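(* Let $Y(t)$, $t>0$, be a centered Gaussian process with covariance $\mathbb{E}\,Y(t)Y(s)=(1-e^{-t-s})/(t+s)$ for $s,t>0$. Then for $0<\varepsilon<1$, $$\log\mathbb{P}\left(\sup_{t>0}|Y(t)|<\varepsilon\right)\asymp-|\log\varepsilon|^3.$$
   Context: Here the relation $\asymp$ means that there exist universal constants $C_1,C_2>0$ (not depending on $\varepsilon$) such that $-C_2|\log\varepsilon|^3\le\log\mathbb{P}\left(\sup_{t>0}|Y(t)|<\varepsilon\right)\le-C_1|\log\varepsilon|^3$ for all $\varepsilon$ in the stated range.
   Formalization: The lower bound fails as ε→1 for any fixed C2, so it is stated for 0<ε≤ε0 with C2 depending on an arbitrary ε0<1 (upper bound: all 0<ε<1, universal C1); Y is assumed to have a.s. continuous paths on t>0 and the event sup|Y|<ε to be measurable. *)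

(* Defs.v *)
From HB Require Import structures.
From mathcomp Require Import all_boot all_order all_algebra.
From mathcomp Require Import all_classical all_reals all_analysis.
Set Implicit Arguments.
Unset Strict Implicit.
Unset Printing Implicit Defensive.
Import Order.TTheory GRing.Theory Num.Theory.
Import numFieldNormedType.Exports.

Local Open Scope classical_set_scope.
Local Open Scope ring_scope.

(* Point masses are listed separately because [normal_prob m 0] is not [\d_m]
   but the uniform law on [0, 1]. *)
Definition gaussian_law (R : realType) (mu : set R -> \bar R) : Prop :=
  (exists m s : R, 0 < s /\
     forall A : set R, measurable A -> mu A = normal_prob m s A) \/
  (exists m : R, forall A : set R, measurable A -> mu A = \d_m A).

Definition gaussian_process (d : measure_display) (T : measurableType d)
    (R : realType) (P : probability T R) (D : set R)
    (Y : R -> {RV P >-> R}) : Prop :=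
  forall (n : nat) (t a : 'I_n -> R), (forall i, D (t i)) ->
    gaussian_law (pushforward P (fun w => \sum_(i < n) a i * Y (t i) w)).

Definition sup_abs (d : measure_display) (T : measurableType d)
    (R : realType) (P : probability T R) (D : set R)
    (Y : R -> {RV P >-> R}) (w : T) : \bar R :=
  ereal_sup [set (`|Y t w|)%:E | t in D].

Definition small_ball_event (d : measure_display) (T : measurableType d)
    (R : realType) (P : probability T R) (D : set R)
    (Y : R -> {RV P >-> R}) (eps : R) : set T :=
  [set w | (sup_abs D Y w < eps%:E)%E].

(* Main.v *)
(* Write [Y t] as the Wiener integral of [expR (- t * u)] over [0 <= u <= 1].  Its covariance is the
   Cauchy kernel [1 / (t + s)] up to a correction that is negligible at large times, and for this
   kernel the distance from [Y t] to the span of [Y p], [p] in a finite set, is explicit: its square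
   is [(2 * t)^-1] times the product of the [((t - p) / (t + p)) ^+ 2].

   Weighting the law by [expR (- a * (Y p_1 ^+ 2 + ... + Y p_n ^+ 2) / 2)] keeps [Y] Gaussian; the mass of
   the weight is governed by the successive distances, and the new variance of [W] is the minimum over
   [c] of the variance of [W + \sum c_i Y p_i] plus [|c|^2 / a].

   Upper bound: among [r ^ 2] nodes in [r] geometric blocks all distances are at least [2 ^ (- O(r))], so
   with [a = eps ^- 2] and [eps <= 2 ^ (- 64 r)] the mass is at most [2 ^ (- c r ^ 3)], whereas the weight
   is at least [expR (- r ^ 2 / 2)] on the small ball event.

   Lower bound: [O(m)] nodes in each of [O(m)] dyadic blocks bring all variances on a fine mesh of
   [[2 ^ (-4m), 2 ^ (2m)]] below [2 ^ (- 8m)], at the cost of a mass [2 ^ (- O(m ^ 3))]; beyond, and between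
   mesh points, the variances were small already.  Chaining under the weighted law then bounds [sup |Y|]
   by [24 * 2 ^ (- m)] on at least half of the mass. *)
Require Import Defs.
From HB Require Import structures.
From mathcomp Require Import all_boot all_order all_algebra.
From mathcomp Require Import all_classical all_reals all_analysis.
From mathcomp Require Import measurable_realfun ring lra zify.
Set Implicit Arguments.
Unset Strict Implicit.
Unset Printing Implicit Defensive.
Import Order.TTheory GRing.Theory Num.Theory.
Import numFieldNormedType.Exports.
Local Open Scope classical_set_scope.
Local Open Scope ring_scope.

(** Conditioning on finitely many values of [Y] would call for multivariate Gaussian densities. The
    weight avoids them: [expR (- (a * X ^+ 2 / 2))] is the characteristic function of N(0, a) at
    [X], so Fubini's theorem and one Gaussian integral give the weighted law of every linear
    combination, and only one-dimensional laws ever occur. The price is the penalty [|c|^2 / a]: an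
    approximation of [Y t] by the nodes helps only if its coefficients are not too large, and these
    are controlled by lower bounds on Blaschke products.

    The two bounds ask opposite things of the nodes. For the upper one every node must stay far from
    all the others, so the blocks are spaced by the ratio 16. For the lower one a time only needs
    the nodes of one block [tau, 2 tau] containing it, so the blocks are adjacent, and [p] nodes
    gain a factor [9 ^- p].

    The upper bound by nodes starts at [eps <= 2 ^- 64]. For larger radii it is enough that the
    probability stays away from 1, which a trigonometric polynomial in a single value of [Y]
    shows. *)

(** * Gaussian integrals *)

(* The bound on [x * h x] only serves to make [h] vanish at infinity. *)
Lemma integral_derive_eq0 (R : realType) (h dh : R -> R) :
  (forall x : R, is_derive x 1 h (dh x)) -> continuous dh ->
  (@lebesgue_measure R).-integrable setT (EFin \o dh) ->
  (exists K, forall x, `|x * h x| <= K) ->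
  (\int[@lebesgue_measure R]_x (dh x)%:E = 0)%E.
Proof.
move=> hd cdh idh [K hK].
have h0 : (h n%:R - h (- n%:R)) @[n --> \oo] --> (0 : R).
  have bnd (n : nat) : `|h n%:R - h (- n%:R)| <= (K + K) / n%:R.
    case: n => [|n]; first by rewrite oppr0 subrr normr0 invr0 mulr0.
    rewrite (le_trans (ler_normB _ _))// mulrDl.
    have n0 : (0 : R) < n.+1%:R by rewrite ltr0n.
    have nn (x : R) : `|x| = n.+1%:R -> `|h x| <= K / n.+1%:R.
      by move=> xn; rewrite ler_pdivlMr// -xn mulrC -normrM.
    by apply: lerD; apply: nn; rewrite ?normrN ger0_norm// ltW.
  apply/norm_cvg0P; apply: (@squeeze_cvgr _ _ _ _ (fun=> 0) (fun n => (K + K) / n%:R)).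
  - by near=> n; rewrite normr_ge0 bnd.
  - exact: cvg_cst.
  - rewrite -[X in _ --> X](mulr0 (K + K)); apply: cvgMl_tmp.
    apply/gtr0_cvgV0; last exact: cvgr_idn.
    by near=> n; rewrite ltr0n; near: n; exists 1%N.
pose D (n : nat) : set R := `[(- n%:R)%R, n%:R]%classic.
pose f_ (n : nat) := (EFin \o dh) \_ (D n).
have mdh : measurable_fun [set: R] (EFin \o dh) by exact: measurable_int idh.
have fE n : (\int[@lebesgue_measure R]_x f_ n x = (h n%:R - h (- n%:R))%:E)%E.
  rewrite -integral_mkcond; case: n => [|n].
    by rewrite /D oppr0 set_itv1 integral_set1 subrr.
  rewrite /D (@continuous_FTC2 _ _ h)//.
  - by have := ltr0Sn R n; lra.
  - exact: continuous_subspaceT.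
  - have ch x : {for x, continuous h}.
      exact/differentiable_continuous/derivable1_diffP.
    by split => //; [exact/cvg_at_right_filter/ch|exact/cvg_at_left_filter/ch].
  - by move=> x _; rewrite derive1E derive_val.
have H1 n : measurable_fun setT (f_ n).
  apply/(measurable_restrictT _ _).1; first exact: measurable_itv.
  exact: measurable_funTS.
have H2 : {ae @lebesgue_measure R, forall x, setT x -> f_ ^~ x @ \oo --> (EFin \o dh) x}.
  apply/aeW => x _.
  apply: cvg_near_cst; near=> n; rewrite /f_ patchE ifT// inE /D/= in_itv/=.
  rewrite -ler_norml; near: n; exact: nbhs_infty_ger.
have H3 : {ae @lebesgue_measure R, forall x n, setT x -> (`|f_ n x| <= (abse \o (EFin \o dh)) x)%E}.
  apply/aeW => x n _; rewrite /f_ patchE; case: ifPn => _ //=.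
  by rewrite normr0 lee_fin.
have [_ _ H] := @dominated_convergence _ (measurableTypeR R) R lebesgue_measure
  setT measurableT f_ (EFin \o dh) (abse \o (EFin \o dh)) H1 mdh H2 (integrable_abse idh) H3.
rewrite -(cvg_lim _ H)//; under eq_fun do rewrite fE.
by apply/cvg_lim => //; apply: cvg_EFin => //; exact: nearW.
Unshelve. all: by end_near. Qed.

Section normal_moments.
Context {R : realType}.
Variables (m s : R).
Hypothesis s0 : 0 < s.
Local Notation mu := (@lebesgue_measure R).
Local Notation pdf := (normal_pdf m s).

Let sn0 : s != 0. Proof. by rewrite gt_eqF. Qed.

Lemma is_derive_normal_pdf (x : R) :
  is_derive x 1 pdf (- ((x - m) / s ^+ 2) * pdf x).
Proof.
rewrite normal_pdfE// /normal_fun.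
apply: trigger_derive.
rewrite /GRing.scale/=; field.
exact: sn0.
Qed.

(** Doubling the standard deviation absorbs the quadratic factor: the quotient of the two
    exponentials is [expR (3 * y / (8 * s ^+ 2))], which exceeds its linear term. With the ratio 2
    of the peaks the constant is 16/3, rounded up to 6. *)
Lemma sqr_normal_pdf_le (x : R) :
  (x - m) ^+ 2 * pdf x <= 6 * s ^+ 2 * normal_pdf m (2 * s) x.
Proof.
have s2n0 : 2 * s != 0 by rewrite mulf_neq0// pnatr_eq0.
rewrite !normal_pdfE//.
have -> : normal_peak (2 * s) = normal_peak s / 2.
  rewrite /normal_peak exprMn -[in LHS]mulrA -[in LHS]mulrnAr sqrtrM//.
  by rewrite sqrtr_sqr ger0_norm// invfM mulrC -mulrnAr.
rewrite /normal_fun; set y := (x - m) ^+ 2.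
have p0 := normal_peak_gt0 sn0.
set A := expR (- y / _); set B := expR (- y / _).
have y0 : 0 <= y by exact: sqr_ge0.
have s20 : 0 < s ^+ 2 by exact: exprn_gt0.
have AB : A * (3 * y / (8 * s ^+ 2)) <= B.
  have -> : B = A * expR (3 * y / (8 * s ^+ 2)).
    by rewrite -expRD /B; congr expR; field.
  rewrite ler_wpM2l ?expR_ge0// (le_trans _ (expR_ge1Dx _))// lerDr//.
have B0 : 0 <= B by exact: expR_ge0.
have -> : y * (normal_peak s * A) = normal_peak s * (8 * s ^+ 2 / 3) * (A * (3 * y / (8 * s ^+ 2))).
  by field.
rewrite (le_trans (ler_wpM2l _ AB))//.
  by have := mulr_gt0 p0 s20; lra.
have : 0 <= normal_peak s * s ^+ 2 * B by rewrite mulr_ge0// ltW// mulr_gt0.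
by lra.
Qed.

Lemma sqr_normal_pdf_bounded (x : R) :
  (x - m) ^+ 2 * pdf x <= 6 * s ^+ 2 * normal_peak (2 * s).
Proof.
rewrite (le_trans (sqr_normal_pdf_le _))//; apply: ler_wpM2l.
  by rewrite mulr_ge0// sqr_ge0.
by apply: normal_pdf_ub; rewrite mulf_neq0// pnatr_eq0.
Qed.

Lemma integrable_normal_quad : mu.-integrable setT
  (fun x => ((1 + (x - m) ^+ 2) * pdf x)%:E).
Proof.
apply: (@le_integrable _ (measurableTypeR R) R mu setT measurableT _
  (fun x => (pdf x + 6 * s ^+ 2 * normal_pdf m (2 * s) x)%:E)).
- apply/measurable_EFinP; apply: measurable_funM; last exact: measurable_normal_pdf.
  by apply: measurable_funD => //; apply: measurable_funX; exact: measurable_funB.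
- move=> x _ /=; rewrite lee_fin mulrDl mul1r !ger0_norm.
  + by rewrite lerD2l sqr_normal_pdf_le.
  + by rewrite addr_ge0 ?normal_pdf_ge0// !mulr_ge0 ?normal_pdf_ge0// ltW.
  + by rewrite addr_ge0 ?normal_pdf_ge0// mulr_ge0 ?sqr_ge0 ?normal_pdf_ge0.
- under eq_fun do rewrite EFinD EFinM.
  apply: integrableD => //; first exact: integrable_normal_pdf.
  by apply: integrableZl => //; exact: integrable_normal_pdf.
Qed.

Lemma integrable_normal_le (g : R -> R) : measurable_fun setT g ->
  (forall x, `|g x| <= 1 + (x - m) ^+ 2) ->
  mu.-integrable setT (fun x => (g x * pdf x)%:E).
Proof.
move=> mg gle; apply: le_integrable integrable_normal_quad => //.
  by apply/measurable_EFinP/measurable_funM => //; exact: measurable_normal_pdf.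
move=> x _ /=; rewrite lee_fin !normrM ler_wpM2r// (le_trans (gle x))//.
exact: ler_norm.
Qed.

Lemma continuous_of_derive (h dh : R -> R) :
  (forall x : R, is_derive x 1 h (dh x)) -> continuous h.
Proof.
by move=> hd x; apply/differentiable_continuous/derivable1_diffP; have [] := hd x.
Qed.

Lemma normal_center : (\int[mu]_x ((x - m) * pdf x)%:E = 0)%E.
Proof.
have hd (x : R) : is_derive x 1 (fun x => - (s ^+ 2) * pdf x) ((x - m) * pdf x).
  have ? := is_derive_normal_pdf x.
  apply: trigger_derive; rewrite /GRing.scale/=; field.
  exact: sn0.
apply: (integral_derive_eq0 hd).
- move=> x; apply: cvgM; last exact: continuous_normal_pdf.
  by apply: cvgB; [exact: cvg_id|exact: cvg_cst].
- apply: integrable_normal_le; first exact: measurable_funB.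
  move=> x; rewrite -[(x - m) ^+ 2]real_normK ?num_real//.
  have : 0 <= (`|x - m| - 1) ^+ 2 by exact: sqr_ge0.
  have := normr_ge0 (x - m).
  by rewrite sqrrB1; nra.
- exists (s ^+ 2 * (6 * s ^+ 2 * normal_peak (2 * s) + (1 + `|m|) * normal_peak s)) => x.
  rewrite mulrCA normrM normrN (ger0_norm (sqr_ge0 s)); apply: ler_wpM2l; first exact: sqr_ge0.
  rewrite normrM (ger0_norm (normal_pdf_ge0 _ _ _)).
  have H1 := sqr_normal_pdf_bounded x.
  have H2 := normal_pdf_ub m x sn0.
  have H3 := normal_pdf_ge0 m s x.
  have xle : `|x| <= (x - m) ^+ 2 + (1 + `|m|).
    rewrite -{1}(subrK m x) (le_trans (ler_normD _ _))// addrA lerD2r.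
    rewrite -[(x - m) ^+ 2]real_normK ?num_real//.
    have : 0 <= (`|x - m| - 1) ^+ 2 by exact: sqr_ge0.
    have := normr_ge0 (x - m).
    by rewrite sqrrB1; nra.
  rewrite (le_trans (ler_wpM2r H3 xle))// mulrDl lerD// ler_wpM2l//.
Qed.

Lemma normal_variance : (\int[mu]_x ((x - m) ^+ 2 * pdf x)%:E = (s ^+ 2)%:E)%E.
Proof.
have hd (x : R) : is_derive x 1 (fun x => - (s ^+ 2) * ((x - m) * pdf x))
    (((x - m) ^+ 2 - s ^+ 2) * pdf x).
  have ? := is_derive_normal_pdf x.
  apply: trigger_derive; rewrite /GRing.scale/=; field.
  exact: sn0.
have msq : measurable_fun setT (fun x : R => (x - m) ^+ 2).
  by apply: measurable_funX; exact: measurable_funB.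
have isq : mu.-integrable setT (fun x => ((x - m) ^+ 2 * pdf x)%:E).
  by apply: integrable_normal_le => // x; rewrite ger0_norm ?sqr_ge0// lerDr.
have ipdf := integrable_normal_pdf m s.
have ispdf : mu.-integrable setT (fun x => (s ^+ 2)%:E * (pdf x)%:E)%E.
  by apply: integrableZl.
have /= := integral_derive_eq0 hd.
under eq_integral do rewrite mulrBl EFinB [(s ^+ 2 * _)%:E]EFinM.
rewrite integralB// integralZl// integral_normal_pdf mule1 => H.
rewrite -[LHS](@subeK _ _ (s ^+ 2)%:E)// H ?add0e//.
- move=> x; apply: cvgM; last exact: continuous_normal_pdf.
  apply: cvgB; last exact: cvg_cst.
  by apply: (cvg_comp (fun z => z - m) (fun z => z ^+ 2)); [apply: cvgB; [exact: cvg_id|exact: cvg_cst]|exact: exprn_continuous].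
- rewrite (_ : _ \o _ = fun x => ((x - m) ^+ 2 * pdf x)%:E - (s ^+ 2)%:E * (pdf x)%:E)%E; last first.
    by apply/funext => x /=; rewrite mulrBl.
  exact: integrableB.
- exists (s ^+ 2 * (2 * (6 * s ^+ 2 * normal_peak (2 * s)) + `|m| ^+ 2 * normal_peak s)) => x.
  rewrite mulrCA normrM normrN (ger0_norm (sqr_ge0 s)); apply: ler_wpM2l; first exact: sqr_ge0.
  rewrite (mulrA x) normrM (ger0_norm (normal_pdf_ge0 m s x)).
  have H1 := sqr_normal_pdf_bounded x.
  have H2 := normal_pdf_ub m x sn0.
  have H3 := normal_pdf_ge0 m s x.
  have xle : `|x * (x - m)| <= 2 * (x - m) ^+ 2 + `|m| ^+ 2.
    rewrite -{1}(subrK m x) mulrDl (le_trans (ler_normD _ _))//.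
    rewrite -expr2 !normrM -[(x - m) ^+ 2]real_normK ?num_real//.
    have := normr_ge0 (x - m); have := normr_ge0 m.
    by nra.
  rewrite (le_trans (ler_wpM2r H3 xle))// mulrDl lerD//; last first.
    by rewrite ler_wpM2l.
  by lra.
Qed.

End normal_moments.

Section normal_cos.
Context {R : realType}.
Variable s : R.
Hypothesis s0 : 0 < s.
Local Notation mu := (@lebesgue_measure R).
Local Notation pdf := (normal_pdf 0 s).

Let abs_le (x : R) : `|x| <= 1 + (x - 0) ^+ 2.
Proof.
rewrite subr0 -[x ^+ 2]real_normK ?num_real//.
by have := normr_ge0 x; have := sqr_ge0 (`|x| - 1); rewrite sqrrB1; nra.
Qed.

Let le_quad (g : R -> R) : (forall x, `|g x| <= 1) ->
  (forall x, `|g x| <= 1 + (x - 0) ^+ 2).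
Proof. by move=> g1 x; rewrite (le_trans (g1 x))// lerDl sqr_ge0. Qed.

Let le_quadM (g : R -> R) : (forall x, `|g x| <= 1) ->
  (forall x, `|x * g x| <= 1 + (x - 0) ^+ 2).
Proof.
by move=> g1 x; rewrite (le_trans _ (abs_le x))// normrM ler_piMr.
Qed.

Let mcos (a : R) : measurable_fun setT (fun x => cos (a * x)).
Proof.
apply: continuous_measurable_fun => x; apply: (@continuous_comp _ _ _ ( *%R a) cos).
  exact: mulrl_continuous.
exact: continuous_cos.
Qed.

Let msin (a : R) : measurable_fun setT (fun x => sin (a * x)).
Proof.
apply: continuous_measurable_fun => x; apply: (@continuous_comp _ _ _ ( *%R a) sin).
  exact: mulrl_continuous.
exact: continuous_sin.
Qed.

Lemma integrable_cos_normal (a : R) :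
  mu.-integrable setT (fun x => (cos (a * x) * pdf x)%:E).
Proof.
by apply: integrable_normal_le => //; apply: le_quad => x; exact: cos_max.
Qed.

Let isin (a : R) : mu.-integrable setT (fun x => (x * sin (a * x) * pdf x)%:E).
Proof.
apply: integrable_normal_le => //; first exact: measurable_funM.
by apply: (@le_quadM (fun x => sin (a * x))) => x; exact: sin_max.
Qed.

Let F a := (\int[mu]_x (cos (a * x) * pdf x))%R.
Let S a := (\int[mu]_x (x * sin (a * x) * pdf x))%R.

(** Gaussian integration by parts (Stein's identity) for [sin (a * x)]. It turns the derivative of
    [F] back into a multiple of [F]. *)
Let stein a : S a = s ^+ 2 * a * F a.
Proof.
have hd (x : R) : is_derive x 1 (fun x => s ^+ 2 * (sin (a * x) * pdf x))
    (s ^+ 2 * a * (cos (a * x) * pdf x) - x * sin (a * x) * pdf x).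
  have ? := is_derive_normal_pdf 0 s0 x.
  have ? : is_derive x 1 (fun x => sin (a * x)) (a * cos (a * x)).
    by apply: trigger_derive; rewrite /GRing.scale/=; ring.
  apply: trigger_derive; rewrite /GRing.scale/=; field.
  by rewrite gt_eqF.
have i1 : mu.-integrable setT (fun x => (s ^+ 2 * a * (cos (a * x) * pdf x))%:E).
  under eq_fun do rewrite EFinM.
  by apply: integrableZl => //; exact: integrable_cos_normal.
have idh : mu.-integrable setT
    (EFin \o (fun x => s ^+ 2 * a * (cos (a * x) * pdf x) - x * sin (a * x) * pdf x)).
  rewrite (_ : _ \o _ = fun x => (s ^+ 2 * a * (cos (a * x) * pdf x))%:E - (x * sin (a * x) * pdf x)%:E)%E; last first.
    by apply/funext => x /=.
  by apply: integrableB.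
have H : (\int[mu]_x (s ^+ 2 * a * (cos (a * x) * pdf x) - x * sin (a * x) * pdf x)%:E = 0)%E.
  apply: (integral_derive_eq0 hd) => //.
  - move=> x; have cp := continuous_normal_pdf (m := 0) (lt0r_neq0 s0).
    have cc : continuous (fun x => cos (a * x)).
      move=> z; apply: (@continuous_comp _ _ _ ( *%R a) cos); first exact: mulrl_continuous.
      exact: continuous_cos.
    have cs : continuous (fun x => sin (a * x)).
      move=> z; apply: (@continuous_comp _ _ _ ( *%R a) sin); first exact: mulrl_continuous.
      exact: continuous_sin.
    apply: cvgB; first by apply: cvgMl_tmp; apply: cvgM; [exact: cc|exact: cp].
    apply: cvgM; last exact: cp.
    by apply: cvgM; [exact: cvg_id|exact: cs].
  - exists (s ^+ 2 * (6 * s ^+ 2 * normal_peak (2 * s) + normal_peak s)) => x.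
    rewrite mulrCA normrM (ger0_norm (sqr_ge0 s)); apply: ler_wpM2l; first exact: sqr_ge0.
    rewrite (mulrA x) normrM (ger0_norm (normal_pdf_ge0 0 s x)).
    have H1 := sqr_normal_pdf_bounded 0 s0 x.
    have H2 := normal_pdf_ub 0 x (lt0r_neq0 s0).
    have H3 := normal_pdf_ge0 0 s x.
    have H4 : `|x * sin (a * x)| <= 1 + (x - 0) ^+ 2.
      by apply: (@le_quadM (fun x => sin (a * x))) => z; exact: sin_max.
    rewrite (le_trans (ler_wpM2r H3 H4))// mulrDl mul1r addrC.
    by rewrite lerD.
have E : (\int[mu]_x (s ^+ 2 * a * (cos (a * x) * pdf x) - x * sin (a * x) * pdf x))%R
    = s ^+ 2 * a * F a - S a.
  apply: etrans; first exact: (@RintegralB _ (measurableTypeR R) R mu setT _ _ measurableT i1 (isin a)).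
  by congr (_ - _); apply: (@RintegralZl _ (measurableTypeR R) R mu setT _ _ measurableT (integrable_cos_normal a)).
have H' := esym (congr1 fine H).
by move/eqP: (etrans H' E); rewrite eq_sym subr_eq0 => /eqP <-.
Qed.

Let dF (a : R) : is_derive a 1 F (- (s ^+ 2 * a * F a)).
Proof.
pose f (a x : R) := cos (a * x) * pdf x.
have df (u x : R) : is_derive u 1 (f^~ x) (- (x * sin (u * x) * pdf x)).
  have ? : is_derive u 1 (fun u => cos (u * x)) (- (x * sin (u * x))).
    by apply: trigger_derive; rewrite /GRing.scale/=; ring.
  by apply: trigger_derive; rewrite /GRing.scale/=; ring.
have aI : `]a - 1, a + 1[%classic a by rewrite /= in_itv/=; apply/andP; split; lra.
have H1 x : `]a - 1, a + 1[%classic x -> mu.-integrable setT (EFin \o f x).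
  by move=> _; exact: integrable_cos_normal.
have H2 x y : `]a - 1, a + 1[%classic x -> setT y -> derivable (f ^~ y) x 1.
  by move=> _ _; have [] := df x y.
pose G (x : R) := (1 + (x - 0) ^+ 2) * pdf x.
have G0 x : 0 <= G x by rewrite mulr_ge0 ?normal_pdf_ge0// addr_ge0// sqr_ge0.
have iG : mu.-integrable setT (EFin \o G) by exact: integrable_normal_quad.
have d1f x y : partial1of2 f x y = - (y * sin (x * y) * pdf y).
  by rewrite partial1of2E; have [_ ->] := df x y.
have H3 x y : `]a - 1, a + 1[%classic x -> setT y -> `|partial1of2 f x y| <= G y.
  move=> _ _; rewrite d1f normrN normrM (ger0_norm (normal_pdf_ge0 0 s y)).
  apply: ler_wpM2r; first exact: normal_pdf_ge0.
  by apply: (@le_quadM (fun y => sin (x * y))) => z; exact: sin_max.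
have D1 := derivable_under_integral measurableT aI H1 H2 G0 iG H3.
have D2 := differentiation_under_integral measurableT aI H1 H2 G0 iG H3.
apply: DeriveDef => //.
rewrite -derive1E; apply: etrans D2 _.
under eq_Rintegral do rewrite d1f -mulN1r.
apply: etrans; first exact: (@RintegralZl _ (measurableTypeR R) R mu setT _ _ measurableT (isin a)).
by rewrite -/(S a) mulN1r stein.
Qed.

(** By [dF] the function [F] solves F' = - s^2 a F, so its product with [expR (a ^+ 2 * s ^+ 2 / 2)]
    is constant, equal to its value at 0. *)
Lemma normal_cos (a : R) :
  (\int[mu]_x (cos (a * x) * pdf x)%:E = (expR (- (a ^+ 2 * s ^+ 2 / 2)))%:E)%E.
Proof.
have g0 (x : R) : is_derive x 1 (fun a => F a * expR (a ^+ 2 * s ^+ 2 / 2)) 0.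
  have ? := dF x.
  by apply: trigger_derive; rewrite /GRing.scale/=; field.
have := @is_derive_0_is_cst R _ a 0 g0.
rewrite expr0n/= !mul0r expR0 mulr1 {2}/F.
under eq_Rintegral do rewrite mul0r cos0 mul1r.
rewrite [in RHS]/Rintegral integral_normal_pdf/= => H.
rewrite -[LHS]fineK; last exact/integrable_fin_num/integrable_cos_normal.
congr EFin; rewrite -/(Rintegral _ _ _) -/(F a).
apply: (mulIf (lt0r_neq0 (expR_gt0 (a ^+ 2 * s ^+ 2 / 2)))).
by rewrite H expRN mulVf// lt0r_neq0// expR_gt0.
Qed.

End normal_cos.

Section normal_second_moment.
Context {R : realType}.
Local Notation mu := (@lebesgue_measure R).

Lemma ge0_integral_normal (m s : R) (f : R -> R) : measurable_fun setT f ->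
  (forall x, 0 <= f x) ->
  (\int[normal_prob m s]_x (f x)%:E = \int[mu]_x (f x * normal_pdf m s x)%:E)%E.
Proof.
move=> mf f0; have dom := normal_prob_dominates m s.
rewrite -(@Radon_Nikodym_SigmaFinite.change_of_variables _ _ _ (normal_prob m s) mu dom)//; last exact/measurable_EFinP.
have i1 := Radon_Nikodym_SigmaFinite.f_integrable dom.
have i2 := integrable_normal_pdf m s.
apply: ae_eq_integral => //.
- apply: emeasurable_funM; first exact/measurable_EFinP.
  exact: measurable_int i1.
- by apply/measurable_EFinP/measurable_funM => //; exact: measurable_normal_pdf.
- have : ae_eq mu setT (Radon_Nikodym_SigmaFinite.f (normal_prob m s) mu)
      (fun x => (normal_pdf m s x)%:E).
    apply: integral_ae_eq => //.
      by apply/measurable_EFinP; exact: measurable_normal_pdf.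
    by move=> E _ mE; rewrite -Radon_Nikodym_SigmaFinite.f_integral.
  by apply: filterS => x /= H /H ->.
Qed.

Lemma normal_sqr (m s c : R) : 0 < s ->
  (\int[mu]_x ((x - c) ^+ 2 * normal_pdf m s x)%:E = (s ^+ 2 + (m - c) ^+ 2)%:E)%E.
Proof.
move=> s0.
have i1 : mu.-integrable setT (fun x => ((x - m) ^+ 2 * normal_pdf m s x)%:E).
  apply: integrable_normal_le => //; first by apply: measurable_funX; exact: measurable_funB.
  by move=> x; rewrite ger0_norm ?sqr_ge0// lerDr.
have i2 : mu.-integrable setT (fun x => ((x - m) * normal_pdf m s x)%:E).
  apply: integrable_normal_le => //; first exact: measurable_funB.
  move=> x; rewrite -[(x - m) ^+ 2]real_normK ?num_real//.
  have : 0 <= (`|x - m| - 1) ^+ 2 by exact: sqr_ge0.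
  have := normr_ge0 (x - m).
  by rewrite sqrrB1; nra.
have i3 := integrable_normal_pdf m s.
have i2' : mu.-integrable setT (fun x => (2 * (m - c))%:E * ((x - m) * normal_pdf m s x)%:E)%E.
  exact: integrableZl.
have i3' : mu.-integrable setT (fun x => ((m - c) ^+ 2)%:E * (normal_pdf m s x)%:E)%E.
  exact: integrableZl.
transitivity (\int[mu]_x (((x - m) ^+ 2 * normal_pdf m s x)%:E
   + ((2 * (m - c))%:E * ((x - m) * normal_pdf m s x)%:E
   + ((m - c) ^+ 2)%:E * (normal_pdf m s x)%:E)))%E.
  by apply: eq_integral => x _; rewrite -!EFinM -!EFinD; congr EFin; ring.
rewrite integralD//; last exact: integrableD.
rewrite integralD// !integralZl//.
by rewrite normal_variance// normal_center// integral_normal_pdf mule0 add0e mule1.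
Qed.

End normal_second_moment.

Section gaussian_rv.
Context d (T : measurableType d) (R : realType) (P : probability T R).
Local Notation mu := (@lebesgue_measure R).

Let law_integral (W : T -> R) (nu : {measure set (measurableTypeR R) -> \bar R}) (f : R -> R) :
  measurable_fun setT W -> measurable_fun setT f -> (forall x, 0 <= f x) ->
  (forall A : set R, measurable A -> pushforward P W A = nu A) ->
  (\int[P]_w (f (W w))%:E = \int[nu]_x (f x)%:E)%E.
Proof.
move=> mW mf f0 WE.
have mEf : measurable_fun setT (EFin \o f) by exact/measurable_EFinP.
have := @ge0_integral_pushforward _ _ T (measurableTypeR R) R W mW P setT (EFin \o f) measurableT mEf.
rewrite preimage_setT => <-; last by move=> y _; rewrite lee_fin.
by apply: eq_measure_integral => A mA _; exact: WE.
Qed.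

(** The parameters of the law are not given; the first two moments identify them. They are read off
    from the second moments about 0 and about -1, so that only nonnegative functions have to be
    integrated against the law. *)
Lemma gaussian_law_cos (W : T -> R) (V : R) : measurable_fun setT W ->
  gaussian_law (pushforward P W) ->
  (\int[P]_w (W w)%:E = 0)%E -> (\int[P]_w (W w ^+ 2)%:E = V%:E)%E ->
  (\int[P]_w (cos (W w))%:E = (expR (- (V / 2)))%:E)%E.
Proof.
move=> mW gW W1 W2.
have mW2 : measurable_fun setT (fun w => W w ^+ 2) by exact: measurable_funX.
have iW2 : P.-integrable setT (fun w => (W w ^+ 2)%:E).
  apply/integrableP; split; first exact/measurable_EFinP.
  under eq_integral do rewrite gee0_abs ?lee_fin ?sqr_ge0//.
  by rewrite W2 ltry.
have i1 : P.-integrable setT (fun w => 1%:E : \bar R).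
  exact: finite_measure_integrable_cst.
have I1 : (\int[P]_w 1%:E = 1)%E.
  by rewrite integral_cst// mul1e; exact: probability_setT.
have iW : P.-integrable setT (fun w => (W w)%:E).
  apply: (@le_integrable _ T R P setT measurableT _ (fun w => (1%:E + (W w ^+ 2)%:E)%E)).
  - exact/measurable_EFinP.
  - move=> x _ /=; rewrite lee_fin [leRHS]ger0_norm ?addr_ge0 ?sqr_ge0//.
    rewrite -[W x ^+ 2]real_normK ?num_real//.
    by have := normr_ge0 (W x); have := sqr_ge0 (`|W x| - 1); rewrite sqrrB1; nra.
  - exact: integrableD.
have W3 : (\int[P]_w ((W w + 1) ^+ 2)%:E = (V + 1)%:E)%E.
  transitivity (\int[P]_w ((W w ^+ 2)%:E + (2%:E * (W w)%:E + 1%:E)))%E.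
    by apply: eq_integral => x _; rewrite -EFinM -!EFinD; congr EFin; ring.
  have i2 : P.-integrable setT (fun w => 2%:E * (W w)%:E)%E by exact: integrableZl.
  rewrite integralD//; last exact: integrableD.
  by rewrite integralD// integralZl// W1 W2 mule0 add0e I1.
have mcos : measurable_fun setT (fun w => cos (W w)).
  apply: measurableT_comp => //; by apply: continuous_measurable_fun; exact: continuous_cos.
have icos : P.-integrable setT (fun w => (cos (W w))%:E).
  apply: le_integrable i1 => //; first exact/measurable_EFinP.
  by move=> x _; rewrite lee_fin normr1; exact: cos_max.
have mcosR : measurable_fun setT (fun x : R => 1 + cos x).
  apply: measurable_funD => //; by apply: continuous_measurable_fun; exact: continuous_cos.
(* Adding 1 makes the integrand nonnegative, as [law_integral] requires. *)
suff : (\int[P]_w (1 + cos (W w))%:E = (1 + expR (- (V / 2)))%:E)%E.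
  under eq_integral do rewrite EFinD.
  rewrite integralD// I1 EFinD => H.
  move: (integrable_fin_num measurableT icos) H.
  case: (\int[P]_w (cos (W w))%:E)%E => // x _.
  by rewrite -EFinD => -[/addrI ->].
have cos1 (x : R) : 0 <= 1 + cos x.
  by have := cos_max x; rewrite ler_norml => /andP[+ _]; lra.
have msqr (c : R) : measurable_fun setT (fun x : R => (x - c) ^+ 2).
  by apply: measurable_funX; exact: measurable_funB.
have sq0 (c x : R) : 0 <= (x - c) ^+ 2 by exact: sqr_ge0.
case: gW => [[m [s [s0 WE]]]|[m WE]].
- have E c : (\int[P]_w ((W w - c) ^+ 2)%:E = (s ^+ 2 + (m - c) ^+ 2)%:E)%E.
    rewrite (law_integral mW (msqr c) (sq0 c) WE) ge0_integral_normal//.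
    exact: normal_sqr.
  have E0 : (\int[P]_w (W w ^+ 2)%:E = \int[P]_w ((W w - 0) ^+ 2)%:E)%E.
    by apply: eq_integral => w _; rewrite subr0.
  have E1 : (\int[P]_w ((W w + 1) ^+ 2)%:E = \int[P]_w ((W w - - 1) ^+ 2)%:E)%E.
    by apply: eq_integral => w _; rewrite opprK.
  move: E1 E0; rewrite !E W2 W3 => -[H1] [H2].
  have m0 : m = 0 by move: H1 H2; lra.
  subst m; rewrite (law_integral mW mcosR cos1 WE) ge0_integral_normal//.
  under eq_integral do rewrite mulrDl mul1r EFinD.
  have ic : mu.-integrable setT (fun x => (cos x * normal_pdf 0 s x)%:E).
    have := integrable_cos_normal s0 1.
    by under eq_fun do rewrite mul1r.
  rewrite integralD//; last exact: integrable_normal_pdf.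
  rewrite integral_normal_pdf EFinD; congr (_ + _)%E.
  transitivity (\int[mu]_x (cos (1 * x) * normal_pdf 0 s x)%:E)%E.
    by apply: eq_integral => x _; rewrite mul1r.
  rewrite normal_cos//; congr (expR _)%:E.
  by move: H2; rewrite subrr expr0n/= addr0 => ->; rewrite expr1n mul1r.
- have E c : (\int[P]_w ((W w - c) ^+ 2)%:E = ((m - c) ^+ 2)%:E)%E.
    rewrite (@law_integral W (@dirac _ (measurableTypeR R) m R) (fun x => (x - c) ^+ 2)
      mW (msqr c) (sq0 c) WE) integral_dirac//.
      by rewrite diracT mul1e.
    by apply/measurable_EFinP; exact: (msqr c).
  have E0 : (\int[P]_w (W w ^+ 2)%:E = \int[P]_w ((W w - 0) ^+ 2)%:E)%E.
    by apply: eq_integral => w _; rewrite subr0.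
  have E1 : (\int[P]_w ((W w + 1) ^+ 2)%:E = \int[P]_w ((W w - - 1) ^+ 2)%:E)%E.
    by apply: eq_integral => w _; rewrite opprK.
  move: E1 E0; rewrite !E W2 W3 => -[H1] [H2].
  have m0 : m = 0 by move: H1 H2; lra.
  subst m; rewrite (@law_integral W (@dirac _ (measurableTypeR R) 0 R) (fun x => 1 + cos x)
    mW mcosR cos1 WE) integral_dirac//;
    last by apply/measurable_EFinP; exact: mcosR.
  rewrite diracT mul1e cos0 H2 subrr expr0n/= mul0r oppr0 expR0.
  by [].
Qed.

End gaussian_rv.

(** * Gaussian weights *)

Section gaussian_tilt.
Context {R : realType}.
Local Notation mu := (@lebesgue_measure R).

(** Completing the square: the integrand is a constant times the normal density of mean [m'] and
    variance [s ^+ 2 / (1 + s ^+ 2 * q)]. *)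
Lemma normal_exp_quad (s q0 be q : R) : 0 < s -> 0 <= q ->
  (\int[mu]_x (expR (- (q0 + 2 * x * be + x ^+ 2 * q) / 2) * normal_pdf 0 s x)%:E
  = ((Num.sqrt (1 + s ^+ 2 * q))^-1
     * expR (- (q0 - be ^+ 2 / (s ^- 2 + q)) / 2))%:E)%E.
Proof.
move=> s0 q_ge0; set D := 1 + s ^+ 2 * q.
have D0 : 0 < D by rewrite ltr_wpDr// mulr_ge0// sqr_ge0.
have rD : 0 < Num.sqrt D by rewrite sqrtr_gt0.
have rDD : Num.sqrt D ^+ 2 = D by rewrite sqr_sqrtr// ltW.
pose s' := s / Num.sqrt D.
have s'0 : 0 < s' by rewrite divr_gt0.
have sn0 : s != 0 by rewrite gt_eqF.
have s'n0 : s' != 0 by rewrite gt_eqF.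
have Dn0 : D != 0 by rewrite gt_eqF.
pose m' := - be * s' ^+ 2.
transitivity (\int[mu]_x (((Num.sqrt D)^-1
    * expR (- (q0 - be ^+ 2 / (s ^- 2 + q)) / 2))%:E * (normal_pdf m' s' x)%:E))%E.
  apply: eq_integral => x _; rewrite -EFinM; congr EFin.
  rewrite !normal_pdfE//.
  have -> : normal_peak s' = normal_peak s * Num.sqrt D.
    have pE (r : R) : 0 < r -> normal_peak r = (r * Num.sqrt (pi *+ 2))^-1.
      move=> r0; rewrite /normal_peak -mulrnAr sqrtrM ?sqr_ge0// sqrtr_sqr.
      by rewrite ger0_norm// ltW.
    rewrite !pE// /s' !invfM invrK; ring.
  rewrite /normal_fun; set E1 := expR _; set E2 := expR _.
  set E3 := expR _; set E4 := expR _.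
  rewrite mulrCA; suff -> : E1 * E2 = E3 * E4.
    by field; rewrite gt_eqF.
  rewrite -!expRD; congr expR; rewrite /m' /s' exprMn exprVn rDD /D.
  have ? : 1 + s ^+ 2 * q != 0 by [].
  have ? : q * s ^+ 2 + 1 != 0 by rewrite addrC mulrC.
  field.
  by do ?[apply/andP; split] => //.
rewrite integralZl//; last exact: integrable_normal_pdf.
by rewrite integral_normal_pdf mule1.
Qed.

End gaussian_tilt.

Section tilted.
Context d (T : measurableType d) (R : realType) (P : probability T R).
Local Notation mu := (@lebesgue_measure R).
(** [H] will be the linear span of the process. Bilinear forms are constrained on [H] only. *)
Variable H : (T -> R) -> Prop.
Hypothesis HD : forall V W (c : R), H V -> H W -> H (fun w => V w + c * W w).
Hypothesis Hm : forall W, H W -> measurable_fun setT W.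

Record psd (b : (T -> R) -> (T -> R) -> R) : Prop := Psd {
  psd_sym : forall V W, H V -> H W -> b V W = b W V ;
  psd_lin : forall U V W (c : R), H U -> H V -> H W ->
    b (fun w => V w + c * W w) U = b V U + c * b W U ;
  psd_ge0 : forall V, H V -> 0 <= b V V }.

(* Weighted by [G], of total mass [M], every [W] in [H] is still a centered Gaussian, now of
   variance [b W W]; [tilted_cos] says so through the characteristic function. *)
Record tilted (G : T -> R) (M : R) (b : (T -> R) -> (T -> R) -> R) : Prop := Tilted {
  tilted_psd : psd b ;
  tilted_meas : measurable_fun setT G ;
  tilted_ge0 : forall w, 0 <= G w ;
  tilted_le1 : forall w, G w <= 1 ;
  tilted_gt0 : 0 < M ;
  tilted_cos : forall W, H W ->
    (\int[P]_w (cos (W w) * G w)%:E = (M * expR (- b W W / 2))%:E)%E }.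

Lemma psd_quad b V W (c : R) : psd b -> H V -> H W ->
  b (fun w => V w + c * W w) (fun w => V w + c * W w)
  = b V V + 2 * c * b V W + c ^+ 2 * b W W.
Proof.
move=> [bsym blin _] HV HW; have HVW := HD c HV HW.
rewrite blin// (bsym V)// (bsym W)// !blin// (bsym W V)//; ring.
Qed.

(** The conditional covariance given an observation of [X] blurred by independent noise of variance
    [a^-1]. *)
Definition tilt_form (a : R) (X : T -> R) b (V W : T -> R) : R :=
  b V W - b V X * b W X / (a^-1 + b X X).

(** The right side is quadratic in [c]; subtracting the left side leaves a square divided by
    [a^-1 + b X X]. The square vanishes at the [c] chosen in [tilt_form_attained]. *)
Lemma tilt_form_min (a : R) X b W (c : R) : 0 < a -> psd b -> H X -> H W ->
  tilt_form a X b W W <= b (fun w => W w + c * X w) (fun w => W w + c * X w) + c ^+ 2 / a.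
Proof.
move=> a0 pb HX HW; rewrite psd_quad// /tilt_form.
have q0 : 0 <= b X X by exact: psd_ge0.
have ai : 0 < a^-1 by rewrite invr_gt0.
set q := b X X in q0 *; set be := b W X.
have D0 : 0 < a^-1 + q by rewrite ltr_wpDr.
rewrite -subr_ge0.
have -> : b W W + 2 * c * be + c ^+ 2 * q + c ^+ 2 / a - (b W W - be * be / (a^-1 + q))
   = (be + c * (a^-1 + q)) ^+ 2 / (a^-1 + q).
  by move: (a^-1) ai D0 => i _ D0; field; rewrite gt_eqF.
by rewrite divr_ge0 ?sqr_ge0// ltW.
Qed.

Lemma tilt_form_attained (a : R) X b W : 0 < a -> psd b -> H X -> H W ->
  exists c, tilt_form a X b W W =
    b (fun w => W w + c * X w) (fun w => W w + c * X w) + c ^+ 2 / a.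
Proof.
move=> a0 pb HX HW; exists (- (b W X / (a^-1 + b X X))).
rewrite psd_quad// /tilt_form.
have q0 : 0 <= b X X by exact: psd_ge0.
have ai : 0 < a^-1 by rewrite invr_gt0.
set q := b X X in q0 *; set be := b W X.
have D0 : 0 < a^-1 + q by rewrite ltr_wpDr.
by move: (a^-1) ai D0 => i _ D0; field; rewrite gt_eqF.
Qed.

Lemma psd_tilt_form (a : R) X b : 0 < a -> psd b -> H X -> psd (tilt_form a X b).
Proof.
move=> a0 pb HX; case: (pb) => bsym blin bge0; split.
- by move=> V W HV HW; rewrite /tilt_form bsym// (mulrC (b V X)).
- by move=> U V W c HU HV HW; rewrite /tilt_form !blin//; ring.
- move=> W HW; have [c ->] := tilt_form_attained a0 pb HX HW.
  apply: addr_ge0; first by apply: bge0; exact: HD.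
  by rewrite divr_ge0 ?sqr_ge0// ltW.
Qed.

Lemma tilted_integrable (G f : T -> R) : measurable_fun setT G -> (forall w, 0 <= G w) ->
  (forall w, G w <= 1) -> measurable_fun setT f -> (forall w, `|f w| <= 1) ->
  P.-integrable setT (fun w => (f w * G w)%:E).
Proof.
move=> mG G0 G1 mf f1.
have i1 : P.-integrable setT (fun w => 1%:E : \bar R).
  exact: finite_measure_integrable_cst.
apply: le_integrable i1 => //.
  by apply/measurable_EFinP/measurable_funM.
move=> w _; rewrite lee_fin normr1 normrM -[leRHS]mulr1 ler_pM//.
by rewrite ger0_norm.
Qed.

Let mcos : measurable_fun setT (@cos R).
Proof. by apply: continuous_measurable_fun; exact: continuous_cos. Qed.

(* The new weight is the characteristic function of N(0, a) at [X w]; by Fubini this reduces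
   the step to [tilted_cos] for [W + x X] and a Gaussian integral in [x]. *)
Lemma tilted_step G M b (a : R) X : 0 < a -> H X -> tilted G M b ->
  tilted (fun w => G w * expR (- (a * X w ^+ 2 / 2)))
    (M / Num.sqrt (1 + a * b X X)) (tilt_form a X b).
Proof.
move=> a0 HX [pb mG G0 G1 M0 cosG].
have q0 : 0 <= b X X by exact: psd_ge0.
have mX := Hm HX.
split.
- exact: psd_tilt_form.
- apply: measurable_funM => //; apply: measurableT_comp => //.
  by apply: measurableT_comp => //; do 2?apply: measurable_funM => //;
    exact: measurable_funX.
- by move=> w; rewrite mulr_ge0// expR_ge0.
- move=> w; rewrite -[leRHS]mulr1 ler_pM ?expR_ge0//.
  by rewrite -expR0 ler_expR oppr_le0 divr_ge0// mulr_ge0 ?sqr_ge0 ?ltW.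
- by rewrite divr_gt0// sqrtr_gt0 ltr_wpDr// mulr_ge0// ltW.
move=> W HW; have mW := Hm HW.
pose s := Num.sqrt a.
have s0 : 0 < s by rewrite sqrtr_gt0.
have sa : s ^+ 2 = a by rewrite sqr_sqrtr// ltW.
pose f (z : T * measurableTypeR R) : R :=
  cos (W z.1) * G z.1 * (cos (X z.1 * z.2) * normal_pdf 0 s z.2).
have mf : measurable_fun setT f.
  apply: measurable_funM; apply: measurable_funM.
  - by apply: measurableT_comp => //; apply: measurableT_comp => //; exact: measurable_fst.
  - by apply: measurableT_comp => //; exact: measurable_fst.
  - apply: measurableT_comp => //; apply: measurable_funM; last exact: measurable_snd.
    by apply: measurableT_comp => //; exact: measurable_fst.
  - apply: (measurableT_comp (measurable_normal_pdf 0 s)); exact: measurable_snd.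
have fle z : `|f z| <= normal_pdf 0 s z.2.
  rewrite /f !normrM (ger0_norm (normal_pdf_ge0 _ _ _)) -[leRHS]mul1r mulrA.
  apply: ler_wpM2r; first exact: normal_pdf_ge0.
  rewrite -[leRHS]mulr1 ler_pM ?mulr_ge0 ?cos_max//.
  by rewrite -[leRHS]mulr1 ler_pM ?cos_max// ger0_norm.
have I1 : (\int[P]_w 1%:E = 1)%E.
  by rewrite integral_cst// mul1e; exact: probability_setT.
have mEf : measurable_fun setT (EFin \o f) by exact/measurable_EFinP.
have intf : (P \x mu)%E.-integrable setT (EFin \o f).
  apply/integrable12ltyP => //.
  apply: (@le_lt_trans _ _ (\int[P]_w 1%:E)%E); last by rewrite I1 ltry.
  apply: ge0_le_integral => //.
  - by move=> w _; exact: integral_ge0.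
  - apply: (@measurable_fun_fubini_tonelli_F _ _ T (measurableTypeR R) R mu (fun z => `|(f z)%:E|)%E) => //.
    by apply: measurableT_comp.
  - move=> w _; rewrite -(integral_normal_pdf 0 s).
    apply: ge0_le_integral => //.
    + apply: measurableT_comp => //; apply/measurable_EFinP.
      by apply: (measurableT_comp mf); exact: pair1_measurable.
    + by apply/measurable_EFinP; exact: measurable_normal_pdf.
    + by move=> x _ /=; rewrite lee_fin; exact: (fle (w, x)).
transitivity (\int[P]_w \int[mu]_x (f (w, x))%:E)%E.
  apply: eq_integral => w _; rewrite /f/=.
  under eq_integral do rewrite EFinM.
  rewrite integralZl//; last exact: (integrable_cos_normal s0 (X w)).
  rewrite normal_cos// -EFinM sa mulrA; congr (_ * expR _)%:E.
  by congr (- (_ / 2)); rewrite mulrC.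
rewrite (@Fubini _ _ T (measurableTypeR R) R P mu (EFin \o f) intf).
have cosP (c : R) : (\int[P]_w (cos (W w + c * X w) * G w)%:E
    = (M * expR (- b (fun w => W w + c * X w) (fun w => W w + c * X w) / 2))%:E)%E.
  by rewrite cosG//; exact: HD.
pose E (x : R) := expR (- (b W W + 2 * x * b W X + x ^+ 2 * b X X) / 2) * normal_pdf 0 s x.
have inner (x : R) : (\int[P]_w (f (w, x))%:E = (M / 2 * (E x + E (- x)))%:E)%E.
  (* The product of the two cosines is the mean of the cosines of [W + x X] and [W - x X], both in
     [H]. *)
  transitivity (\int[P]_w ((normal_pdf 0 s x / 2)%:E
    * ((cos (W w + x * X w) * G w)%:E + (cos (W w + - x * X w) * G w)%:E)))%E.
    apply: eq_integral => w _; rewrite -EFinD -EFinM /f/=; congr EFin.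
    by rewrite mulNr cosB cosD (mulrC (X w)); field.
  have iW (c : R) : P.-integrable setT (fun w => (cos (W w + c * X w) * G w)%:E).
    apply: (tilted_integrable mG G0 G1 _ (fun w => cos_max _)).
    by apply: measurableT_comp => //; apply: measurable_funD => //; exact: measurable_funM.
  rewrite integralZl//; last exact: integrableD.
  rewrite integralD// !cosP !psd_quad// -EFinD -EFinM; congr EFin.
  rewrite /E (_ : normal_pdf 0 s (- x) = normal_pdf 0 s x); last first.
    by rewrite !normal_pdfE ?gt_eqF// /normal_fun !subr0 sqrrN.
  by rewrite sqrrN; ring.
under eq_integral do rewrite inner EFinM EFinD.
have EE : (\int[mu]_x (E x)%:E = ((Num.sqrt (1 + s ^+ 2 * b X X))^-1
     * expR (- (b W W - b W X ^+ 2 / (s ^- 2 + b X X)) / 2))%:E)%E.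
  exact: normal_exp_quad.
(* Changing the sign of [x] amounts to changing that of [b W X], which enters the integral only
   through its square. *)
have ENE (x : R) : E (- x) = expR (- (b W W + 2 * x * (- b W X) + x ^+ 2 * b X X) / 2) * normal_pdf 0 s x.
  rewrite /E (_ : normal_pdf 0 s (- x) = normal_pdf 0 s x); last first.
    by rewrite !normal_pdfE ?gt_eqF// /normal_fun !subr0 sqrrN.
  by congr (expR _ * _); ring.
have EN : (\int[mu]_x (E (- x))%:E = ((Num.sqrt (1 + s ^+ 2 * b X X))^-1
     * expR (- (b W W - b W X ^+ 2 / (s ^- 2 + b X X)) / 2))%:E)%E.
  by under eq_integral do rewrite ENE; rewrite normal_exp_quad// sqrrN.
have mE : measurable_fun setT E.
  apply: measurable_funM; last exact: measurable_normal_pdf.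
  apply: measurableT_comp => //; apply: measurable_funM => //.
  apply: measurableT_comp => //; apply: measurable_funD.
    by apply: measurable_funD => //; apply: measurable_funM => //; exact: measurable_funM.
  by apply: measurable_funM => //; exact: measurable_funX.
have mEN : measurable_fun setT (fun x : R => E (- x)) by apply: (measurableT_comp mE).
have E0 x : 0 <= E x by rewrite mulr_ge0 ?expR_ge0 ?normal_pdf_ge0.
rewrite ge0_integralZl//; last 3 first.
- by apply: emeasurable_funD; apply/measurable_EFinP.
- by move=> x _; rewrite adde_ge0 ?lee_fin.
- by rewrite lee_fin divr_ge0// ltW.
rewrite ge0_integralD//; last 4 first.
- by move=> x _; rewrite lee_fin.
- exact/measurable_EFinP.
- by move=> x _; rewrite lee_fin.
- exact/measurable_EFinP.
rewrite EE EN -EFinD -EFinM sa /tilt_form; congr EFin.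
rewrite -expr2; set A := expR _; set r := Num.sqrt _.
by field; rewrite gt_eqF// sqrtr_gt0 ltr_wpDr// mulr_ge0// ltW.
Qed.

End tilted.

(** * Second moments under a weight, and iteration of the weights *)

Section tilted_moments.
Context d (T : measurableType d) (R : realType) (P : probability T R).
Variable H : (T -> R) -> Prop.
Hypothesis H0 : H (fun=> 0).
Hypothesis HD : forall V W (c : R), H V -> H W -> H (fun w => V w + c * W w).
Hypothesis Hm : forall W, H W -> measurable_fun setT W.

Lemma psd_zero b U : psd H b -> H U -> b (fun=> 0) U = 0.
Proof.
move=> [_ blin _] HU; have := blin _ _ _ (-1) HU H0 H0.
rewrite (_ : (fun=> _) = (fun=> 0)); last by apply/funext => w; rewrite mulr0 addr0.
by rewrite mulN1r subrr.
Qed.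

Lemma span_scale (c : R) W : H W -> H (fun w => c * W w).
Proof.
move=> HW; have := HD c H0 HW.
by rewrite (_ : (fun _ => _) = (fun w => c * W w))//; apply/funext => w; rewrite add0r.
Qed.

Lemma psd_scale b (c : R) W : psd H b -> H W ->
  b (fun w => c * W w) (fun w => c * W w) = c ^+ 2 * b W W.
Proof.
move=> pb HW; have := psd_quad HD c pb H0 HW.
rewrite (_ : (fun _ => _ + _) = (fun w => c * W w)); last by apply/funext => w; rewrite add0r.
by move=> ->; rewrite !psd_zero// mulr0 !add0r.
Qed.

Lemma tilted_mass G M b : tilted P H G M b -> (\int[P]_w (G w)%:E = M%:E)%E.
Proof.
move=> [pb _ _ _ _ cosG]; have := cosG _ H0.
rewrite psd_zero// oppr0 mul0r expR0 mulr1 => <-.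
by apply: eq_integral => w _; rewrite cos0 mul1r.
Qed.

(** The derivative at 0 of [sin (h * (x / 2))], taken along the steps [h = harmonic n]. *)
Lemma cvg_sin_quotient (x : R) :
  (2 * sin (harmonic n * (x / 2)) / harmonic n) ^+ 2 @[n --> \oo] --> x ^+ 2.
Proof.
have dsin : is_derive (0 : R) 1 (fun h : R => sin (h * (x / 2))) (x / 2).
  apply: trigger_derive; rewrite /GRing.scale/= mul0r cos0; ring.
have hn0 n : @harmonic R n != 0 by rewrite gt_eqF// harmonic_gt0.
have c1 : sin (harmonic n * (x / 2)) / harmonic n @[n --> \oo] --> x / 2.
  have [/cvgr_dnbhsP dv dE] := dsin; rewrite -[X in _ --> X]dE.
  have := dv (@harmonic R) (conj hn0 (@cvg_harmonic R)).
  apply: cvg_trans; apply: near_eq_cvg; near=> n => /=.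
  by rewrite /GRing.scale/= mulr1 addr0 mul0r sin0 subr0 mulrC.
have c2 : 2 * (sin (harmonic n * (x / 2)) / harmonic n) @[n --> \oo] --> x.
  rewrite [X in _ --> X](_ : x = 2 * (x / 2)); last by field.
  exact: cvgMl_tmp.
under eq_fun do rewrite -mulrA.
by apply: (cvg_comp _ (fun z => z ^+ 2) c2); exact: exprn_continuous.
Unshelve. all: by end_near. Qed.

(* Fatou's lemma, using that [(2 sin (h W / 2) / h)^2 = 2 (1 - cos (h W)) / h^2] tends to [W^2]. *)
Lemma tilted_moment2 G M b W : tilted P H G M b -> H W ->
  (\int[P]_w (W w ^+ 2 * G w)%:E <= (M * b W W)%:E)%E.
Proof.
move=> tG HW; have mass := tilted_mass tG.
case: (tG) => pb mG G0 G1 M0 cosG.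
have bW0 := psd_ge0 pb HW.
have mW := Hm HW.
have msin : measurable_fun setT (@sin R).
  by apply: continuous_measurable_fun; exact: continuous_sin.
pose k n w : R := (2 * sin (harmonic n * (W w / 2)) / harmonic n) ^+ 2 * G w.
have mk n : measurable_fun setT (EFin \o k n).
  apply/measurable_EFinP; apply: measurable_funM => //; apply: measurable_funX.
  apply: measurable_funM => //; apply: measurable_funM => //.
  apply: measurableT_comp => //; apply: measurable_funM => //.
  exact: measurable_funM.
have k0 n w : (0 <= (EFin \o k n) w)%E by rewrite lee_fin mulr_ge0 ?sqr_ge0.
have kint n : (\int[P]_w (k n w)%:E <= (M * b W W)%:E)%E.
  pose x := @harmonic R n.
  have x0 : 0 < x by exact: harmonic_gt0.
  have iG : P.-integrable setT (fun w => (G w)%:E).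
    have := @tilted_integrable _ _ _ P G (fun=> 1) mG G0 G1 (measurable_cst _).
    under eq_fun do rewrite mul1r.
    by apply => w; rewrite normr1.
  have iC : P.-integrable setT (fun w => (cos (x * W w) * G w)%:E).
    apply: (tilted_integrable P mG G0 G1) => [|w]; last exact: cos_max.
    apply: measurableT_comp; last exact: measurable_funM.
    by apply: continuous_measurable_fun; exact: continuous_cos.
  have -> : (\int[P]_w (k n w)%:E = \int[P]_w ((2 / x ^+ 2)%:E * ((G w)%:E - (cos (x * W w) * G w)%:E)))%E.
    apply: eq_integral => w _; rewrite -EFinB -EFinM; congr EFin.
    rewrite /k -/x (_ : x * W w = x * (W w / 2) + x * (W w / 2)); last by field.
    rewrite cosD -!expr2; have := cos2Dsin2 (x * (W w / 2)).
    move: (cos _) (sin _) => u v uv.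
    have -> : u ^+ 2 = 1 - v ^+ 2 by lra.
    by field; rewrite gt_eqF.
  rewrite integralZl//; last exact: integrableB.
  rewrite integralB// mass (cosG (fun w => x * W w)); last exact: span_scale.
  rewrite psd_scale// -EFinB -EFinM lee_fin.
  set y := x ^+ 2 * b W W.
  have -> : M * b W W = 2 / x ^+ 2 * (M * (y / 2)).
    by rewrite /y; field; rewrite gt_eqF.
  apply: ler_wpM2l; first by rewrite divr_ge0// sqr_ge0.
  rewrite -{1}[M]mulr1 -mulrBr ler_wpM2l ?(ltW M0)//.
  (* [1 - expR (- y / 2) <= y / 2], so the bound already holds for each [n], before Fatou's
     lemma. *)
  by have := expR_ge1Dx (- y / 2); lra.
have := fatou P measurableT mk (fun n w _ => k0 n w).
rewrite (_ : (\int[P]_(x in _) _)%E = (\int[P]_w (W w ^+ 2 * G w)%:E)%E); last first.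
  apply: eq_integral => w _.
  have ck : (EFin \o k n) w @[n --> \oo] --> (W w ^+ 2 * G w)%:E.
    apply: cvg_EFin; first exact: nearW.
    by apply: cvgMr_tmp; exact: cvg_sin_quotient.
  by rewrite is_cvg_limn_einfE; [exact/cvg_lim|apply/cvg_ex; eexists; exact: ck].
move=> /le_trans; apply.
rewrite limn_einf_lim; apply: lime_le; first exact: is_cvg_einfs.
apply: nearW => n; apply: le_trans (kint n).
by apply: ereal_inf_lbound; exists n => //=.
Qed.

(* [M ^+ 2] is the product of the factors [1 / (1 + a v_k)], where [v_k] is the variance of [X k]
   under the weight of the previous ones, a regularized squared distance of [X k] to their span. *)
Lemma tilt_iter b (a : R) (X : nat -> T -> R) : 0 < a -> (forall i, H (X i)) ->
  tilted P H (fun=> 1) 1 b -> forall n : nat, exists M b',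
  [/\ tilted P H (fun w => expR (- (a * (\sum_(i < n) X i w ^+ 2) / 2))) M b',
   (forall W (c : nat -> R), H W -> b' W W <= b (fun w => W w + \sum_(i < n) c i * X i w)
       (fun w => W w + \sum_(i < n) c i * X i w) + \sum_(i < n) c i ^+ 2 / a),
   (forall W, H W -> exists c : nat -> R, b' W W = b (fun w => W w + \sum_(i < n) c i * X i w)
       (fun w => W w + \sum_(i < n) c i * X i w) + \sum_(i < n) c i ^+ 2 / a),
   ((forall i, b (X i) (X i) <= 1) -> (1 + a) ^- n <= M ^+ 2) &
   (forall q, 0 <= q -> (forall k (c : nat -> R), (k < n)%N ->
      q <= b (fun w => X k w + \sum_(i < k) c i * X i w)
       (fun w => X k w + \sum_(i < k) c i * X i w)) -> M ^+ 2 <= (1 + a * q) ^- n)].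
Proof.
move=> a0 HX tb; have pb := tilted_psd tb; elim => [|n [M [b' [tG IHle IHex IHlow IHup]]]].
  exists 1, b; split.
  - by under eq_fun do rewrite big_ord0 mulr0 mul0r oppr0 expR0.
  - move=> W c HW; rewrite big_ord0 addr0.
    by under eq_fun do rewrite big_ord0 addr0.
  - move=> W HW; exists (fun=> 0); rewrite big_ord0 addr0.
    by under eq_fun do rewrite big_ord0 addr0.
  - by rewrite expr1n expr0 invr1.
  - by move=> q _ _; rewrite expr1n expr0 invr1.
have pb' := tilted_psd tG.
have q0 : 0 <= b' (X n) (X n) by exact: (psd_ge0 pb' (HX n)).
have D0 : 0 < 1 + a * b' (X n) (X n) by rewrite ltr_wpDr// mulr_ge0// ltW.
have M2 : (M / Num.sqrt (1 + a * b' (X n) (X n))) ^+ 2 = M ^+ 2 / (1 + a * b' (X n) (X n)).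
  by rewrite exprMn exprVn sqr_sqrtr// ltW.
exists (M / Num.sqrt (1 + a * b' (X n) (X n))), (tilt_form a (X n) b'); split.
- have := tilted_step HD Hm a0 (HX n) tG.
  congr tilted; apply/funext => w; rewrite -expRD big_ord_recr/=; congr expR; ring.
- move=> W c HW; apply: le_trans (tilt_form_min HD (c n) a0 pb' (HX n) HW) _.
  rewrite [in leRHS]big_ord_recr/= addrA lerD2r.
  have HWX := HD (c n) HW (HX n).
  apply: le_trans (IHle _ c HWX) _.
  rewrite lerD2r le_eqVlt; apply/orP; left; apply/eqP.
  by congr b; apply/funext => w; rewrite big_ord_recr/=; ring.
- move=> W HW; have [cn En] := tilt_form_attained HD a0 pb' (HX n) HW.
  have [c Ec] := IHex _ (HD cn HW (HX n)).
  (* The minimum is attained in two stages: [cn] for the last weight, then [c] for [W + cn X_n]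
     under the previous ones. *)
  exists (fun i => if i == n then cn else c i).
  rewrite En Ec big_ord_recr/= eqxx addrA; congr (_ + _); congr (_ + _).
    by congr b; apply/funext => w; rewrite big_ord_recr/= eqxx -addrA [cn * _ + _]addrC;
      congr (_ + (_ + _)); apply: eq_bigr => i _; rewrite ltn_eqF.
  by apply: eq_bigr => i _; rewrite ltn_eqF.
- move=> b1; rewrite M2 exprSr invfM; apply: ler_pM => //.
  + by rewrite invr_ge0 exprn_ge0// addr_ge0// ltW.
  + by rewrite invr_ge0 addr_ge0// ltW.
  + exact: IHlow.
  rewrite lef_pV2 ?posrE//; last by rewrite ltr_wpDr// ltW.
  rewrite lerD2l ger_pMr//; apply: le_trans (b1 n).
  (* Zero coefficients show that weighting never increases a variance, so each factor is at most
     [1 + a]. *)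
  have := IHle (X n) (fun=> 0) (HX n).
  rewrite [X in _ + X]big1 ?addr0; last by move=> i _; rewrite expr0n mul0r.
  by under eq_fun do [rewrite big1 ?addr0; last by move=> i _; rewrite mul0r].
- move=> q q_ge0 hq; rewrite M2 [in leRHS]exprSr [in leRHS]invfM; apply: ler_pM => //.
  + exact: sqr_ge0.
  + by rewrite invr_ge0 ltW.
  + by apply: IHup => // k c kn; apply: hq; exact: ltnW.
  rewrite lef_pV2 ?posrE//; last by rewrite ltr_wpDr// mulr_ge0// ltW.
  rewrite lerD2l ler_pM2l//.
  (* The variance is attained at some [c]; without its nonnegative penalty it is one of the values
     assumed to be at least [q]. *)
  have [c ->] := IHex (X n) (HX n).
  apply: le_trans (hq n c (ltnSn n)) _.
  by rewrite lerDl sumr_ge0// => i _; rewrite divr_ge0 ?sqr_ge0// ltW.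
Qed.

End tilted_moments.

(** * The Cauchy kernel *)

Section cauchy_form.
Context {R : realFieldType}.
Implicit Types (s ps : seq R) (c : R -> R) (a p x : R).

Definition bilin_sum (K : R -> R -> R) s c : R :=
  \sum_(a <- s) \sum_(b <- s) c a * c b * K a b.

(** For positive nodes this is the squared norm of the sum of [c a * expR (- a * u)] in L2 of the
    half-line [u > 0]. *)
Definition cauchy_sum s c : R := bilin_sum (fun a b => (a + b)^-1) s c.

(** The finite Blaschke product of the right half-plane with zeros [ps]. *)
Definition blaschke ps a : R := \prod_(p <- ps) ((a - p) / (a + p)).

Lemma eq_bilin_sum K s c c' : {in s, c =1 c'} -> bilin_sum K s c = bilin_sum K s c'.
Proof.
move=> cc; apply: eq_big_seq => a as_; apply: eq_big_seq => b bs.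
by rewrite !cc.
Qed.

Lemma bilin_sum_scale K s c (k : R) :
  bilin_sum K s (fun a => k * c a) = k ^+ 2 * bilin_sum K s c.
Proof.
rewrite /bilin_sum mulr_sumr; apply: eq_bigr => a _.
by rewrite mulr_sumr; apply: eq_bigr => b _; ring.
Qed.

Lemma bilin_sum_parallelogram K s c c' :
  bilin_sum K s (fun a => c a - c' a) + bilin_sum K s (fun a => c a + c' a)
  = 2 * bilin_sum K s c + 2 * bilin_sum K s c'.
Proof.
rewrite /bilin_sum !mulr_sumr -!big_split/=; apply: eq_bigr => a _.
by rewrite !mulr_sumr -!big_split/=; apply: eq_bigr => b _; ring.
Qed.

(* One step of Schur elimination; [p] need not be a node. *)
Lemma cauchy_schur s c p : 0 < p -> {in s, forall a, 0 < a} ->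
  cauchy_sum s c = 2 * p * (\sum_(a <- s) c a / (a + p)) ^+ 2
    + cauchy_sum s (fun a => (a - p) / (a + p) * c a).
Proof.
move=> p0 s0; rewrite expr2 big_distrlr/= mulr_sumr -big_split/=.
apply: eq_big_seq => a /s0 a0; rewrite mulr_sumr -big_split/=.
apply: eq_big_seq => b /s0 b0.
by field; rewrite !gt_eqF// addr_gt0.
Qed.

(** Each Schur step with pivot [p] splits off a nonnegative square, which is dropped, and multiplies
    the coefficient at [a] by [(a - p) / (a + p)]. *)
Lemma cauchy_ge_blaschke s ps c : {in s, forall a, 0 < a} -> {in ps, forall a, 0 < a} ->
  cauchy_sum s (fun a => blaschke ps a * c a) <= cauchy_sum s c.
Proof.
move=> s0; elim: ps c => [|p ps IH] c ps0.
  rewrite le_eqVlt; apply/orP; left; apply/eqP; apply: eq_bilin_sum => a _.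
  by rewrite /blaschke big_nil mul1r.
have p0 : 0 < p by apply: ps0; rewrite mem_head.
rewrite (cauchy_schur c p0 s0).
apply: (@le_trans _ _ (cauchy_sum s (fun a => (a - p) / (a + p) * c a))); last first.
  by rewrite lerDr mulr_ge0 ?sqr_ge0// mulr_ge0// ltW.
have ps'0 : {in ps, forall a, 0 < a}.
  by move=> q qps; apply: ps0; rewrite in_cons qps orbT.
apply: le_trans (IH _ ps'0).
rewrite le_eqVlt; apply/orP; left; apply/eqP; apply: eq_bilin_sum => a _.
by rewrite /blaschke big_cons; ring.
Qed.

Lemma blaschke_root ps p : p \in ps -> blaschke ps p = 0.
Proof.
by move=> pps; rewrite /blaschke (big_rem p)//= subrr mul0r mul0r.
Qed.

(** Taking the nodes themselves as pivots annihilates every coefficient. *)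
Lemma cauchy_ge0 s c : {in s, forall a, 0 < a} -> 0 <= cauchy_sum s c.
Proof.
move=> s0; apply: le_trans (cauchy_ge_blaschke c s0 s0).
rewrite /cauchy_sum (@eq_bilin_sum _ _ _ (fun=> 0)); last first.
  by move=> a as_; rewrite blaschke_root// mul0r.
by rewrite /bilin_sum big1// => a _; rewrite big1// => b _; rewrite !mul0r.
Qed.

(* Apply [cauchy_ge_blaschke] with all the nodes but [p]: only the coefficient at [p] survives. *)
Lemma cauchy_coef s c p : uniq s -> {in s, forall a, 0 < a} -> p \in s ->
  blaschke [seq q <- s | q != p] p ^+ 2 * c p ^+ 2 / (2 * p) <= cauchy_sum s c.
Proof.
move=> us s0 ps; set ps' := [seq q <- s | q != p].
have ps'0 : {in ps', forall a, 0 < a}.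
  by move=> a; rewrite mem_filter => /andP[_]; exact: s0.
apply: le_trans (cauchy_ge_blaschke c s0 ps'0).
have z a : a \in s -> a != p -> blaschke ps' a = 0.
  by move=> as_ ap; apply: blaschke_root; rewrite mem_filter ap.
rewrite /cauchy_sum /bilin_sum (bigD1_seq p)//= [X in _ + X]big1_seq ?addr0; last first.
  move=> a /andP[ap as_]; rewrite big1_seq// => b _.
  by rewrite z// !mul0r.
rewrite (bigD1_seq p)//= [X in _ + X]big1_seq ?addr0; last first.
  move=> b /andP[bp bs]; rewrite (z b)// mul0r mulr0 mul0r//.
rewrite le_eqVlt; apply/orP; left; apply/eqP.
by rewrite (_ : p + p = 2 * p) -?expr2 ?exprMn//; ring.
Qed.

Lemma blaschke_sqr_le ps a (k : R) : 0 <= k -> 0 < a -> 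
  {in ps, forall p, ((a - p) / (a + p)) ^+ 2 <= k} ->
  blaschke ps a ^+ 2 <= k ^+ size ps.
Proof.
move=> k0 a0; elim: ps => [|p ps IH] kp.
  by rewrite /blaschke big_nil expr1n.
rewrite /blaschke big_cons exprMn [in leRHS]/= [in leRHS]exprS; apply: ler_pM; rewrite ?sqr_ge0//.
  by apply: kp; rewrite mem_head.
by apply: IH => q qps; apply: kp; rewrite in_cons qps orbT.
Qed.

(** The Schur elimination run backwards. Dividing by [r a] undoes the factor of the new node, and
    the constant [r x] restores [c x = 1]. The coefficient at [p] is free, because its factor is 0,
    and is chosen to cancel the square. *)
Lemma cauchy_approx ps x : 0 < x -> {in ps, forall a, 0 < a} -> uniq ps -> x \notin ps ->
  exists c, c x = 1 /\ cauchy_sum (x :: ps) c = blaschke ps x ^+ 2 / (2 * x).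
Proof.
move=> x0; elim: ps => [|p ps IH] ps0 /=.
  move=> _ _; exists (fun=> 1); split=> //.
  rewrite /cauchy_sum /bilin_sum !big_seq1 /blaschke big_nil.
  by rewrite mul1r expr1n (_ : x + x = 2 * x)//; ring.
move=> /andP[pps ups]; rewrite in_cons negb_or => /andP[xp xps].
have p0 : 0 < p by apply: ps0; rewrite mem_head.
have ps'0 : {in ps, forall a, 0 < a}.
  by move=> q qps; apply: ps0; rewrite in_cons qps orbT.
have [c' [c'x Nc']] := IH ps'0 ups xps.
pose r a := (a - p) / (a + p).
pose c1 a := r x * c' a / r a.
pose cp := - (2 * p * \sum_(a <- x :: ps) c1 a / (a + p)).
pose c a := if a == p then cp else c1 a.
have s0 : {in x :: p :: ps, forall a, 0 < a}.
  by move=> a; rewrite in_cons => /predU1P[->//|]; exact: ps0.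
have rn0 a : 0 < a -> a != p -> r a != 0.
  by move=> a0 ap; rewrite mulf_neq0 ?subr_eq0// invr_eq0 gt_eqF// addr_gt0.
have notp a : a \in x :: ps -> a != p.
  rewrite in_cons => /predU1P[->//|aps]; apply: contra pps => /eqP <-//.
have cE a : a \in x :: ps -> c a = c1 a by move=> /notp /negbTE ap; rewrite /c ap.
exists c; split.
  by rewrite cE ?mem_head// /c1 c'x mulr1 divff// rn0.
have pxp : perm_eq (x :: p :: ps) (p :: x :: ps).
  by rewrite -(cat1s x) -(cat1s p) perm_catCA.
rewrite (cauchy_schur c p0 s0).
rewrite (perm_big _ pxp)/= big_cons {1}/c eqxx.
rewrite (eq_big_seq (fun a => c1 a / (a + p))); last by move=> a /cE ->.
rewrite (_ : cp / (p + p) = - \sum_(a <- x :: ps) c1 a / (a + p)); last first.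
  by rewrite /cp (_ : p + p = 2 * p); [field; rewrite gt_eqF|ring].
rewrite addNr expr0n mulr0 add0r.
transitivity (cauchy_sum (x :: ps) (fun a => r x * c' a)).
  rewrite /cauchy_sum /bilin_sum (perm_big _ pxp)/= big_cons [X in X + _]big1 ?add0r; last first.
    by move=> b _; rewrite subrr !mul0r.
  apply: eq_big_seq => a ain; rewrite (perm_big _ pxp)/= big_cons subrr !(mul0r, mulr0) add0r.
  have H1 b : b \in x :: ps -> (b - p) / (b + p) * c b = r x * c' b.
    move=> bin; rewrite cE// /c1 -/(r b) mulrC divfK// rn0//; last exact: notp.
    by move: bin; rewrite in_cons => /predU1P[->//|]; exact: ps'0.
  by apply: eq_big_seq => b bin; rewrite !H1.
rewrite /cauchy_sum bilin_sum_scale -/(cauchy_sum _ _) Nc' /blaschke big_cons -/(r x).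
by rewrite [in RHS]exprMn mulrA.
Qed.

Lemma cauchy_cons_notin x ps c : x \notin ps -> 
  cauchy_sum (x :: ps) (fun a => c a - (a == x)%:R * c a) = cauchy_sum ps c.
Proof.
move=> xps; rewrite /cauchy_sum /bilin_sum big_cons [X in X + _]big1 ?add0r; last first.
  by move=> b _; rewrite eqxx mul1r subrr !mul0r.
apply: eq_big_seq => a ain; rewrite big_cons eqxx mul1r subrr mulr0 mul0r add0r.
have H b : b \in ps -> c b - (b == x)%:R * c b = c b.
  by move=> bps; rewrite (_ : b == x = false) ?mul0r ?subr0//; apply: contraNF xps => /eqP <-.
by apply: eq_big_seq => b bin; rewrite !H.
Qed.

(** By the parallelogram identity, removing the term at [x] leaves a form of value at most [2 / x].
    Each remaining coefficient is then bounded by [cauchy_coef]. *)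
Lemma cauchy_approx_coef ps x (k : R) : 0 < x -> {in ps, forall a, 0 < a} -> uniq ps -> x \notin ps ->
  0 < k -> {in ps, forall p, k <= blaschke [seq q <- ps | q != p] p ^+ 2} ->
  exists c, [/\ c x = 1, cauchy_sum (x :: ps) c = blaschke ps x ^+ 2 / (2 * x) &
    {in ps, forall p, c p ^+ 2 <= 4 * p / x / k}].
Proof.
move=> x0 ps0 ups xps k0 kps; have [c [cx Nc]] := cauchy_approx x0 ps0 ups xps.
exists c; split => // p pps.
have p0 := ps0 _ pps.
have s0 : {in x :: ps, forall a, 0 < a}.
  by move=> a; rewrite in_cons => /predU1P[->//|]; exact: ps0.
have Nps : cauchy_sum ps c <= 2 / x.
  rewrite -(cauchy_cons_notin c xps).
  have := bilin_sum_parallelogram (fun a b => (a + b)^-1) (x :: ps) c (fun a => (a == x)%:R * c a).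
  rewrite -!/(cauchy_sum _ _) Nc.
  have -> : cauchy_sum (x :: ps) (fun a => (a == x)%:R * c a) = (2 * x)^-1.
    rewrite /cauchy_sum /bilin_sum big_cons [X in _ + X]big1_seq ?addr0; last first.
      move=> a /= ain; rewrite big1// => b _.
      by rewrite (_ : a == x = false) ?mul0r//; apply: contraNF xps => /eqP <-.
    rewrite big_cons [X in _ + X]big1_seq ?addr0; last first.
      move=> a /= ain.
      by rewrite (_ : a == x = false) ?(mul0r, mulr0)//; apply: contraNF xps => /eqP <-.
    by rewrite eqxx cx !mul1r (_ : x + x = 2 * x)//; ring.
  have := @cauchy_ge0 (x :: ps) (fun a => c a + (a == x)%:R * c a) s0.
  have : blaschke ps x ^+ 2 / (2 * x) <= (2 * x)^-1.
    rewrite ler_piMl ?invr_ge0 ?mulr_ge0 ?(ltW x0)//.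
    rewrite -(expr1n _ (size ps)); apply: blaschke_sqr_le => // q /ps0 q0.
    rewrite expr_div_n ler_pdivrMr ?exprn_gt0 ?addr_gt0// mul1r.
    by rewrite -subr_ge0 (_ : _ - _ = 4 * x * q); [rewrite !mulr_ge0// ltW|ring].
  have -> : 2 / x = 4 * (2 * x)^-1 by field; rewrite gt_eqF.
  by lra.
have := le_trans (cauchy_coef c ups ps0 pps) Nps.
rewrite ler_pdivrMr ?mulr_gt0//.
have := ler_wpM2r (sqr_ge0 (c p)) (kps _ pps).
move=> h1 h2; have := le_trans h1 h2.
by rewrite -mulrC -ler_pdivlMr// (_ : 2 / x * (2 * p) / k = 4 * p / x / k)//; ring.
Qed.

End cauchy_form.

(** An elementary substitute for Stirling's formula: [p ^ p] is at most the falling factorial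
    [(p + p) ^_ p], which is a binomial coefficient times the factorial of [p]. *)
Lemma exp_self_le_fact (p : nat) : (p ^ p <= 4 ^ p * p`!)%N.
Proof.
have h1 : ('C(p + p, p) <= 2 ^ (p + p))%N.
  rewrite -[2%N]/(1 + 1)%N expnDn.
  have pp : (p < (p + p).+1)%N by rewrite ltnS leq_addr.
  rewrite (bigD1 (Ordinal pp))//= !exp1n !muln1.
  exact: leq_addr.
have h2 : (p ^ p <= (p + p) ^_ p)%N.
  rewrite ffact_prod -[X in (_ ^ X <= _)%N]card_ord -prod_nat_const.
  by apply: leq_prod => i _; have := ltn_ord i; lia.
apply: leq_trans h2 _; rewrite -bin_ffact -[4%N]/(2 ^ 2)%N -expnM.
by rewrite leq_mul2r (_ : 2 * p = p + p)%N ?h1 ?orbT//; lia.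
Qed.

(** The two factorials multiply to the product of [|j - j'|] over the other indices [j'] of a block;
    [4 * p] bounds the denominators of the corresponding ratios. *)
Lemma fact_split_ge (p j : nat) : (j < p)%N ->
  ((4 * p) ^ p.-1 <= 2 ^ (5 * p) * (j`! * (p - j.+1)`!))%N.
Proof.
case: p => // p; rewrite ltnS => jp; rewrite subSS /=.
have h1 : ('C(p, j) <= 2 ^ p)%N.
  rewrite -[2%N]/(1 + 1)%N expnDn.
  have pp : (j < p.+1)%N by [].
  rewrite (bigD1 (Ordinal pp))//= !exp1n !muln1.
  exact: leq_addr.
have h2 := bin_fact jp.
have h3 := exp_self_le_fact p.+1.
have h4 : (p.+1 ^ p <= 4 ^ p.+1 * p`!)%N.
  by move: h3; rewrite expnS factS mulnCA leq_pmul2l.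
rewrite expnMn.
apply: (@leq_trans (4 ^ p * (4 ^ p.+1 * (2 ^ p * (j`! * (p - j)`!)))))%N.
  rewrite leq_mul2l; apply/orP; right; apply: leq_trans h4 _.
  by rewrite leq_mul2l -h2 leq_mul2r h1 !orbT.
rewrite !mulnA leq_mul2r; apply/orP; right.
rewrite leq_mul2r; apply/orP; right.
by rewrite -[4%N]/(2 ^ 2)%N -!expnM -!expnD leq_exp2l//; lia.
Qed.

(** * Blaschke products over a geometric grid *)

Section grid.
Context {R : realFieldType}.
Implicit Types (tau : R) (B p b j : nat).

(** A block fills only one octave. The ratio 16 leaves a factor 8 up to the next block, so that
    nodes of distinct blocks never come close. *)
Definition node tau p b j : R := tau * 16 ^+ b * (1 + j%:R / p%:R).

Definition grid tau B p : seq R := [seq node tau p b j | b <- iota 0 B, j <- iota 0 p].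

Lemma size_grid tau B p : size (grid tau B p) = (B * p)%N.
Proof. by rewrite size_allpairs !size_iota. Qed.

Lemma gridP tau B p (a : R) : a \in grid tau B p ->
  exists b j, [/\ (b < B)%N, (j < p)%N & a = node tau p b j].
Proof.
move/allpairsP => [[b j] /= [+ + ->]]; rewrite !mem_iota/= !add0n => bB jp.
by exists b, j.
Qed.

Lemma node_bounds tau p b j : 0 < tau -> (j < p)%N ->
  tau * 16 ^+ b <= node tau p b j < tau * 16 ^+ b * 2.
Proof.
move=> t0 jp; have p0 : 0 < p%:R :> R by rewrite ltr0n (leq_ltn_trans _ jp).
have tb : 0 < tau * 16 ^+ b by rewrite mulr_gt0// exprn_gt0.
apply/andP; split.
  by apply: ler_peMr; [exact: ltW|rewrite lerDl divr_ge0].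
rewrite /node ltr_pM2l//; have : j%:R / p%:R < 1 :> R.
  by rewrite ltr_pdivrMr// mul1r ltr_nat.
by lra.
Qed.

Lemma grid_ge tau B p : 0 < tau -> {in grid tau B p, forall a, tau <= a}.
Proof.
move=> t0 a /gridP[b [j [bB jp ->]]].
have /andP[h _] := node_bounds b t0 jp; apply: le_trans h.
by apply: ler_peMr; [exact: ltW|rewrite exprn_ege1//; lra].
Qed.

Lemma grid_le tau B p : 0 < tau -> {in grid tau B p, forall a, a <= tau * 16 ^+ B}.
Proof.
move=> t0 a /gridP[b [j [bB jp ->]]].
have /andP[_ h] := node_bounds b t0 jp; apply: ltW; apply: lt_le_trans h _.
rewrite -mulrA ler_pM2l//; apply: (@le_trans _ _ (16 ^+ b.+1)).
  by rewrite exprSr ler_pM2l ?exprn_gt0//; lra.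
by rewrite ler_weXn2l//; lra.
Qed.

Lemma node_lt tau p b j b' j' : 0 < tau -> (j < p)%N -> (j' < p)%N -> (b < b')%N ->
  node tau p b j < node tau p b' j'.
Proof.
move=> t0 jp jp' bb'.
have /andP[_ h] := node_bounds b t0 jp; have /andP[h' _] := node_bounds b' t0 jp'.
apply: lt_le_trans h (le_trans _ h').
rewrite -mulrA ler_pM2l//; apply: (@le_trans _ _ (16 ^+ b.+1)).
  by rewrite exprSr ler_pM2l ?exprn_gt0//; lra.
by rewrite ler_weXn2l//; lra.
Qed.

Lemma node_inj tau p b j b' j' : 0 < tau -> (j < p)%N -> (j' < p)%N ->
  node tau p b j = node tau p b' j' -> b = b' /\ j = j'.
Proof.
move=> t0 jp jp'; case: (ltngtP b b') => [bb'|bb'|<-] E.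
- by have := node_lt t0 jp jp' bb'; rewrite E ltxx.
- by have := node_lt t0 jp' jp bb'; rewrite E ltxx.
split=> //; move: E; rewrite /node => /mulfI E.
have tb : tau * 16 ^+ b != 0 by rewrite gt_eqF// mulr_gt0// exprn_gt0.
have p0 : p%:R != 0 :> R by rewrite pnatr_eq0 -lt0n (leq_ltn_trans _ jp).
have /addrI/(congr1 (fun x => x * p%:R)) := E tb.
by rewrite !divfK// => /eqP; rewrite eqr_nat => /eqP.
Qed.

Lemma uniq_grid tau B p : 0 < tau -> uniq (grid tau B p).
Proof.
move=> t0; apply: allpairs_uniq; rewrite ?iota_uniq//.
move=> [b j] [b' j'] /allpairsP[[x y] /= [_ + [-> ->]]] /allpairsP[[x' y'] /= [_ + [-> ->]]].
rewrite !mem_iota/= !add0n => jp jp' E.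
by have [-> ->] := node_inj t0 jp jp' E.
Qed.

(** If [y] lies [d] blocks beyond [x], then [x <= 2 * 16 ^- d * y], and hence [(y - x) / (y + x)] is
    at least [g d]. *)
Let g (d : nat) : R := 1 - 4 * 16 ^- d.

Let g_prod n : 2^-1 <= \prod_(1 <= d < n.+1) g d.
Proof.
(* The induction needs this stronger bound, whose extra term pays for the next factor. *)
suff : 2^-1 + 2^-1 * 16 ^- n <= \prod_(1 <= d < n.+1) g d.
  by apply: le_trans; rewrite lerDl mulr_ge0// invr_ge0 exprn_ge0.
elim: n => [|n IH]; first by rewrite big_nil expr0 invr1; lra.
rewrite big_nat_recr//= /g exprSr invfM.
have z0 : 0 < 16 ^- n :> R by rewrite invr_gt0 exprn_gt0.
have z1 : 16 ^- n <= 1 :> R by rewrite invf_le1 ?exprn_gt0// exprn_ege1//; lra.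
move: IH; set z := 16 ^- n in z0 z1 *; set Q := \prod_(_ <= _ < _) _ => IH.
have h : 0 <= 1 - 4 * (z / 16) by lra.
by apply: le_trans (ler_wpM2r h IH); nra.
Qed.

(** [maxn b b' - minn b b'] is the distance between the blocks. Those before [b] and those after it
    contribute at least 1/2 each. *)
Let g_prod_abs B b : (b < B)%N ->
  4^-1 <= \prod_(0 <= b' < B | b' != b) g (maxn b b' - minn b b').
Proof.
move=> bB; rewrite (big_cat_nat (n := b))//=; last exact: ltnW.
have -> : \prod_(0 <= i < b | i != b) g (maxn b i - minn b i) = \prod_(1 <= d < b.+1) g d.
  rewrite big_mkcond/= (eq_big_nat _ _ (F2 := fun i => g (b - i)%N)); last first.
    move=> i /andP[_ ib]; rewrite ltn_eqF//=.
    by congr g; rewrite (maxn_idPl (ltnW ib)) (minn_idPr (ltnW ib)).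
  rewrite big_nat_rev/= add0n big_add1/=; apply: eq_big_nat => i /andP[_ ib].
  by congr g; lia.
have -> : \prod_(b <= i < B | i != b) g (maxn b i - minn b i) = \prod_(1 <= d < (B - b.+1).+1) g d.
  rewrite big_ltn_cond// eqxx/=.
  rewrite big_mkcond/= (eq_big_nat _ _ (F2 := fun i => g (i - b)%N)); last first.
    move=> i /andP[ib _]; rewrite gtn_eqF//=.
    by congr g; rewrite (maxn_idPr (ltnW ib)) (minn_idPl (ltnW ib)).
  rewrite -{1}(add0n b.+1) big_addn big_add1/=; apply: eq_big_nat => i _.
  by congr g; lia.
by have := g_prod b; have := g_prod (B - b.+1)%N; nra.
Qed.

Let g_ge0 (d : nat) : (0 < d)%N -> 0 <= g d.
Proof.
case: d => // d _; rewrite /g exprS invfM.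
have z1 : 16 ^- d <= 1 :> R by rewrite invf_le1 ?exprn_gt0// exprn_ege1//; lra.
by lra.
Qed.

Let cross_ratio tau p b j b' j' : 0 < tau -> (j < p)%N -> (j' < p)%N -> b != b' ->
  g (maxn b b' - minn b b') ^+ 2 <=
  ((node tau p b j - node tau p b' j') / (node tau p b j + node tau p b' j')) ^+ 2.
Proof.
move=> t0 jp jp' bb'.
wlog : b b' j j' jp jp' bb' / (b < b')%N => [H|{}bb'].
  move: (bb'); rewrite neq_ltn => /orP[|] h; first exact: H.
  have sw (x y : R) : ((x - y) / (x + y)) ^+ 2 = ((y - x) / (y + x)) ^+ 2.
    by rewrite -sqrrN -mulNr opprB (addrC x).
  rewrite maxnC minnC sw.
  by apply: H => //; rewrite eq_sym.
rewrite (maxn_idPr (ltnW bb')) (minn_idPl (ltnW bb')).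
set x := node _ _ _ _; set y := node _ _ _ _.
have /andP[x1 x2] := node_bounds b t0 jp; have /andP[y1 y2] := node_bounds b' t0 jp'.
rewrite -/x in x1 x2; rewrite -/y in y1 y2.
have u0 : 0 < tau * 16 ^+ b by rewrite mulr_gt0// exprn_gt0.
have x0 : 0 < x by exact: lt_le_trans x1.
have d0 : (0 < b' - b)%N by rewrite subn_gt0.
have v0 : 0 < 16 ^+ (b' - b) :> R by rewrite exprn_gt0.
have yv : tau * 16 ^+ b * 16 ^+ (b' - b) <= y by rewrite -mulrA -exprD subnKC// ltnW.
have y0 : 0 < y by apply: lt_le_trans yv; rewrite mulr_gt0.
have xy : x * 16 ^+ (b' - b) <= 2 * y.
  by apply: le_trans (ler_wpM2r (ltW v0) (ltW x2)) _; lra.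
have -> : ((x - y) / (x + y)) ^+ 2 = ((y - x) / (x + y)) ^+ 2.
  by rewrite -sqrrN -mulNr opprB.
rewrite ler_sqr ?nnegrE.
- rewrite ler_pdivlMr ?addr_gt0// /g.
  have : x <= 2 * 16 ^- (b' - b) * y by rewrite mulrAC ler_pdivlMr.
  have : 0 <= 4 * 16 ^- (b' - b) * x :> R by rewrite !mulr_ge0 ?invr_ge0// ltW.
  by lra.
- exact: g_ge0.
- apply: divr_ge0; last by apply: addr_ge0; exact: ltW.
  by rewrite subr_ge0; apply/ltW/node_lt.
Qed.

(** Within a block the ratio is [(j - j') / (2 * p + j + j')], free of [tau] and [b], with
    denominator at most [4 * p]. Squaring the estimate on factorials turns 5 into 10. *)
Let same_block tau p b j : 0 < tau -> (j < p)%N ->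
  2 ^- (10 * p) <= \prod_(0 <= j' < p | j' != j)
   ((node tau p b j - node tau p b j') / (node tau p b j + node tau p b j')) ^+ 2.
Proof.
move=> t0 jp; have p0 : (0 < p)%N by exact: leq_ltn_trans jp.
have pR : 0 < p%:R :> R by rewrite ltr0n.
pose h j' : R := ((maxn j j' - minn j j')%N%:R / (4 * p)%N%:R).
apply: (@le_trans _ _ (\prod_(0 <= j' < p | j' != j) h j' ^+ 2)); last first.
  rewrite big_nat_cond [leRHS]big_nat_cond; apply: ler_prod => j' /andP[/andP[_ jp'] jj'].
  rewrite sqr_ge0/=.
  have -> : (node tau p b j - node tau p b j') / (node tau p b j + node tau p b j')
      = (j%:R - j'%:R) / (2 * p%:R + j%:R + j'%:R).
    rewrite /node.
    have ? : 0 <= j%:R :> R by []; have ? : 0 <= j'%:R :> R by [].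
    have u0 : 0 < tau * 16 ^+ b by rewrite mulr_gt0// exprn_gt0.
    have ? : 0 < 2 * p%:R + j%:R + j'%:R :> R by lra.
    have ? : 0 < tau * 16 ^+ b * (p%:R + j%:R) + tau * 16 ^+ b * (p%:R + j'%:R) :> R.
      by rewrite -mulrDr mulr_gt0//; lra.
    by field; rewrite !gt_eqF.
  have den : 0 < 2 * p%:R + j%:R + j'%:R :> R.
    by have : 0 <= j%:R :> R by []; have : 0 <= j'%:R :> R by []; lra.
  have -> : ((j%:R - j'%:R) / (2 * p%:R + j%:R + j'%:R)) ^+ 2 = 
     ((maxn j j' - minn j j')%N%:R / (2 * p%:R + j%:R + j'%:R)) ^+ 2 :> R.
    case: (leqP j j') => jj.
      by rewrite natrB// -[LHS]sqrrN -mulNr opprB.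
    by rewrite natrB// ltnW.
  rewrite /h ler_sqr ?nnegrE ?divr_ge0 ?(ltW den)//.
  rewrite ler_wpM2l// lef_pV2 ?posrE ?ltr0n ?muln_gt0//.
  rewrite natrM; have : j%:R <= p%:R :> R by rewrite ler_nat ltnW.
  have : j'%:R <= p%:R :> R by rewrite ler_nat ltnW.
  by lra.
rewrite prodrXl.
have -> : \prod_(0 <= j' < p | j' != j) h j' = (j`! * (p - j.+1)`!)%N%:R / ((4 * p) ^ p.-1)%N%:R.
  rewrite (big_cat_nat (n := j))//=; last exact: ltnW.
  have -> : \prod_(0 <= i < j | i != j) h i = \prod_(1 <= d < j.+1) (d%:R / (4 * p)%N%:R).
    rewrite big_mkcond/= (eq_big_nat _ _ (F2 := fun i => (j - i)%N%:R / (4 * p)%N%:R)); last first.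
      move=> i /andP[_ ib]; rewrite ltn_eqF//= /h.
      by rewrite (maxn_idPl (ltnW ib)) (minn_idPr (ltnW ib)).
    rewrite big_nat_rev/= add0n big_add1/=; apply: eq_big_nat => i /andP[_ ib].
    by congr (_%:R / _); lia.
  have -> : \prod_(j <= i < p | i != j) h i = \prod_(1 <= d < (p - j.+1).+1) (d%:R / (4 * p)%N%:R).
    rewrite big_ltn_cond// eqxx/=.
    rewrite big_mkcond/= (eq_big_nat _ _ (F2 := fun i => (i - j)%N%:R / (4 * p)%N%:R)); last first.
      move=> i /andP[ib _]; rewrite gtn_eqF//= /h.
      by rewrite (maxn_idPr (ltnW ib)) (minn_idPl (ltnW ib)).
    rewrite -{1}(add0n j.+1) big_addn big_add1/=; apply: eq_big_nat => i _.
    by congr (_%:R / _); lia.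
  have F n : \prod_(1 <= d < n.+1) (d%:R / (4 * p)%N%:R) = n`!%:R / (4 * p)%N%:R ^+ n :> R.
    rewrite big_split/= prodr_const_nat subSS subn0 exprVn fact_prod.
    by rewrite natr_prod.
  rewrite !F mulrACA -invfM -exprD -natrM natrX.
  by congr (_ / _ ^+ _); lia.
have := fact_split_ge jp.
rewrite -(ler_nat R) natrM !natrX => H.
have w0 : 0 < (4 * p)%:R ^+ p.-1 :> R by rewrite exprn_gt0// ltr0n muln_gt0.
rewrite (_ : 10 * p = 5 * p * 2)%N; last by lia.
rewrite (exprM _ (5 * p) 2) -exprVn ler_sqr ?nnegrE ?invr_ge0 ?exprn_ge0//.
rewrite ler_pdivlMr//.
by rewrite mulrC ler_pdivrMr ?exprn_gt0// mulrC.
Qed.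

(* The [p] nodes of the same block contribute like [p! / p ^ p], the other blocks, whose distances
   are powers of 16, a convergent product. *)
Lemma grid_blaschke tau B p (a : R) : 0 < tau -> a \in grid tau B p ->
  2 ^- (14 * p) <= blaschke [seq q <- grid tau B p | q != a] a ^+ 2.
Proof.
move=> t0 ag; have [b [j [bB jp aE]]] := gridP ag.
pose F b' := \prod_(0 <= j' < p | node tau p b' j' != a)
  ((a - node tau p b' j') / (a + node tau p b' j')) ^+ 2.
have -> : blaschke [seq q <- grid tau B p | q != a] a ^+ 2 = \prod_(0 <= b' < B) F b'.
  rewrite /blaschke big_filter -prodrXl /grid big_mkcond big_allpairs_dep/=.
  rewrite /index_iota subn0; apply: eq_bigr => b' _.
  by rewrite -big_mkcond /F /index_iota subn0.
rewrite (bigD1_seq b) ?mem_index_iota ?iota_uniq//=.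
have Fb : 2 ^- (10 * p) <= F b.
  have := same_block b t0 jp; rewrite /F aE => H.
  rewrite big_nat_cond (eq_bigl (fun i => (0 <= i < p)%N && (i != j))); last first.
    move=> i; case: (ltnP i p) => //= ip; congr (~~ _).
    apply/eqP/eqP => [|->//] E; by have [_ ->] := node_inj t0 ip jp E.
  by rewrite -big_nat_cond.
have Fo b' : b' != b -> g (maxn b b' - minn b b') ^+ (2 * p) <= F b'.
  move=> bb'; rewrite /F big_nat_cond.
  rewrite (eq_bigl (fun i => (0 <= i < p)%N && true)); last first.
    move=> i; case: (ltnP i p) => //= ip.
    apply/eqP => E; rewrite aE in E.
    by have [E' _] := node_inj t0 ip jp E; rewrite E' eqxx in bb'.
  rewrite -big_nat_cond exprM -{1}(subn0 p) -prodr_const_nat.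
  rewrite big_nat_cond [leRHS]big_nat_cond; apply: ler_prod => i /andP[/andP[_ ip] _].
  rewrite sqr_ge0/= aE cross_ratio// eq_sym//.
(* The block of [a] accounts for 10, all the other blocks together for 4. *)
have -> : 2 ^- (14 * p) = 2 ^- (10 * p) * (4^-1) ^+ (2 * p) :> R.
  have -> : (4 : R) = 2 ^+ 2 by rewrite -natrX.
  rewrite exprVn -(exprM 2 2) -invfM -(exprD 2); congr (_ ^- _); lia.
apply: ler_pM => //; rewrite ?invr_ge0 ?exprn_ge0// ?invr_ge0//.
apply: (@le_trans _ _ (\prod_(0 <= b' < B | b' != b) g (maxn b b' - minn b b') ^+ (2 * p))).
  rewrite prodrXl; apply: lerXn2r; rewrite ?nnegrE ?invr_ge0//; last exact: g_prod_abs.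
  by apply: le_trans (g_prod_abs bB); rewrite invr_ge0.
apply: ler_prod => b' bb'; rewrite Fo// andbT exprn_ge0// g_ge0//.
by move: bb'; rewrite neq_ltn; lia.
Qed.

End grid.

(** * The linear span of the process *)

Definition covY {R : realType} (t s : R) : R := (1 - expR (- t - s)) / (t + s).

Lemma covYC {R : realType} (t s : R) : covY t s = covY s t.
Proof. by rewrite /covY (addrC t s) (_ : - t - s = - s - t)//; ring. Qed.

Section process_span.
Context d (T : measurableType d) (R : realType) (P : probability T R).
Variable Y : R -> {RV P >-> R}.
Hypothesis gY : gaussian_process `]0%R, +oo[ Y.
Hypothesis EY : forall t : R, 0 < t -> ('E_P[Y t] = 0)%E.
Hypothesis covYE : forall t s : R, 0 < t -> 0 < s ->
  ('E_P[fun w => (Y t w * Y s w)%R] = (covY t s)%:E)%E.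

Definition lin (l : seq (R * R)) (w : T) : R := \sum_(p <- l) p.1 * Y p.2 w.

Definition linspan (W : T -> R) : Prop :=
  exists l : seq (R * R), (forall p, p \in l -> 0 < p.2) /\ W = lin l.

Definition covar (V W : T -> R) : R := fine (\int[P]_w (V w * W w)%:E).

Lemma measurable_lin l : measurable_fun setT (lin l).
Proof.
elim: l => [|p l IH].
  have -> : lin [::] = fun=> 0 by apply/funext => w; rewrite /lin big_nil.
  exact: measurable_cst.
have -> : lin (p :: l) = fun w => p.1 * Y p.2 w + lin l w.
  by apply/funext => w; rewrite /lin big_cons.
by apply: measurable_funD => //; apply: measurable_funM.
Qed.

Lemma span0 : linspan (fun=> 0).
Proof. by exists [::]; split => //; apply/funext => w; rewrite /lin big_nil. Qed.

Lemma spanY t : 0 < t -> linspan (Y t).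
Proof.
move=> t0; exists [:: (1, t)]; split.
  by move=> p; rewrite inE => /eqP ->.
by apply/funext => w; rewrite /lin big_seq1 mul1r.
Qed.

Lemma spanD V W (c : R) : linspan V -> linspan W -> linspan (fun w => V w + c * W w).
Proof.
move=> [l [l0 ->]] [l' [l0' ->]].
exists (l ++ [seq (c * p.1, p.2) | p <- l']); split.
  by move=> p; rewrite mem_cat => /orP[/l0//|/mapP[q /l0' q0 ->]].
apply/funext => w; rewrite /lin big_cat big_map mulr_sumr; congr (_ + _).
by apply: eq_bigr => p _; rewrite mulrA.
Qed.

Lemma span_meas W : linspan W -> measurable_fun setT W.
Proof. by move=> [l [_ ->]]; exact: measurable_lin. Qed.

(** Used with [Z] a value of the process, a linear combination, or the constant 1; so covariances
    and means are treated alike. *)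
Let lin_integral (Z : T -> R) (k : R -> R) l :
  (forall t, 0 < t -> P.-integrable setT (fun w => (Y t w * Z w)%:E) /\
     (\int[P]_w (Y t w * Z w)%:E = (k t)%:E)%E) ->
  (forall p, p \in l -> 0 < p.2) ->
  P.-integrable setT (fun w => (lin l w * Z w)%:E) /\
  (\int[P]_w (lin l w * Z w)%:E = (\sum_(p <- l) p.1 * k p.2)%:E)%E.
Proof.
move=> Yk; elim: l => [|p l IH] l0.
  have E : (fun w => (lin [::] w * Z w)%:E) = (fun=> 0%E) :> (T -> \bar R).
    by apply/funext => w; rewrite /lin big_nil mul0r.
  by rewrite E big_nil; split; [exact: integrable0|rewrite integral0].
have [q0 IHi] : 0 < p.2 /\ (forall q, q \in l -> 0 < q.2).
  by split; [apply: l0; rewrite mem_head|move=> q ql; apply: l0; rewrite in_cons ql orbT].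
have [i1 e1] := Yk _ q0; have [i2 e2] := IH IHi.
have E : (fun w => (lin (p :: l) w * Z w)%:E) =
    (fun w => p.1%:E * (Y p.2 w * Z w)%:E + (lin l w * Z w)%:E)%E :> (T -> \bar R).
  by apply/funext => w; rewrite /lin big_cons mulrDl EFinD -EFinM mulrA.
have i3 : P.-integrable setT (fun w => p.1%:E * (Y p.2 w * Z w)%:E)%E by exact: integrableZl.
rewrite E; split; first exact: integrableD.
by rewrite integralD// integralZl// e1 e2 big_cons.
Qed.

Let Ysqr t : 0 < t -> (\int[P]_w (Y t w ^+ 2)%:E = (covY t t)%:E)%E.
Proof. by move=> t0; rewrite -covYE// unlock; apply: eq_integral. Qed.

Let Ysqr_int t : 0 < t -> P.-integrable setT (fun w => (Y t w ^+ 2)%:E).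
Proof.
move=> t0; apply/integrableP; split.
  by apply/measurable_EFinP; exact: measurable_funX.
under eq_integral do rewrite gee0_abs ?lee_fin ?sqr_ge0//.
by rewrite Ysqr// ltry.
Qed.

Let YY t s : 0 < t -> 0 < s -> P.-integrable setT (fun w => (Y t w * Y s w)%:E) /\
  (\int[P]_w (Y t w * Y s w)%:E = (covY t s)%:E)%E.
Proof.
move=> t0 s0; split; last by rewrite -covYE// unlock.
apply: (@le_integrable _ T R P setT measurableT _ (fun w => (Y t w ^+ 2)%:E + (Y s w ^+ 2)%:E)%E).
- by apply/measurable_EFinP; exact: measurable_funM.
- move=> w _; rewrite -EFinD lee_fin [leRHS]ger0_norm ?addr_ge0 ?sqr_ge0//.
  rewrite normrM -[Y t w ^+ 2]real_normK ?num_real// -[Y s w ^+ 2]real_normK ?num_real//.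
  have := normr_ge0 (Y t w); have := normr_ge0 (Y s w).
  have := sqr_ge0 (`|Y t w| - `|Y s w|); rewrite sqrrB.
  by nra.
- by apply: integrableD => //; exact: Ysqr_int.
Qed.

Lemma lin_cov l l' : (forall p, p \in l -> 0 < p.2) -> (forall p, p \in l' -> 0 < p.2) ->
  P.-integrable setT (fun w => (lin l w * lin l' w)%:E) /\
  (\int[P]_w (lin l w * lin l' w)%:E =
     (\sum_(p <- l) p.1 * \sum_(q <- l') q.1 * covY q.2 p.2)%:E)%E.
Proof.
move=> l0 l0'; apply: (@lin_integral _ (fun t => \sum_(q <- l') q.1 * covY q.2 t)) => // t t0.
have [i e] := @lin_integral (Y t) (fun s => covY s t) l' (fun s s0 => YY s0 t0) l0'.
have E : (fun w => (Y t w * lin l' w)%:E) = (fun w => (lin l' w * Y t w)%:E) :> (T -> \bar R).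
  by apply/funext => w; rewrite mulrC.
by rewrite E.
Qed.

Lemma span_prod_integrable V W : linspan V -> linspan W ->
  P.-integrable setT (fun w => (V w * W w)%:E).
Proof. by move=> [l [l0 ->]] [l' [l0' ->]]; have [] := lin_cov l0 l0'. Qed.

Lemma covarE V W : linspan V -> linspan W -> (\int[P]_w (V w * W w)%:E = (covar V W)%:E)%E.
Proof.
by move=> sV sW; rewrite fineK//; apply: integrable_fin_num => //; exact: span_prod_integrable.
Qed.

Lemma psd_covar : psd linspan covar.
Proof.
split.
- by move=> V W _ _; rewrite /covar; congr fine; apply: eq_integral => w _; rewrite mulrC.
- move=> U V W c sU sV sW; apply: EFin_inj; rewrite -covarE//; last exact: spanD.
  rewrite EFinD EFinM -!covarE//.
  have i1 := span_prod_integrable sV sU; have i2 := span_prod_integrable sW sU.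
  have i3 : P.-integrable setT (fun w => c%:E * (W w * U w)%:E)%E by exact: integrableZl.
  rewrite -integralZl// -integralD//; apply: eq_integral => w _.
  by rewrite -EFinM -EFinD; congr EFin; ring.
- move=> V sV; rewrite -lee_fin -covarE//; apply: integral_ge0 => w _.
  by rewrite lee_fin -expr2 sqr_ge0.
Qed.

Lemma covar_lin l : (forall p, p \in l -> 0 < p.2) ->
  covar (lin l) (lin l) = \sum_(p <- l) \sum_(q <- l) p.1 * q.1 * covY p.2 q.2.
Proof.
move=> l0; have [_ e] := lin_cov l0 l0.
rewrite /covar e/=; apply: eq_bigr => p _; rewrite mulr_sumr; apply: eq_bigr => q _.
by rewrite covYC mulrA.
Qed.

Lemma covar_bilin_sum (s : seq R) (c : R -> R) : {in s, forall a, 0 < a} ->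
  covar (fun w => \sum_(a <- s) c a * Y a w) (fun w => \sum_(a <- s) c a * Y a w)
  = bilin_sum covY s c.
Proof.
move=> s0.
have -> : (fun w => \sum_(a <- s) c a * Y a w) = lin [seq (c a, a) | a <- s].
  by apply/funext => w; rewrite /lin big_map.
rewrite covar_lin; last by move=> p /mapP[a /s0 a0 ->].
by rewrite big_map; apply: eq_bigr => a _; rewrite big_map.
Qed.

(** The only place where the Gaussian hypothesis and the zero mean enter. Afterwards the law is
    known through the characteristic functions of linear combinations. *)
Lemma tilted_covar : tilted P linspan (fun=> 1) 1 covar.
Proof.
split => //; first exact: psd_covar.
move=> W sW; rewrite mul1r.
transitivity (\int[P]_w (cos (W w))%:E)%E; first by apply: eq_integral => w _; rewrite mulr1.
have mW := span_meas sW.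
rewrite (@gaussian_law_cos _ _ _ _ _ (covar W W))// ?mulNr//.
- have [l [l0 ->]] := sW.
  have := gY (n := size l) (t := fun i => (nth (0, 1) l i).2) (fun i => (nth (0, 1) l i).1).
  rewrite (_ : (fun w => _) = lin l); last first.
    by apply/funext => w; rewrite /lin (big_nth (0, 1)) big_mkord.
  by apply=> i; rewrite /= in_itv/= andbT; apply: l0; rewrite mem_nth.
- have [l [l0 ->]] := sW.
  have H t : 0 < t -> P.-integrable setT (fun w => (Y t w * 1)%:E) /\
      (\int[P]_w (Y t w * 1)%:E = 0%:E)%E.
    move=> t0; have E : (fun w => (Y t w * 1)%:E) = (fun w => (Y t w)%:E) :> (T -> \bar R).
      by apply/funext => w; rewrite mulr1.
    rewrite E; split; last by have := EY t0; rewrite unlock.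
    apply: (@le_integrable _ T R P setT measurableT _ (fun w => 1%:E + (Y t w ^+ 2)%:E)%E).
    + exact/measurable_EFinP.
    + move=> w _; rewrite -EFinD lee_fin [leRHS]ger0_norm ?addr_ge0 ?sqr_ge0//.
      rewrite -[Y t w ^+ 2]real_normK ?num_real//.
      by have := normr_ge0 (Y t w); have := sqr_ge0 (`|Y t w| - 1); rewrite sqrrB1; nra.
    + apply: integrableD => //; last exact: Ysqr_int.
      exact: finite_measure_integrable_cst.
  have [_] := @lin_integral (fun=> 1) (fun=> 0) l H l0.
  rewrite big1 => [e|p _]; last by rewrite mulr0.
  by apply: etrans e; apply: eq_integral => w _; rewrite mulr1.
- rewrite -covarE//; apply: eq_integral => w _; by rewrite expr2.
Qed.

End process_span.

(** * Comparison of the covariance with the Cauchy kernel *)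

Section cov_bounds.
Context {R : realType}.
Implicit Types (s : seq R) (c : R -> R).

(** The integral over [0, 1] is the one over the half-line minus the one beyond 1, and shifting the
    latter by 1 damps the coefficients by [expR (- a)]. *)
Lemma bilin_covY s c : bilin_sum covY s c =
  cauchy_sum s c - cauchy_sum s (fun a => expR (- a) * c a).
Proof.
rewrite /cauchy_sum /bilin_sum -sumrB; apply: eq_bigr => a _.
rewrite -sumrB; apply: eq_bigr => b _.
by rewrite /covY expRD; ring.
Qed.

Lemma bilin_covY_le s c : {in s, forall a, 0 < a} -> bilin_sum covY s c <= cauchy_sum s c.
Proof. by move=> s0; rewrite bilin_covY gerBl cauchy_ge0. Qed.

(** A crude termwise bound; it suffices because it is applied to the damped coefficients. *)
Lemma cauchy_le_size s c (tau : R) : 0 < tau -> {in s, forall a, tau <= a} ->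
  cauchy_sum s c <= (size s)%:R / (2 * tau) * \sum_(a <- s) c a ^+ 2.
Proof.
move=> t0 st; apply: (@le_trans _ _ (\sum_(a <- s) \sum_(b <- s) (c a ^+ 2 + c b ^+ 2) / 2 / (2 * tau))).
  rewrite /cauchy_sum /bilin_sum big_seq [leRHS]big_seq; apply: ler_sum => a /st ta.
  rewrite big_seq [leRHS]big_seq; apply: ler_sum => b /st tb.
  have ab0 : 0 < a + b by lra.
  have h1 : c a * c b <= (c a ^+ 2 + c b ^+ 2) / 2.
    by have := sqr_ge0 (c a - c b); rewrite sqrrB; lra.
  have h2 : 0 <= (c a ^+ 2 + c b ^+ 2) / 2 by rewrite divr_ge0// addr_ge0 ?sqr_ge0.
  have h3 : (a + b)^-1 <= (2 * tau)^-1 by rewrite lef_pV2 ?posrE//; lra.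
  apply: le_trans (ler_wpM2l h2 h3); apply: ler_wpM2r => //.
  by rewrite invr_ge0 ltW.
rewrite le_eqVlt; apply/orP; left; apply/eqP.
under eq_bigr do rewrite -mulr_suml -mulr_suml big_split/=.
rewrite -!mulr_suml big_split/=.
have cst (u : R) : \sum_(a <- s) u = (size s)%:R * u.
  by rewrite big_const_seq count_predT iter_addr_0 mulr_natl.
under eq_bigr do rewrite cst.
rewrite -mulr_sumr cst; set S := \sum_(_ <- _) _.
by field; rewrite gt_eqF.
Qed.

(* On nodes beyond [tau] the part of the Laplace kernel cut off at 1 is negligible. *)
Lemma bilin_covY_ge s c (tau k : R) : 1 <= tau -> uniq s -> {in s, forall a, tau <= a} ->
  0 < k -> {in s, forall p, k <= blaschke [seq q <- s | q != p] p ^+ 2} ->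
  2 * (size s)%:R ^+ 2 * expR (- tau) <= k ->
  2^-1 * cauchy_sum s c <= bilin_sum covY s c.
Proof.
move=> t1 us st k0 sk h; rewrite bilin_covY.
have t0 : 0 < tau by lra.
have s0 : {in s, forall a, 0 < a} by move=> a /st; lra.
set N := cauchy_sum s c; set N' := cauchy_sum s _.
suff : N' <= 2^-1 * N by lra.
have N0 : 0 <= N by exact: cauchy_ge0.
apply: le_trans (cauchy_le_size _ t0 st) _.
have term a : a \in s -> (expR (- a) * c a) ^+ 2 <= 2 * expR (- tau) * N / k.
  move=> as_; have a0 := s0 _ as_; have ta := st _ as_.
  have h1 : c a ^+ 2 <= 2 * a * N / k.
    rewrite ler_pdivlMr//; have := cauchy_coef c us s0 as_.
    rewrite ler_pdivrMr ?mulr_gt0// -/N => h1.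
    rewrite (mulrC (_ * _) N); apply: le_trans h1; rewrite mulrC.
    by apply: ler_wpM2r; [exact: sqr_ge0|exact: sk].
  rewrite exprMn; apply: le_trans (ler_wpM2l (sqr_ge0 _) h1) _.
  (* One factor [expR (- a)] absorbs the [a] of the coefficient bound, the other one yields
     [expR (- tau)]. *)
  have e1 : expR (- a) * a <= 1.
    rewrite -(expRxMexpNx_1 a) mulrC ler_wpM2r ?expR_ge0//.
    by apply: le_trans (expR_ge1Dx a); rewrite lerDr.
  have e2 : expR (- a) <= expR (- tau) by rewrite ler_expR lerN2.
  have -> : expR (- a) ^+ 2 * (2 * a * N / k) = (expR (- a) * (expR (- a) * a)) * (2 * N / k) by ring.
  rewrite (_ : 2 * expR (- tau) * N / k = expR (- tau) * (2 * N / k)); last by ring.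
  apply: ler_wpM2r; first by rewrite divr_ge0 ?mulr_ge0// ltW.
  rewrite -[leRHS]mulr1; apply: ler_pM; rewrite ?expR_ge0// mulr_ge0 ?expR_ge0// ltW//.
have sumle : \sum_(a <- s) (expR (- a) * c a) ^+ 2 <= (size s)%:R * (2 * expR (- tau) * N / k).
  rewrite mulr_natl -iter_addr_0 -count_predT -big_const_seq.
  by rewrite big_seq [leRHS]big_seq; apply: ler_sum.
have n0 : 0 <= (size s)%:R :> R by [].
apply: le_trans (ler_wpM2l _ sumle) _; first by rewrite divr_ge0// mulr_ge0// ltW.
set n := (size s)%:R in h n0 *.
have -> : n / (2 * tau) * (n * (2 * expR (- tau) * N / k)) =
   (2 * n ^+ 2 * expR (- tau) / k) * tau^-1 * (N / 2).
  by field; rewrite !gt_eqF.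
rewrite (mulrC 2^-1) -[leRHS]mul1r; apply: ler_wpM2r; first by rewrite divr_ge0.
rewrite -[leRHS]mulr1; apply: ler_pM.
- by rewrite divr_ge0 ?(ltW k0)// mulr_ge0 ?expR_ge0// mulr_ge0 ?sqr_ge0.
- by rewrite invr_ge0 ltW.
- by rewrite ler_pdivrMr// mul1r.
- by rewrite invf_le1.
Qed.

End cov_bounds.

(** * Upper bound *)

Lemma expR1_le4 (R : realType) : expR 1 <= 4 :> R.
Proof.
have h := expR_ge1Dx (- 2^-1 : R).
have h2 : expR (2^-1) <= 2 :> R.
  rewrite -[leLHS]invrK -expRN -[leRHS]invrK lef_pV2 ?posrE ?expR_gt0 ?invr_gt0//.
  by lra.
have -> : expR 1 = expR (2^-1) * expR (2^-1) :> R by rewrite -expRD; congr expR; field.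
by have := expR_ge0 (2^-1 : R); nra.
Qed.

Lemma sum_prefix (R : realType) (s : seq R) (k : nat) (c : nat -> R) :
  uniq s -> (k < size s)%N -> exists c' : R -> R, c' (nth 1 s k) = 1 /\
  forall y : R -> R, y (nth 1 s k) + \sum_(i < k) c i * y (nth 1 s i) = \sum_(a <- s) c' a * y a.
Proof.
move=> us ks; exists (fun a => if (index a s < k)%N then c (index a s) else (index a s == k)%:R).
rewrite index_uniq// ltnn eqxx; split => // y.
rewrite (big_nth 1) (big_cat_nat (n := k))//=; last exact: ltnW.
rewrite [X in _ = _ + X]big_ltn// index_uniq// ltnn eqxx mul1r.
rewrite [X in _ = _ + (_ + X)]big_nat_cond [X in _ = _ + (_ + X)]big1 ?addr0; last first.
  move=> i /andP[/andP[ki is_] _]; rewrite index_uniq//.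
  by rewrite ltnNge (ltnW ki)/= gtn_eqF// mul0r.
rewrite addrC; congr (_ + _).
rewrite big_mkord; apply: eq_bigr => i _.
by rewrite index_uniq// ?ltn_ord// (ltn_trans _ ks).
Qed.

Section small_ball_upper.
Context d (T : measurableType d) (R : realType) (P : probability T R).
Variable Y : R -> {RV P >-> R}.
Hypothesis gY : gaussian_process `]0%R, +oo[ Y.
Hypothesis EY : forall t : R, 0 < t -> ('E_P[Y t] = 0)%E.
Hypothesis covYE : forall t s : R, 0 < t -> 0 < s ->
  ('E_P[fun w => (Y t w * Y s w)%R] = (covY t s)%:E)%E.

(** With [a = eps ^- 2] the weight is at least [expR (- (n / 2))] on [A], where [n = size s], so
    [P A] is at most [expR (n / 2)] times the mass. Squares avoid the square roots in the mass. *)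
Lemma prob_le_tilt (s : seq R) (eps q : R) (A : set T) : 0 < eps -> 0 <= q ->
  {in s, forall a, 0 < a} -> uniq s -> measurable A ->
  (forall w, A w -> {in s, forall a, `|Y a w| < eps}) ->
  (forall p c, p \in s -> c p = 1 -> q <= bilin_sum covY s c) ->
  fine (P A) ^+ 2 <= expR (size s)%:R * (1 + q / eps ^+ 2) ^- size s.
Proof.
move=> e0 q0 s0 us mA As sq; pose a := eps ^- 2.
have a0 : 0 < a by rewrite invr_gt0 exprn_gt0.
(* The default 1 is a positive time, so [X i] lies in the span even past the end of [s]. *)
pose X i : T -> R := Y (nth 1 s i).
have HX i : linspan Y (X i).
  apply: spanY; case: (ltnP i (size s)) => h; last by rewrite nth_default.
  by apply: s0; rewrite mem_nth.
have [M [b' [tG _ _ _ Mup]]] :=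
  tilt_iter (@spanD _ _ _ _ _) (@span_meas _ _ _ _ _) a0 HX
    (tilted_covar gY EY covYE) (size s).
have mass := tilted_mass (@span0 _ _ _ _ Y) tG.
have {}Mup : M ^+ 2 <= (1 + a * q) ^- size s.
  apply: Mup => // k c ks.
  have [c' [c'k c'E]] := sum_prefix c us ks.
  rewrite (_ : (fun w => _) = (fun w => \sum_(a <- s) c' a * Y a w)); last first.
    by apply/funext => w; rewrite -(c'E (fun a => Y a w)).
  by rewrite (covar_bilin_sum covYE)//; apply: (sq (nth 1 s k)) => //; rewrite mem_nth.
set n := size s in tG mass Mup *.
pose G w := expR (- (a * (\sum_(i < n) X i w ^+ 2) / 2)).
have M0 : 0 < M by exact: tilted_gt0 tG.
have GA w : A w -> expR (- (n%:R / 2)) <= G w.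
  move=> Aw; rewrite ler_expR lerN2 ler_wpM2r ?invr_ge0//.
  rewrite mulrC ler_pdivrMr ?exprn_gt0//.
  apply: (@le_trans _ _ (\sum_(i < n) eps ^+ 2)); last first.
    by rewrite sumr_const card_ord mulr_natl.
  apply: ler_sum => i _; rewrite -[X i w ^+ 2]real_normK ?num_real//.
  by rewrite lerXn2r ?nnegrE ?(ltW e0)// ltW// As// mem_nth.
have PA : P A \is a fin_num by rewrite fin_num_measure.
have H : expR (- (n%:R / 2)) * fine (P A) <= M.
  rewrite -lee_fin EFinM fineK// -mass.
  rewrite -integral_cst//.
  apply: (@le_trans _ _ (\int[P]_(w in A) (G w)%:E)%E).
    apply: ge0_le_integral => //.
    - by move=> w _; rewrite lee_fin expR_ge0.
    - by apply: measurable_funTS; apply/measurable_EFinP; exact: tilted_meas tG.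
  apply: ge0_subset_integral => //.
  - by apply/measurable_EFinP; exact: tilted_meas tG.
  - by move=> w _; rewrite lee_fin expR_ge0.
have p0 : 0 <= fine (P A) by exact: fine_ge0.
have {}H : fine (P A) <= expR (n%:R / 2) * M.
  rewrite expRN in H; move: H; rewrite mulrC ler_pdivrMr ?expR_gt0// mulrC//.
rewrite (_ : q / eps ^+ 2 = a * q); last by rewrite mulrC.
apply: (@le_trans _ _ ((expR (n%:R / 2) * M) ^+ 2)).
  by rewrite lerXn2r ?nnegrE ?mulr_ge0 ?expR_ge0 ?(ltW M0).
rewrite exprMn -expRM_natr; apply: ler_pM; rewrite ?expR_ge0 ?sqr_ge0//.
by rewrite ler_expR divfK.
Qed.

(* With [a = eps ^- 2] each of the [r ^ 2] nodes multiplies [M ^+ 2] by at most about [2 ^ (- 100 r)],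
   whereas the weight is at least [expR (- r ^ 2 / 2)] on the event. *)
Lemma small_ball_upper (r : nat) (eps : R) (A : set T) : (0 < r)%N -> 0 < eps ->
  eps <= 2 ^- (64 * r) -> measurable A ->
  (forall w, A w -> forall t, 0 < t -> `|Y t w| < eps) ->
  fine (P A) <= 2 ^- (50 * r ^ 3).
Proof.
move=> r0 e0 er mA As.
have r1 : 1 <= r%:R :> R by rewrite ler1n.
have [u [uE ru u2]] : exists u : R, [/\ forall n, 2 ^+ (n * r) = u ^+ n, r%:R <= u & 2 <= u].
  exists (2 ^+ r); split; first by move=> n; rewrite mulnC exprM.
    by rewrite -natrX ler_nat ltnW// ltn_expl.
  by rewrite -[leLHS]expr1 ler_weXn2l// ler1n.
have u0 : 0 < u by lra.
have u1 : 1 <= u by lra.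
have un0 n : 0 < u ^+ n by rewrite exprn_gt0.
(* Large enough for [expR (- tau) <= u ^- 32] to beat both [k = u ^- 14] and the number of nodes,
   yet at most [32 * u]. *)
pose tau : R := 32 * r%:R.
have t1 : 1 <= tau by rewrite /tau; lra.
have t0 : 0 < tau by lra.
pose s := grid tau r r.
have us : uniq s by exact: uniq_grid.
have st : {in s, forall a, tau <= a} by exact: grid_ge.
have s0 : {in s, forall a, 0 < a} by move=> a /st; lra.
have ns : size s = (r * r)%N by exact: size_grid.
pose k : R := u ^- 14.
have k0 : 0 < k by rewrite invr_gt0.
have sk : {in s, forall p, k <= blaschke [seq q <- s | q != p] p ^+ 2}.
  by move=> p ps; rewrite /k -uE; exact: grid_blaschke.
have small : 2 * (size s)%:R ^+ 2 * expR (- tau) <= k.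
  rewrite ns natrM expRN ler_pdivrMr ?expR_gt0//.
  have e2 : u ^+ 32 <= expR tau.
    rewrite -uE /tau -natrM -[X in expR X]mul1r expRM_natr lerXn2r ?nnegrE ?expR_ge0//.
    by have := expR_ge1Dx (1 : R); lra.
  apply: (@le_trans _ _ (k * u ^+ 32)); last by rewrite ler_pM2l.
  have -> : k * u ^+ 32 = u ^+ 18 by rewrite /k; field; rewrite gt_eqF.
  apply: (@le_trans _ _ (u * (u * u) ^+ 2)); last first.
    by rewrite -expr2 -exprM -exprS ler_weXn2l.
  apply: ler_pM => //.
  by rewrite lerXn2r ?nnegrE ?mulr_ge0 ?(ltW u0)// ler_pM.
(* Half of [k / (2 * p)], with [p] replaced by the upper end [tau * 16 ^+ r = tau * u ^+ 4] of the
   grid. *)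
pose q : R := k / (4 * (tau * u ^+ 4)).
have T0 : 0 < tau * u ^+ 4 by rewrite mulr_gt0.
have q0 : 0 <= q by rewrite divr_ge0 ?(ltW k0)// mulr_ge0// ltW.
have e16 : 16 ^+ r = u ^+ 4 :> R by rewrite -uE (exprM 2 4) -(natrX _ 2 4).
have sq p c : p \in s -> c p = 1 -> q <= bilin_sum covY s c.
  move=> ps cp; apply: le_trans (bilin_covY_ge c t1 us st k0 sk small).
  have := cauchy_coef c us s0 ps; rewrite cp expr1n mulr1 => h.
  have p0 : 0 < p by exact: s0.
  have h1 : k / (2 * p) <= cauchy_sum s c.
    apply: le_trans h; apply: ler_wpM2r; last exact: sk.
    by rewrite invr_ge0 mulr_ge0// ltW.
  rewrite (_ : q = 2^-1 * (k / (2 * (tau * u ^+ 4)))); last first.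
    by rewrite /q; field; rewrite !gt_eqF.
  rewrite ler_pM2l ?invr_gt0//; apply: le_trans h1.
  rewrite ler_pM2l// lef_pV2 ?posrE; [|by rewrite mulr_gt0..].
  by rewrite ler_pM2l// -e16; exact: (grid_le t0 ps).
have := prob_le_tilt e0 q0 s0 us mA (fun w Aw a as_ => As w Aw a (s0 a as_)) sq.
rewrite ns => H.
have : fine (P A) ^+ 2 <= (2 ^- (50 * r ^ 3)) ^+ 2.
  apply: le_trans H _.
  (* [q >= u ^- 26] and [eps ^- 2 >= u ^+ 128] leave [u ^+ 102]; two powers of [u] pay for the 4,
     which in turn absorbs [expR (r * r)]. *)
  have qe : 4 * u ^+ 100 <= 1 + q / eps ^+ 2.
    apply: (@le_trans _ _ (q / eps ^+ 2)); last by rewrite lerDr.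
    have q2 : u ^- 26 <= q.
      have -> : u ^- 26 = k / u ^+ 12 by rewrite /k; field; rewrite gt_eqF.
      rewrite /q ler_pM2l// lef_pV2 ?posrE//; last by rewrite mulr_gt0.
      have -> : u ^+ 12 = u ^+ 7 * (u * u ^+ 4) by rewrite -exprS -exprD.
      have -> : 4 * (tau * u ^+ 4) = 4 * 32 * (r%:R * u ^+ 4) by rewrite /tau; ring.
      apply: ler_pM => //; first by rewrite mulr_ge0// ltW.
        rewrite (_ : 4 * 32 = 2 ^+ 7 :> R); last by rewrite -natrX -natrM.
        by rewrite lerXn2r// nnegrE ltW.
      by rewrite ler_wpM2r// ltW.
    have ee : u ^+ 128 <= eps ^- 2.
      rewrite -[leLHS]invrK lef_pV2 ?posrE ?invr_gt0 ?exprn_gt0//.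
      have -> : u ^- 128 = (u ^- 64) ^+ 2 by rewrite exprVn -exprM.
      by rewrite lerXn2r ?nnegrE ?invr_ge0 ?(ltW (un0 _)) ?(ltW e0)// -uE.
    apply: (@le_trans _ _ (u ^- 26 * u ^+ 128)); last first.
      by apply: ler_pM => //; rewrite ?invr_ge0 ltW.
    have -> : u ^- 26 * u ^+ 128 = u ^+ 2 * u ^+ 100.
      by rewrite -exprD -[128%N]/(26 + 102)%N exprD mulKf// gt_eqF.
    rewrite ler_pM2r// (_ : 4 = 2 ^+ 2 :> R); last by rewrite -natrX.
    by rewrite lerXn2r// nnegrE ltW.
  have e4 := expR1_le4 R.
  have en : expR (r * r)%:R <= 4 ^+ (r * r) :> R.
    by rewrite -[X in expR X]mul1r expRM_natr lerXn2r ?nnegrE ?expR_ge0.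
  have w0 : 0 < 4 * u ^+ 100 by rewrite mulr_gt0.
  apply: (@le_trans _ _ (4 ^+ (r * r) * (4 * u ^+ 100) ^- (r * r))).
    apply: ler_pM => //; rewrite ?expR_ge0 ?invr_ge0 ?exprn_ge0//.
      by apply: le_trans qe; exact: ltW.
    rewrite lef_pV2 ?posrE ?exprn_gt0//; last by apply: lt_le_trans qe.
    by rewrite lerXn2r ?nnegrE ?(ltW w0)//; apply: le_trans qe; exact: ltW.
  rewrite exprMn invfM mulrA divff ?mul1r; last by rewrite gt_eqF// exprn_gt0.
  have -> : 2 ^+ (50 * r ^ 3) = (u ^+ 50) ^+ (r * r) :> R.
    rewrite -exprM -uE; congr (_ ^+ _).
    by rewrite !expnS expn0 muln1 -!mulnA.
  have -> : (u ^+ 50 ^- (r * r)) ^+ 2 = u ^+ 100 ^- (r * r) => //.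
  by rewrite exprVn (exprAC (u ^+ 50) (r * r) 2) -(exprM u 50 2).
rewrite ler_sqr ?nnegrE ?invr_ge0 ?exprn_ge0//.
exact: fine_ge0.
Qed.

End small_ball_upper.

(** * Lower bound *)

Section dyadic_chain.
Context {R : realType}.
Implicit Types (a b lam t : R) (f : R -> R).

Definition dyadic a b (m i : nat) : R := a + (b - a) * (i%:R / 2 ^+ m).

Lemma dyadic_double a b m i : dyadic a b m.+1 (2 * i) = dyadic a b m i.
Proof.
by rewrite /dyadic natrM exprS; congr (_ + _ * _); field; rewrite gt_eqF ?exprn_gt0.
Qed.

Lemma dyadic_in a b m i : a < b -> (0 < i)%N -> (i <= 2 ^ m)%N -> a < dyadic a b m i <= b.
Proof.
move=> ab i0 im; rewrite /dyadic.
have w0 : 0 < 2 ^+ m :> R by rewrite exprn_gt0.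
have ba : 0 < b - a by rewrite subr_gt0.
have h1 : 0 < i%:R / 2 ^+ m :> R by rewrite divr_gt0// ltr0n.
have h2 : i%:R / 2 ^+ m <= 1 :> R by rewrite ler_pdivrMr// mul1r -natrX ler_nat.
by rewrite ltrDl mulr_gt0//=; have := ler_wpM2l (ltW ba) h2; rewrite mulr1; lra.
Qed.

(** An odd point of level [m.+1] is compared only with its right neighbour, a point of level [m].
    The chain ends at [b] and never visits [a], which is time 0 for the first cell; hence the
    exclusion of [i = 0]. The bound is a partial geometric sum. *)
Lemma dyadic_chain a b lam f : a < b -> 0 < lam ->
  (forall m i, (i < 2 ^ m)%N ->
    `|f (dyadic a b m.+1 (2 * i).+1) - f (dyadic a b m.+1 (2 * i).+2)| <= lam * (4 / 5) ^+ m) ->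
  forall m i, (0 < i)%N -> (i <= 2 ^ m)%N ->
    `|f (dyadic a b m i) - f b| <= 5 * lam * (1 - (4 / 5) ^+ m).
Proof.
move=> ab lam0 fm; elim=> [|m IH] i i0 im.
  have -> : i = 1%N by move: i0 im; rewrite expn0; lia.
  by rewrite /dyadic expr0 divr1 mulr1 subrKC !subrr normr0 mulr0.
have q0 : 0 <= (4 / 5) ^+ m :> R by rewrite exprn_ge0// divr_ge0.
have qS : (4 / 5) ^+ m.+1 = 4 / 5 * (4 / 5) ^+ m :> R by rewrite exprS.
have step : 5 * lam * (1 - (4 / 5) ^+ m) + lam * (4 / 5) ^+ m = 5 * lam * (1 - (4 / 5) ^+ m.+1).
  by rewrite qS; field.
have lq : 0 <= lam * (4 / 5) ^+ m by rewrite mulr_ge0// ltW.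
rewrite -step.
have [j [ij|ij]] : exists j, i = (2 * j)%N \/ i = (2 * j).+1.
  by exists i./2; have := odd_double_half i; case: (odd i) => /=; lia.
  rewrite ij dyadic_double; apply: le_trans (IH j _ _) _; [lia| |by rewrite lerDl].
  by move: im; rewrite ij expnS leq_pmul2l.
have jm : (j < 2 ^ m)%N by move: im; rewrite ij expnS; lia.
rewrite ij -(subrK (f (dyadic a b m.+1 (2 * j).+2)) (f (dyadic a b m.+1 (2 * j).+1))) -addrA.
apply: le_trans (ler_normD _ _) _; rewrite [leRHS]addrC; apply: lerD; first exact: fm.
have -> : (2 * j).+2 = (2 * j.+1)%N by lia.
by rewrite dyadic_double; apply: IH.
Qed.

Lemma dyadic_sup a b lam f : a < b -> 0 < lam ->
  (forall t, a < t -> {for t, continuous f}) ->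
  (forall m i, (i < 2 ^ m)%N ->
    `|f (dyadic a b m.+1 (2 * i).+1) - f (dyadic a b m.+1 (2 * i).+2)| <= lam * (4 / 5) ^+ m) ->
  forall t, a < t <= b -> `|f t - f b| <= 5 * lam.
Proof.
move=> ab lam0 cf fm t /andP[at_]; rewrite le_eqVlt => /predU1P[->|tb].
  by rewrite subrr normr0 mulr_ge0// ltW.
have ba : 0 < b - a by rewrite subr_gt0.
pose s := (t - a) / (b - a).
have s0 : 0 < s by rewrite divr_gt0// subr_gt0.
have s1 : s < 1 by rewrite ltr_pdivrMr// mul1r; lra.
apply/ler_addgt0Pr => e e0.
have /cvgrPdist_lt/(_ _ e0) := cf t at_.
move=> /nbhs_ballP[de /= de0 H].
have [m hm] : exists m : nat, (b - a) / de < 2 ^+ m.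
  exists (Num.truncn ((b - a) / de)).+1; apply: lt_le_trans (truncnS_gt _) _.
  by rewrite -natrX ler_nat ltnW// ltn_expl.
have w0 : 0 < 2 ^+ m :> R by rewrite exprn_gt0.
(* Rounding up ensures [0 < i]. *)
pose i := (Num.truncn (2 ^+ m * s)).+1.
have /andP[i1 i2] : (Num.truncn (2 ^+ m * s))%:R <= 2 ^+ m * s < i%:R.
  by apply: truncn_itv; rewrite mulr_ge0// ltW.
have im : (i <= 2 ^ m)%N.
  rewrite -(ltr_nat R) natrX; apply: le_lt_trans i1 _.
  by rewrite gtr_pMr.
have clo : `|f t - f (dyadic a b m i)| < e.
  apply: H; rewrite /ball/= /dyadic.
  have -> : t - (a + (b - a) * (i%:R / 2 ^+ m)) = - ((b - a) / 2 ^+ m * (i%:R - 2 ^+ m * s)).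
    by rewrite /s; field; rewrite !gt_eqF.
  rewrite normrN normrM ger0_norm ?divr_ge0 ?ltW//.
  have h3 : `|i%:R - 2 ^+ m * s| <= 1.
    rewrite ger0_norm ?subr_ge0 ?(ltW i2)//.
    by move: i1; rewrite /i -[in X in _ -> X]natr1; lra.
  apply: le_lt_trans (ler_wpM2l _ h3) _; first by rewrite divr_ge0 ?ltW.
  by rewrite mulr1 ltr_pdivrMr// mulrC -ltr_pdivrMr.
have c2 := dyadic_chain ab lam0 fm (ltn0Sn _ : (0 < i)%N) im.
rewrite -(subrK (f (dyadic a b m i)) (f t)) -addrA.
apply: le_trans (ler_normD _ _) _; rewrite [leRHS]addrC; apply: lerD; first exact: ltW.
apply: le_trans c2 _; rewrite ler_piMr ?mulr_ge0 ?(ltW lam0)//.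
Qed.

End dyadic_chain.

Lemma nneseries_le (R : realType) (u : nat -> R) (C : R) : (forall i, 0 <= u i) ->
  (forall n, \sum_(0 <= i < n) u i <= C) -> (\sum_(0 <= i <oo) (u i)%:E <= C%:E)%E.
Proof.
move=> u0 uC; apply: lime_le.
  by apply: is_cvg_nneseries => i _ _; rewrite lee_fin.
by apply: nearW => n; rewrite sumEFin lee_fin.
Qed.

Section tilted_small_ball.
Context d (T : measurableType d) (R : realType) (P : probability T R).
Variable Y : R -> {RV P >-> R}.
Variables (G : T -> R) (M : R) (b : (T -> R) -> (T -> R) -> R).
Hypothesis tG : tilted P (linspan Y) G M b.
(** [be] lists the ends of the cells. [w_ k] bounds the variance at the right end of cell [k] and,
    relative to the length of the cell, that of its increments. *)
Variables (be : nat -> R) (w_ : nat -> R) (lam W : R).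
Hypothesis be_ge0 : forall k, 0 <= be k.
Hypothesis be_lt : forall k, be k < be k.+1.
Hypothesis be_cover : forall t, 0 < t -> exists k, be k < t <= be k.+1.
Hypothesis w_ge0 : forall k, 0 <= w_ k.
Hypothesis w_sum : forall n, \sum_(0 <= k < n) w_ k <= W.
Hypothesis lam0 : 0 < lam.
Hypothesis lamW : 6 * W <= lam ^+ 2.
Hypothesis b_end : forall k, b (Y (be k.+1)) (Y (be k.+1)) <= w_ k.
Hypothesis b_inc : forall k t s, be k < t <= be k.+1 -> be k < s <= be k.+1 ->
  b (fun w => Y t w + -1 * Y s w) (fun w => Y t w + -1 * Y s w)
    <= w_ k * ((t - s) / (be k.+1 - be k)) ^+ 2.

Let inc k m i w : R := Y (dyadic (be k) (be k.+1) m.+1 (2 * i).+1) w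
  + -1 * Y (dyadic (be k) (be k.+1) m.+1 (2 * i).+2) w.

(** [V k m w < 1] forces all thresholds of level [m] in cell [k] to hold; the end of the cell is
    counted at level 0. *)
Let V k (m : nat) w : R := (m == 0%N)%:R * (Y (be k.+1) w / lam) ^+ 2
  + \sum_(i < 2 ^ m) (inc k m i w / (lam * (4 / 5) ^+ m)) ^+ 2.

(** There are [2 ^ m] increments of variance at most [w_ k * 4 ^- m.+1], against squared thresholds
    [lam ^+ 2 * (16 / 25) ^+ m]; this gives the ratio 25/32. Any ratio between 1/sqrt 2 and 1 in
    place of 4/5 would give a convergent series. *)
Let rho (m : nat) : R := ((m == 0%N)%:R + (25 / 32) ^+ m / 4) / lam ^+ 2.

Let q0 m : 0 < (4 / 5 : R) ^+ m.
Proof. by rewrite exprn_gt0// divr_gt0. Qed.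

Let be_gt0 k : 0 < be k.+1.
Proof. exact: le_lt_trans (be_lt k). Qed.

Let dy_in k m i : (i < 2 ^ m)%N ->
  (be k < dyadic (be k) (be k.+1) m.+1 (2 * i).+1 <= be k.+1) /\
  (be k < dyadic (be k) (be k.+1) m.+1 (2 * i).+2 <= be k.+1).
Proof. by move=> im; split; apply: dyadic_in => //; rewrite expnS; lia. Qed.

Let inc_span k m i : (i < 2 ^ m)%N -> linspan Y (inc k m i).
Proof.
move=> /dy_in -/(_ k) [/andP[h1 _] /andP[h2 _]].
by apply: spanD; apply: spanY; [exact: le_lt_trans h1|exact: le_lt_trans h2].
Qed.

Let V_ge0 k m w : 0 <= V k m w.
Proof.
apply: addr_ge0; first by rewrite mulr_ge0// sqr_ge0.
by apply: sumr_ge0 => i _; exact: sqr_ge0.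
Qed.

Let mV k m : measurable_fun setT (V k m).
Proof.
apply: measurable_funD.
  by apply: measurable_funM => //; apply: measurable_funX; apply: measurable_funM.
apply: measurable_sum => i; apply: measurable_funX; apply: measurable_funM => //.
by apply: measurable_funD => //; apply: measurable_funM.
Qed.

Let mG : measurable_fun setT G. Proof. exact: tilted_meas tG. Qed.
Let G0 w : 0 <= G w. Proof. exact: tilted_ge0 tG w. Qed.

Let int_sqr Z (c : R) : linspan Y Z ->
  (\int[P]_w ((Z w / c) ^+ 2 * G w)%:E <= (M * b Z Z / c ^+ 2)%:E)%E.
Proof.
move=> sZ; have mZ := span_meas sZ.
have -> : (\int[P]_w ((Z w / c) ^+ 2 * G w)%:E = (c ^- 2)%:E * \int[P]_w (Z w ^+ 2 * G w)%:E)%E.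
  rewrite -ge0_integralZl//.
  - by apply: eq_integral => w _; rewrite -EFinM; congr EFin; rewrite exprMn exprVn; ring.
  - by apply/measurable_EFinP; apply: measurable_funM => //; exact: measurable_funX.
  - by move=> w _; rewrite lee_fin mulr_ge0// sqr_ge0.
  - by rewrite lee_fin invr_ge0 sqr_ge0.
rewrite mulrC EFinM; apply: lee_wpmul2l; first by rewrite lee_fin invr_ge0 sqr_ge0.
exact: (tilted_moment2 (@span0 _ _ _ _ Y) (@spanD _ _ _ _ _) (@span_meas _ _ _ _ _) tG).
Qed.

Let intV k m : (\int[P]_w (V k m w * G w)%:E <= (M * (w_ k * rho m))%:E)%E.
Proof.
have M0 : 0 < M by exact: tilted_gt0 tG.
have mZ (Z : T -> R) : measurable_fun setT Z -> measurable_fun setT (fun w => (Z w ^+ 2 * G w)%:E).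
  by move=> ?; apply/measurable_EFinP; apply: measurable_funM => //; exact: measurable_funX.
have minc (i : nat) : measurable_fun setT (fun w => inc k m i w / (lam * (4 / 5) ^+ m)).
  apply: measurable_funM => //; apply: measurable_funD => //; exact: measurable_funM.
have mend : measurable_fun setT (fun w => Y (be k.+1) w / lam) by apply: measurable_funM.
have -> : (\int[P]_w (V k m w * G w)%:E =
   (m == 0%N)%:R%:E * \int[P]_w ((Y (be k.+1) w / lam) ^+ 2 * G w)%:E
   + \sum_(i < 2 ^ m) \int[P]_w ((inc k m i w / (lam * (4 / 5) ^+ m)) ^+ 2 * G w)%:E)%E.
  have e1 : ((m == 0%N)%:R%:E * \int[P]_w ((Y (be k.+1) w / lam) ^+ 2 * G w)%:E =
      \int[P]_w ((m == 0%N)%:R%:E * ((Y (be k.+1) w / lam) ^+ 2 * G w)%:E))%E.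
    rewrite ge0_integralZl//; first exact: mZ.
    by move=> w _; rewrite lee_fin mulr_ge0// sqr_ge0.
  have e2 : (\sum_(i < 2 ^ m) \int[P]_w ((inc k m i w / (lam * (4 / 5) ^+ m)) ^+ 2 * G w)%:E =
      \int[P]_w \sum_(i < 2 ^ m) ((inc k m i w / (lam * (4 / 5) ^+ m)) ^+ 2 * G w)%:E)%E.
    rewrite ge0_integral_sum//; first by move=> i; exact: mZ.
    by move=> i w _; rewrite lee_fin mulr_ge0// sqr_ge0.
  rewrite e1 e2 -ge0_integralD//.
  - apply: eq_integral => w _; rewrite sumEFin -EFinM -EFinD; congr EFin.
    by rewrite /V mulrDl mulr_suml -mulrA.
  - by move=> w _; rewrite mule_ge0// lee_fin mulr_ge0// sqr_ge0.
  - by apply: measurable_funeM; exact: mZ.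
  - by move=> w _; apply: sume_ge0 => i _; rewrite lee_fin mulr_ge0// sqr_ge0.
  - by apply: emeasurable_sum => i; exact: mZ.
have H1 : (\int[P]_w ((Y (be k.+1) w / lam) ^+ 2 * G w)%:E <= (M * w_ k / lam ^+ 2)%:E)%E.
  apply: le_trans (int_sqr lam (spanY Y (be_gt0 k))) _.
  rewrite lee_fin ler_wpM2r ?invr_ge0 ?sqr_ge0//.
  by rewrite ler_wpM2l ?b_end// ltW.
have H2 (i : 'I_(2 ^ m)) : (\int[P]_w ((inc k m i w / (lam * (4 / 5) ^+ m)) ^+ 2 * G w)%:E
    <= (M * w_ k / lam ^+ 2 * ((25 / 64) ^+ m / 4))%:E)%E.
  apply: le_trans (int_sqr (lam * (4 / 5) ^+ m) (inc_span k (ltn_ord i))) _.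
  have [h1 h2] := dy_in k (ltn_ord i).
  have := b_inc h1 h2.
  have -> : (dyadic (be k) (be k.+1) m.+1 (2 * i).+1 - dyadic (be k) (be k.+1) m.+1 (2 * i).+2)
     / (be k.+1 - be k) = - (2 ^- m.+1).
    have ? : 0 < be k.+1 - be k by rewrite subr_gt0.
    have ? : 0 < 2 ^+ m.+1 :> R by rewrite exprn_gt0.
    by rewrite /dyadic -[(2 * i).+2%:R]natr1; field; rewrite !gt_eqF.
  rewrite sqrrN => h; rewrite lee_fin.
  have -> : M * w_ k / lam ^+ 2 * ((25 / 64) ^+ m / 4) = M * (w_ k * (2 ^- m.+1) ^+ 2) / (lam * (4 / 5) ^+ m) ^+ 2.
    have -> : (25 / 64 : R) = (5 / 4) ^+ 2 * (1 / 2) ^+ 2 by field.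
    rewrite exprMn !exprMn !exprVn !expr1n ?exprS.
    rewrite !expr0 !mulr1; set x := 4 ^+ m; set y := 5 ^+ m; set z := 2 ^+ m.
    by field; rewrite !gt_eqF// ?exprn_gt0.
  rewrite ler_wpM2r ?invr_ge0 ?sqr_ge0//.
  by rewrite ler_wpM2l// ltW.
apply: (@le_trans _ _ ((m == 0%N)%:R%:E * (M * w_ k / lam ^+ 2)%:E +
   \sum_(i < 2 ^ m) (M * w_ k / lam ^+ 2 * ((25 / 64) ^+ m / 4))%:E)%E).
  apply: leeD; last by apply: lee_sum.
  by apply: lee_wpmul2l; rewrite ?lee_fin.
rewrite sumEFin -EFinM -EFinD lee_fin sumr_const card_ord -[_ *+ (2 ^ m)%N]mulr_natl natrX.
rewrite le_eqVlt; apply/orP; left; apply/eqP.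
have e25 : (25 / 32 : R) = 2 * (25 / 64) by field.
rewrite /rho e25 (exprMn m 2 (25 / 64)); set x := 2 ^+ m; set y := (25 / 64) ^+ m.
by field; rewrite gt_eqF.
Qed.

Let rho_sum n : \sum_(0 <= m < n) rho m <= 3 / lam ^+ 2.
Proof.
rewrite /rho -mulr_suml ler_wpM2r ?invr_ge0 ?sqr_ge0// big_split/=.
have h1 : \sum_(0 <= i < n) (i == 0%N)%:R <= 1 :> R.
  case: n => [|n]; first by rewrite big_nil.
  by rewrite big_nat_recl//= big1 ?addr0.
have h2 : \sum_(0 <= i < n) (25 / 32 : R) ^+ i / 4 <= 8 / 7.
  suff : \sum_(0 <= i < n) (25 / 32 : R) ^+ i / 4 = 8 / 7 * (1 - (25 / 32) ^+ n).
    by have : 0 <= (25 / 32 : R) ^+ n by [rewrite exprn_ge0// divr_ge0]; lra.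
  elim: n {h1} => [|n IH]; first by rewrite big_nil expr0; lra.
  by rewrite big_nat_recr//= IH exprS; lra.
by lra.
Qed.

(* Chebyshev's inequality under the weight, with threshold [lam] at the right end of each cell and
   [lam * (4 / 5) ^+ m] for the dyadic increments of level [m]; [6 = 1 + sum_m (4 / 5) ^ m]. *)
Lemma tilted_small_ball (A : set T) : measurable A ->
  {ae P, forall w, {within `]0, +oo[, continuous (fun t : R => Y t w)}} ->
  (forall w, (forall t : R, 0 < t -> `|Y t w| <= 6 * lam) -> A w) ->
  M / 2 <= fine (P A).
Proof.
move=> mA cY AP.
have M0 : 0 < M by exact: tilted_gt0 tG.
have VG0 k m w : (0 <= (V k m w * G w)%:E)%E by rewrite lee_fin mulr_ge0.
have mVG k m : measurable_fun setT (fun w => (V k m w * G w)%:E).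
  by apply/measurable_EFinP; exact: measurable_funM.
pose S w := (\sum_(0 <= k <oo) \sum_(0 <= m <oo) (V k m w * G w)%:E)%E.
have Sm0 k w : (0 <= \sum_(0 <= m <oo) (V k m w * G w)%:E)%E.
  by apply: nneseries_ge0 => m _ _.
have mSk k : measurable_fun setT (fun w => \sum_(0 <= m <oo) (V k m w * G w)%:E)%E.
  have := @ge0_emeasurable_sum _ T R setT (fun m w => (V k m w * G w)%:E) xpredT
    (fun m w _ _ => VG0 k m w) (fun m _ => mVG k m).
  by [].
have mS : measurable_fun setT S.
  have := @ge0_emeasurable_sum _ T R setT (fun k w => \sum_(0 <= m <oo) (V k m w * G w)%:E)%E xpredT
    (fun k w _ _ => Sm0 k w) (fun k _ => mSk k).
  by [].
(* The [rho m] sum to at most [3 / lam ^+ 2], so [6 * W <= lam ^+ 2] leaves half of the mass. *)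
have intS : (\int[P]_w S w <= (M / 2)%:E)%E.
  rewrite /S integral_nneseries//.
  apply: (@le_trans _ _ (\sum_(0 <= k <oo) (M * (w_ k * (3 / lam ^+ 2)))%:E)%E).
    apply: lee_nneseries => [k _ _|k _]; first by apply: integral_ge0 => w _; exact: Sm0.
    rewrite integral_nneseries//.
    apply: (@le_trans _ _ (\sum_(0 <= m <oo) (M * (w_ k * rho m))%:E)%E).
      by apply: lee_nneseries => [m _ _|m _]; [exact: integral_ge0|exact: intV].
    have rho0 m : 0 <= rho m.
      by rewrite divr_ge0 ?sqr_ge0// addr_ge0// divr_ge0// exprn_ge0// divr_ge0.
    apply: nneseries_le => [m|n]; first by apply: mulr_ge0; [exact: ltW|exact: mulr_ge0].
    rewrite -mulr_sumr -mulr_sumr ler_wpM2l ?(ltW M0)// ler_wpM2l//.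
  apply: nneseries_le => [k|n].
    by rewrite !mulr_ge0 ?(ltW M0)// invr_ge0 sqr_ge0.
  rewrite -mulr_sumr -mulr_suml ler_wpM2l ?(ltW M0)//.
  have l2 : 0 < lam ^+ 2 by rewrite exprn_gt0.
  rewrite mulrA ler_pdivrMr//; move: (w_sum n) lamW.
  by set s := \sum_(_ <= _ < _) _; set l := lam ^+ 2; clearbody s l; lra.
(* Almost surely the weight is at most the indicator of [A] plus [S]: where [A] fails, some [V k m]
   is at least 1. *)
have H : (\int[P]_w (G w)%:E <= \int[P]_w ((\1_A w)%:E + S w))%E.
  apply: ae_ge0_le_integral => //.
  - by move=> w _; rewrite lee_fin.
  - exact/measurable_EFinP.
  - by move=> w _; rewrite adde_ge0 ?lee_fin//; apply: nneseries_ge0 => k _ _; exact: Sm0.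
  - by apply: emeasurable_funD => //; apply/measurable_EFinP; exact: measurable_indic.
  apply: filterS cY => w cw _.
  have S0 : (0 <= S w)%E by apply: nneseries_ge0 => k _ _; exact: Sm0.
  have [Aw|nAw] := pselect (A w).
    rewrite indicE mem_set//; apply: (@le_trans _ _ 1%E); last by rewrite leeDl.
    by rewrite lee_fin; exact: tilted_le1 tG w.
  rewrite indicE memNset// add0e.
  have [[k m] /= Vkm] : exists km : nat * nat, 1 <= V km.1 km.2 w.
    apply: contrapT => nV; apply: nAw; apply: AP => t t0.
    have V1 k m : V k m w < 1.
      by rewrite ltNge; apply/negP => h; apply: nV; exists (k, m).
    have [k tk] := be_cover t0.
    have absle (x c : R) : 0 < c -> (x / c) ^+ 2 < 1 -> `|x| <= c.
      move=> c0; rewrite expr_div_n ltr_pdivrMr ?exprn_gt0// mul1r => xc.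
      by rewrite -ler_sqr ?nnegrE ?(ltW c0)// real_normK ?num_real// ltW.
    have end_le : `|Y (be k.+1) w| <= lam.
      apply: absle => //; apply: le_lt_trans (V1 k 0%N).
      by rewrite /V eqxx mul1r lerDl sumr_ge0// => i _; rewrite sqr_ge0.
    have inc_le m i : (i < 2 ^ m)%N -> `|inc k m i w| <= lam * (4 / 5) ^+ m.
      move=> im; apply: absle; first by rewrite mulr_gt0.
      apply: le_lt_trans (V1 k m).
      rewrite /V (bigD1 (Ordinal im))//= addrCA lerDl; apply: addr_ge0.
        by apply: mulr_ge0 => //; exact: sqr_ge0.
      by apply: sumr_ge0 => j _; exact: sqr_ge0.
    have ct t' : be k < t' -> {for t', continuous (fun t => Y t w)}.
      move=> kt'; move: cw; rewrite continuous_open_subspace; last exact: interval_open.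
      by apply; rewrite inE/= in_itv/= andbT; exact: le_lt_trans kt'.
    have inc_le' m i : (i < 2 ^ m)%N -> `|Y (dyadic (be k) (be k.+1) m.+1 (2 * i).+1) w
        - Y (dyadic (be k) (be k.+1) m.+1 (2 * i).+2) w| <= lam * (4 / 5) ^+ m.
      by move=> im; have := inc_le m i im; rewrite /inc mulN1r.
    have h := dyadic_sup (f := fun t => Y t w) (be_lt k) lam0 ct inc_le' tk.
    rewrite -(subrK (Y (be k.+1) w) (Y t w)).
    by apply: le_trans (ler_normD _ _) _; lra.
  apply: (@le_trans _ _ (V k m w * G w)%:E); first by rewrite lee_fin ler_peMl.
  apply: (@le_trans _ _ (\sum_(0 <= m <oo) (V k m w * G w)%:E)%E).
    have := @nneseries_lim_ge R (fun m => (V k m w * G w)%:E) xpredT 0 m.+1 (fun m _ _ => VG0 k m w).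
    apply: le_trans; rewrite big_nat_recr//= leeDr// sume_ge0// => i _; exact: VG0.
  have := @nneseries_lim_ge R (fun k => \sum_(0 <= m <oo) (V k m w * G w)%:E)%E xpredT 0 k.+1 (fun k _ _ => Sm0 k w).
  apply: le_trans; rewrite big_nat_recr//= leeDr// sume_ge0// => i _; exact: Sm0.
have mass := tilted_mass (@span0 _ _ _ _ Y) tG.
have PA : P A \is a fin_num by rewrite fin_num_measure.
move: H; rewrite mass ge0_integralD//; last 2 first.
- by apply/measurable_EFinP; exact: measurable_indic.
- by move=> w _; apply: nneseries_ge0 => k _ _; exact: Sm0.
rewrite integral_indic// setIT => H.
have : (M%:E <= P A + (M / 2)%:E)%E by apply: le_trans H _; rewrite leeD2l.
by rewrite -(fineK PA) -EFinD lee_fin; lra.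
Qed.

End tilted_small_ball.

(** * Variances of values and increments *)

Section increments.
Context {R : realType}.
Implicit Types t s : R.

Definition incY t s : R := covY t t + covY s s - 2 * covY t s.

Lemma covY_le1 t : 0 < t -> covY t t <= 1.
Proof.
move=> t0; rewrite /covY ler_pdivrMr ?addr_gt0// mul1r.
by have := expR_ge1Dx (- t - t); lra.
Qed.

Lemma covY_le_inv t : 0 < t -> covY t t <= (2 * t)^-1.
Proof.
move=> t0; rewrite /covY (_ : t + t = 2 * t); last by ring.
by rewrite ler_piMl ?invr_ge0 ?mulr_ge0 ?(ltW t0)// gerBl expR_ge0.
Qed.

Lemma incYC t s : incY t s = incY s t.
Proof. by rewrite /incY (covYC t s) (addrC (covY t t)). Qed.

(* For [covY] is the Cauchy kernel minus a positive definite kernel. *)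
Lemma incY_le_inv t s : 0 < t -> 0 < s -> incY t s <= (t - s) ^+ 2 / (2 * t * s * (t + s)).
Proof.
move=> t0 s0; have ts0 : 0 < t + s by rewrite addr_gt0.
rewrite ler_pdivlMr ?mulr_gt0// /incY /covY !expRD.
set x := expR (- t); set y := expR (- s).
rewrite (_ : t + t = 2 * t); last by ring.
rewrite (_ : s + s = 2 * s); last by ring.
rewrite [leLHS](_ : _ = (t - s) ^+ 2 - (t * s * (x - y) ^+ 2 + (x * s - y * t) ^+ 2)).
  by rewrite gerBl addr_ge0 ?sqr_ge0// mulr_ge0 ?sqr_ge0// mulr_ge0 ?ltW.
by field; rewrite !gt_eqF.
Qed.

(* [phi t s u] is the integral of [(expR (- t * v) - expR (- s * v)) ^+ 2] over [0 <= v <= u]. *)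
Let phi t s (u : R) : R := (1 - expR (- (2 * t) * u)) / (2 * t)
  + (1 - expR (- (2 * s) * u)) / (2 * s) - 2 * ((1 - expR (- (t + s) * u)) / (t + s)).

Let is_derive_phi t s (u : R) : 0 < t -> 0 < s ->
  is_derive u (1 : R) (phi t s) ((expR (- t * u) - expR (- s * u)) ^+ 2).
Proof.
move=> t0 s0; have ts0 : 0 < t + s by rewrite addr_gt0.
rewrite /phi; apply: trigger_derive; rewrite /GRing.scale/=.
rewrite (_ : - (2 * t) * u = - t * u + - t * u); last by ring.
rewrite (_ : - (2 * s) * u = - s * u + - s * u); last by ring.
rewrite (_ : - (t + s) * u = - t * u + - s * u); last by ring.
by rewrite !expRD; field; rewrite !gt_eqF.
Qed.

(** By the mean value theorem the increment of [phi] over [0, 1] is its derivative at some [u]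
    there, and the two exponentials differ at [u] by at most [|t - s|]. *)
Lemma incY_le_sqr t s : 0 < t -> 0 < s -> incY t s <= (t - s) ^+ 2.
Proof.
wlog st : t s / s <= t => [H|] t0 s0.
  have [/H|/ltW/H ts] := leP s t; first exact.
  by rewrite incYC -sqrrN opprB; exact: ts.
have -> : incY t s = phi t s 1 - phi t s 0.
  rewrite /phi !mulr0 expR0 subrr !mul0r mulr0 subr0 addr0 subr0 /incY /covY !mulr1.
  rewrite (_ : - t - t = - (2 * t)); last by ring.
  rewrite (_ : - s - s = - (2 * s)); last by ring.
  rewrite (_ : - t - s = - (t + s)); last by ring.
  by rewrite (_ : t + t = 2 * t) 1?(_ : s + s = 2 * s)//; ring.
have cphi : continuous (phi t s).
  by apply: continuous_of_derive => u; exact: is_derive_phi.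
have [u] := @MVT_segment R (phi t s) (fun u => (expR (- t * u) - expR (- s * u)) ^+ 2) 0 1 ler01
  (fun u _ => is_derive_phi u t0 s0) (continuous_subspaceT cphi).
rewrite in_itv/= subr0 mulr1 => /andP[u0 u1] ->.
rewrite -sqrrN opprB ler_sqr ?nnegrE ?subr_ge0 ?ler_expR//; last by nra.
have -> : expR (- s * u) - expR (- t * u) = expR (- s * u) * (1 - expR (- ((t - s) * u))).
  by rewrite mulrBr mulr1 -expRD; congr (_ - expR _); ring.
have h1 : expR (- s * u) <= 1 by rewrite -expR0 ler_expR; nra.
have h2 : 1 - expR (- ((t - s) * u)) <= (t - s) * u.
  by have := expR_ge1Dx (- ((t - s) * u)); lra.
have h3 : 0 <= 1 - expR (- ((t - s) * u)).
  by rewrite subr_ge0 -expR0 ler_expR oppr_le0 mulr_ge0// subr_ge0.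
apply: le_trans (ler_wpM2r h3 h1) _; rewrite mul1r; apply: le_trans h2 _.
by apply: ler_piMr; rewrite ?subr_ge0.
Qed.

End increments.

Section process_bounds.
Context d (T : measurableType d) (R : realType) (P : probability T R).
Variable Y : R -> {RV P >-> R}.
Hypothesis gY : gaussian_process `]0%R, +oo[ Y.
Hypothesis EY : forall t : R, 0 < t -> ('E_P[Y t] = 0)%E.
Hypothesis covYE : forall t s : R, 0 < t -> 0 < s ->
  ('E_P[fun w => (Y t w * Y s w)%R] = (covY t s)%:E)%E.

Lemma covar_incr (t s : R) : 0 < t -> 0 < s ->
  covar P (fun w => Y t w + -1 * Y s w) (fun w => Y t w + -1 * Y s w) = incY t s.
Proof.
move=> t0 s0; have -> : (fun w => Y t w + -1 * Y s w) = lin Y [:: (1, t); (-1, s)].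
  by apply/funext => w; rewrite /lin big_cons big_seq1/= mul1r.
rewrite (covar_lin covYE); last by move=> p; rewrite !inE => /orP[|] /eqP ->.
by rewrite !big_cons !big_nil /incY /= (covYC s t); ring.
Qed.

Lemma covar_one (t : R) : 0 < t -> covar P (Y t) (Y t) = covY t t.
Proof.
move=> t0; have -> : (Y t : T -> R) = lin Y [:: (1, t)].
  by apply/funext => w; rewrite /lin big_seq1/= mul1r.
rewrite (covar_lin covYE); last by move=> p; rewrite !inE => /eqP ->.
by rewrite !big_seq1/=; ring.
Qed.

(** Extends coefficients on one block by zero to all nodes, as the inequality of [tilt_iter]
    involves the whole list. *)
Lemma sum_supported (s ps : seq R) (c : R -> R) (y : R -> R) : uniq s -> uniq ps -> {subset ps <= s} ->
  \sum_(i < size s) (nth 1 s i \in ps)%:R * c (nth 1 s i) * y (nth 1 s i) = \sum_(a <- ps) c a * y a.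
Proof.
move=> us ups pss.
rewrite -(big_mkord xpredT (fun i => (nth 1 s i \in ps)%:R * c (nth 1 s i) * y (nth 1 s i))).
rewrite -(big_nth 1 xpredT (fun a => (a \in ps)%:R * c a * y a)).
rewrite (eq_bigr (fun a => if a \in ps then c a * y a else 0)); last first.
  by move=> a _; case: ifP => _; rewrite ?mul1r ?mul0r.
rewrite -big_mkcond -big_filter; apply: perm_big; apply: uniq_perm => //.
  exact: filter_uniq.
by move=> a; rewrite mem_filter; case: (boolP (a \in ps)) => // /pss ->.
Qed.

(* If [t] is a node, the combination [Y t - Y t] is available; otherwise [cauchy_approx_coef] gives one. *)
Lemma anchor_bound (s ps : seq R) (a tau k t : R) (b : (T -> R) -> (T -> R) -> R) :
  (forall W (c : nat -> R), linspan Y W -> b W W <=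
      covar P (fun w => W w + \sum_(i < size s) c i * Y (nth 1 s i) w)
              (fun w => W w + \sum_(i < size s) c i * Y (nth 1 s i) w)
      + \sum_(i < size s) c i ^+ 2 / a) ->
  0 < a -> uniq s -> uniq ps -> {subset ps <= s} -> 0 < tau ->
  {in ps, forall q, tau <= q <= 2 * tau} -> tau <= t <= 2 * tau ->
  0 < k <= 1 -> {in ps, forall p, k <= blaschke [seq q <- ps | q != p] p ^+ 2} ->
  b (Y t) (Y t) <= 9 ^- size ps / (2 * t) + 8 * (size ps)%:R / k / a.
Proof.
move=> bs a0 us ups pss tau0 psb /andP[t1 t2] /andP[k0 k1] kps.
have t0 : 0 < t by lra.
have ps0 : {in ps, forall q, 0 < q} by move=> q /psb; lra.
have {}bs (c : R -> R) : b (Y t) (Y t) <=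
      covar P (fun w => Y t w + \sum_(q <- ps) c q * Y q w)
              (fun w => Y t w + \sum_(q <- ps) c q * Y q w)
      + (\sum_(q <- ps) c q ^+ 2) / a.
  apply: le_trans (bs _ (fun i => (nth 1 s i \in ps)%:R * c (nth 1 s i)) (spanY Y t0)) _.
  under eq_fun do rewrite (sum_supported c (fun q => Y q _) us ups pss).
  rewrite lerD2l mulr_suml le_eqVlt; apply/orP; left; apply/eqP.
  under [RHS]eq_bigr do rewrite expr2 -mulrA.
  rewrite -(sum_supported c (fun q => c q / a) us ups pss).
  apply: eq_bigr => i _; case: (_ \in ps); last by rewrite !mul0r expr0n mul0r.
  by rewrite !mul1r expr2 mulrA.
have [tps|tps] := boolP (t \in ps).
  apply: le_trans (bs (fun q => - (q == t)%:R)) _.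
  have e1 (y : R -> R) : \sum_(q <- ps) - (q == t)%:R * y q = - y t.
    rewrite (bigD1_seq t)//= eqxx big1 ?addr0 ?mulN1r// => q /negbTE ->.
    by rewrite oppr0 mul0r.
  under eq_fun do rewrite (e1 (fun q => Y q _)) subrr.
  have -> : \sum_(q <- ps) (- (q == t)%:R) ^+ 2 = 1 :> R.
    under eq_bigr do rewrite expr2.
    by rewrite (e1 (fun q => - (q == t)%:R)) eqxx opprK.
  have -> : covar P (fun=> 0) (fun=> 0) = 0 :> R.
    by rewrite /covar; under eq_integral do rewrite mul0r; rewrite integral0.
  (* Exact cancellation costs only the penalty [a^-1], covered by the second term. *)
  rewrite add0r; apply: ler_wpDl; first by rewrite divr_ge0 ?mulr_ge0 ?(ltW t0)// invr_ge0 exprn_ge0.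
  rewrite mul1r ler_peMl ?invr_ge0 ?(ltW a0)// ler_pdivlMr// mul1r.
  have : 1 <= (size ps)%:R :> R by rewrite ler1n; case: (ps) tps.
  lra.
have [c [ct Nc cps]] := cauchy_approx_coef t0 ps0 ups tps k0 kps.
apply: le_trans (bs c) _; apply: lerD.
  have -> : (fun w => Y t w + \sum_(q <- ps) c q * Y q w) =
      (fun w => \sum_(q <- t :: ps) c q * Y q w).
    by apply/funext => w; rewrite big_cons ct mul1r.
  have s0 : {in t :: ps, forall q, 0 < q}.
    by move=> q; rewrite in_cons => /predU1P[->//|]; exact: ps0.
  rewrite (covar_bilin_sum covYE)//; apply: le_trans (bilin_covY_le c s0) _.
  rewrite Nc ler_wpM2r ?invr_ge0 ?mulr_ge0 ?(ltW t0)// -exprVn.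
  apply: blaschke_sqr_le => // q qps.
  have /andP[q1 q2] := psb _ qps.
  have tq : 0 < t + q by lra.
  rewrite expr_div_n ler_pdivrMr ?exprn_gt0// mulrC ler_pdivlMr//.
  (* Times within a factor 2 of each other satisfy [((t - q) / (t + q)) ^+ 2 <= 9^-1]. *)
  by rewrite -subr_ge0 (_ : _ - _ = 4 * (2 * t - q) * (2 * q - t)); [rewrite !mulr_ge0//; lra|ring].
rewrite ler_wpM2r ?invr_ge0 ?(ltW a0)//.
apply: (@le_trans _ _ (\sum_(q <- ps) 8 / k)).
  rewrite big_seq [leRHS]big_seq; apply: ler_sum => q qps.
  apply: le_trans (cps q qps) _; rewrite ler_wpM2r ?invr_ge0 ?(ltW k0)//.
  by rewrite ler_pdivrMr//; have := psb _ qps; lra.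
rewrite big_const_seq count_predT iter_addr_0 -[leLHS]mulr_natl.
by rewrite le_eqVlt; apply/orP; left; apply/eqP; ring.
Qed.

End process_bounds.

Lemma increasing_cover (R : realDomainType) (be : nat -> R) (t : R) :
  be 0%N < t -> (exists n, t <= be n) -> exists k, be k < t <= be k.+1.
Proof.
move=> t0 exn; case: (ex_minnP exn) => -[|k] tk kmin; first by have := lt_le_trans t0 tk; rewrite ltxx.
exists k; rewrite tk andbT ltNge; apply/negP => /kmin.
by rewrite ltnn.
Qed.

(* Time is cut into [N = u^6] cells of length [u^-4], up to time [u^2], then into dyadic cells. *)
Section cells.
Context {R : realType}.
Variables (u : R) (N : nat).
Hypotheses (u2 : 2 <= u) (Nu : N%:R = u ^+ 6).

(** Up to [N] the truncated subtraction makes the last factor 1; from [N] on the minimum freezes the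
    middle one. *)
Definition cell k : R := u ^- 4 * (minn k N)%:R * 2 ^+ (k - N).
(** For short cells the squared length, from [incY_le_sqr]. For the dyadic cell starting at
    [x = u ^+ 2 * 2 ^+ j] it is [(4 * x)^-1], from [incY_le_inv]; this is also the variance bound at
    its right end [2 * x]. *)
Definition cell_weight k : R := if (k < N)%N then u ^- 8 else u ^- 2 / 4 / 2 ^+ (k - N).

Let u0 : 0 < u. Proof. exact: lt_le_trans u2. Qed.
Let u1 : 1 <= u. Proof. by apply: le_trans u2; rewrite ler1n. Qed.
Let un0 n : 0 < u ^+ n. Proof. by rewrite exprn_gt0. Qed.

Lemma cell_small k : (k <= N)%N -> cell k = u ^- 4 * k%:R.
Proof. by move=> kN; rewrite /cell (minn_idPl kN) (eqP kN) expr0 mulr1. Qed.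

Lemma cell_large j : cell (N + j) = u ^+ 2 * 2 ^+ j.
Proof.
rewrite /cell (minn_idPr (leq_addr _ _)) addKn Nu.
by congr (_ * _); field; rewrite gt_eqF.
Qed.

Lemma cell_weight_large j : cell_weight (N + j) = u ^- 2 / 4 / 2 ^+ j.
Proof. by rewrite /cell_weight ltnNge leq_addr addKn. Qed.

Lemma cell_split k : (k < N)%N \/ exists j, k = (N + j)%N.
Proof. by case: (ltnP k N) => h; [left|right; exists (k - N)%N; rewrite subnKC]. Qed.

Lemma cell_ge0 k : 0 <= cell k.
Proof. by rewrite /cell !mulr_ge0 ?invr_ge0 ?exprn_ge0// ltW. Qed.

Lemma cell_lt k : cell k < cell k.+1.
Proof.
case: (cell_split k) => [kN|[j ->]].
  by rewrite !cell_small ?(ltnW kN)// ltr_pM2l ?invr_gt0// ltr_nat.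
by rewrite -addnS !cell_large ltr_pM2l// [2 ^+ j.+1]exprS ltr_pMl ?exprn_gt0//; lra.
Qed.

Lemma cell_cover t : 0 < t -> exists k, cell k < t <= cell k.+1.
Proof.
move=> t0; apply: increasing_cover; first by rewrite cell_small ?mulr0.
exists (N + (Num.truncn t).+1)%N; rewrite cell_large.
apply: le_trans (ltW (truncnS_gt t)) _.
rewrite -[leLHS]mul1r; apply: ler_pM => //; first exact: exprn_ege1.
by rewrite -natrX ler_nat ltnW// ltn_expl.
Qed.

Lemma cell_weight_ge0 k : 0 <= cell_weight k.
Proof.
by rewrite /cell_weight; case: ifP => _; rewrite ?divr_ge0 ?invr_ge0 ?exprn_ge0// ltW.
Qed.

Lemma cell_weight_sum n : \sum_(0 <= k < n) cell_weight k <= 2 * u ^- 2.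
Proof.
apply: (@le_trans _ _ (\sum_(0 <= k < N + n) cell_weight k)).
  rewrite [leRHS](big_cat_nat (n := n))//= ?leq_addl// lerDl sumr_ge0// => i _.
  exact: cell_weight_ge0.
rewrite (big_cat_nat (n := N))//= ?leq_addr//.
rewrite (eq_big_nat _ _ (F2 := fun=> u ^- 8)); last first.
  by move=> i /andP[_ iN]; rewrite /cell_weight iN.
rewrite big_const_nat subn0 iter_addr_0 -[u ^- 8 *+ N]mulr_natl Nu.
have -> : u ^+ 6 * u ^- 8 = u ^- 2 by field; rewrite gt_eqF.
rewrite -{1}(add0n N) big_addn addKn.
have -> : \sum_(0 <= i < n) cell_weight (i + N) = u ^- 2 / 2 * (1 - 2 ^- n).
  elim: n => [|n IH]; first by rewrite big_nil expr0 invr1 subrr mulr0.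
  rewrite big_nat_recr//= IH addnC cell_weight_large [2 ^+ n.+1]exprS.
  by field; rewrite !gt_eqF ?exprn_gt0.
have z0 : 0 <= u ^- 2 by rewrite invr_ge0 ltW.
have : 0 <= 2 ^- n :> R by rewrite invr_ge0 exprn_ge0.
move: (u ^- 2) z0 (2 ^- n : R) => z z0 y y0.
by nra.
Qed.

Lemma cell_incr k t s : cell k < t <= cell k.+1 -> cell k < s <= cell k.+1 ->
  incY t s <= cell_weight k * ((t - s) / (cell k.+1 - cell k)) ^+ 2.
Proof.
move=> /andP[t1 t2] /andP[s1 s2].
have t0 : 0 < t by exact: le_lt_trans (cell_ge0 k) t1.
have s0 : 0 < s by exact: le_lt_trans (cell_ge0 k) s1.
case: (cell_split k) => [kN|[j kE]].
  apply: le_trans (incY_le_sqr t0 s0) _.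
  rewrite /cell_weight kN !cell_small ?(ltnW kN)// -natr1 -mulrBr.
  rewrite (_ : k%:R + 1 - k%:R = 1); last by ring.
  by rewrite le_eqVlt; apply/orP; left; apply/eqP; field; rewrite gt_eqF.
apply: le_trans (incY_le_inv t0 s0) _.
rewrite kE -addnS cell_weight_large !cell_large.
rewrite kE cell_large in t1 s1.
have x0 : 0 < u ^+ 2 * 2 ^+ j by rewrite mulr_gt0// exprn_gt0.
have -> : u ^- 2 / 4 / 2 ^+ j * ((t - s) / (u ^+ 2 * 2 ^+ j.+1 - u ^+ 2 * 2 ^+ j)) ^+ 2
   = (t - s) ^+ 2 / (2 * (u ^+ 2 * 2 ^+ j) * (u ^+ 2 * 2 ^+ j) * (2 * (u ^+ 2 * 2 ^+ j))).
  have ? : 2 ^+ j != 0 :> R by rewrite gt_eqF ?exprn_gt0.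
  rewrite [2 ^+ j.+1]exprS (_ : u ^+ 2 * (2 * 2 ^+ j) - u ^+ 2 * 2 ^+ j = u ^+ 2 * 2 ^+ j); last by ring.
  by field; rewrite !gt_eqF// exprn_gt0.
move: (u ^+ 2 * 2 ^+ j) x0 t1 s1 => x x0 t1 s1.
rewrite ler_wpM2l ?sqr_ge0// lef_pV2 ?posrE ?mulr_gt0 ?addr_gt0//.
apply: ler_pM; rewrite ?mulr_ge0 ?addr_ge0 ?(ltW x0)//; last by lra.
by apply: ler_pM; rewrite ?mulr_ge0 ?(ltW x0) ?(ltW s1)//; lra.
Qed.

End cells.

Section small_ball_lower.
Context d (T : measurableType d) (R : realType) (P : probability T R).
Variable Y : R -> {RV P >-> R}.
Hypothesis gY : gaussian_process `]0%R, +oo[ Y.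
Hypothesis EY : forall t : R, 0 < t -> ('E_P[Y t] = 0)%E.
Hypothesis covYE : forall t s : R, 0 < t -> 0 < s ->
  ('E_P[fun w => (Y t w * Y s w)%R] = (covY t s)%:E)%E.
Hypothesis cY : {ae P, forall w, {within `]0, +oo[, continuous (fun t : R => Y t w)}}.

(* Weighting the at most [42 m ^ 2] nodes by [a = u ^+ 100], [u = 2 ^ m], costs a factor [u ^ (- 2121 m ^ 2)]
   at most and brings the variance at every cell end below [u ^- 8]. *)
Lemma small_ball_lower (m : nat) (A : set T) : (0 < m)%N -> measurable A ->
  (forall w, (forall t : R, 0 < t -> `|Y t w| <= 24 * 2 ^- m) -> A w) ->
  2 ^- (2122 * m ^ 3) <= fine (P A).
Proof.
move=> m0 mA AP.
have [u [uE mu u2]] : exists u : R, [/\ forall n, 2 ^+ (n * m) = u ^+ n, m%:R <= u & 2 <= u].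
  exists (2 ^+ m); split; first by move=> n; rewrite mulnC exprM.
    by rewrite -natrX ler_nat ltnW// ltn_expl.
  by rewrite -[leLHS]expr1 ler_weXn2l// ler1n.
have um : 2 ^+ m = u by rewrite -[m]mul1n uE.
have u0 : 0 < u by lra.
have u1 : 1 <= u by lra.
have un0 n : 0 < u ^+ n by rewrite exprn_gt0.
pose N := (2 ^ (6 * m))%N.
have Nu : N%:R = u ^+ 6 by rewrite natrX uE.
pose p := (6 * m)%N.
have p0 : (0 < p)%N by rewrite muln_gt0.
(* Adjacent dyadic blocks, from the first cell end [u ^- 4] to the end [tau p = u ^+ 2] of the short
   cells. *)
pose tau b : R := u ^- 4 * 2 ^+ b.
have tau0 b : 0 < tau b by rewrite mulr_gt0 ?invr_gt0// exprn_gt0.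
(* Each [b] gets a grid of a single block, since a time is approximated only from the block
   containing it. *)
pose s := undup (flatten [seq grid (tau b) 1 p | b <- iota 0 p.+1]).
have us : uniq s by exact: undup_uniq.
have gs b : (b <= p)%N -> {subset grid (tau b) 1 p <= s}.
  move=> bp q qg; rewrite mem_undup; apply/flatten_mapP; exists b => //.
  by rewrite mem_iota.
have s0 : {in s, forall q, 0 < q}.
  move=> q; rewrite mem_undup => /flatten_mapP[b _ qg].
  exact: lt_le_trans (tau0 b) (grid_ge (tau0 b) qg).
have ss : (size s <= 42 * m ^ 2)%N.
  apply: (leq_trans (size_undup _)).
  rewrite size_flatten /shape -map_comp.
  rewrite (eq_map (g := fun=> p)); last by move=> b; rewrite /= size_grid mul1n.
  rewrite sumnE big_map big_const_seq count_predT size_iota iter_addn_0.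
  by rewrite /p; nia.
(* Squared coefficients may reach the order of [k^-1 = u ^+ 84]; the remaining [u ^+ 16] brings the
   penalty below [u ^- 8 / 2]. *)
pose a := u ^+ 100.
have a0 : 0 < a by exact: un0.
pose X i : T -> R := Y (nth 1 s i).
have nth0 i : 0 < nth 1 s i.
  by case: (ltnP i (size s)) => h; [apply: s0; rewrite mem_nth|rewrite nth_default].
have HX i : linspan Y (X i) by apply: spanY.
have [M [b' [tG b'le _ Mlow _]]] :=
  tilt_iter (@spanD _ _ _ _ _) (@span_meas _ _ _ _ _) a0 HX
    (tilted_covar gY EY covYE) (size s).
have {}Mlow : (1 + a) ^- size s <= M ^+ 2.
  by apply: Mlow => i; rewrite (covar_one covYE)// covY_le1.
have M0 : 0 < M by exact: tilted_gt0 tG.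
have b'cov W : linspan Y W -> b' W W <= covar P W W.
  move=> HW; have := b'le W (fun=> 0) HW.
  rewrite [X in _ + X]big1 ?addr0; last by move=> i _; rewrite expr0n mul0r.
  by under eq_fun do [rewrite big1 ?addr0; last by move=> i _; rewrite mul0r].
(* Each of the at most [42 * m ^ 2] nodes costs at most [1 + a <= u ^+ 101] in [M ^+ 2]. The square
   root halves [101 * 42] to 2121, and one more unit pays for the factor 1/2. *)
have key K : (101 * 42 <= 2 * K)%N -> 2 ^- (K.+1 * m ^ 3) <= M / 2.
  move=> hK; rewrite expnSr mulnA uE; have q0 : (0 < m ^ 2)%N by rewrite expn_gt0 m0.
  move: (m ^ 2)%N q0 ss => q q0 sq.
  have a1 : 1 + a <= u ^+ 101.
    rewrite [leRHS]exprS -/a; have : 1 <= a by exact: exprn_ege1.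
    by nra.
  have h1 : u ^- (K * q) <= M.
    rewrite -ler_sqr ?nnegrE ?invr_ge0 ?(ltW (un0 _)) ?(ltW M0)//.
    apply: le_trans Mlow; rewrite exprVn -exprM.
    rewrite lef_pV2 ?posrE ?exprn_gt0//; last by rewrite addr_gt0.
    apply: (@le_trans _ _ ((u ^+ 101) ^+ size s)).
      by rewrite lerXn2r ?nnegrE ?addr_ge0 ?(ltW (un0 _)).
    rewrite -exprM ler_weXn2l// [leqRHS]mulnAC.
    apply: leq_trans (leq_mul (leqnn 101) sq) _; rewrite mulnA (mulnC K) leq_mul2r.
    by rewrite hK orbT.
  rewrite mulSn exprD invfM; have h2 : u ^- q <= 2^-1.
    rewrite lef_pV2 ?posrE//; apply: le_trans u2 _.
    by rewrite -[leLHS]expr1 ler_weXn2l.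
  rewrite mulrC; apply: ler_pM => //; by rewrite invr_ge0 ltW.
apply: (le_trans (key 2121%N isT)).
(* The weights sum to at most [2 * u ^- 2], and [6 * 2 <= 4 ^ 2]; [6 * lam] is the radius
   [24 * 2 ^- m]. *)
apply: (tilted_small_ball (lam := 4 / u) tG (cell_ge0 N u2) (cell_lt u2 Nu) (cell_cover u2 Nu)
  (cell_weight_ge0 N u2) (cell_weight_sum u2 Nu)) => //.
- by rewrite divr_gt0.
- rewrite (_ : (4 / u) ^+ 2 = 16 * u ^- 2); last by field; rewrite gt_eqF.
  have := un0 2; rewrite -invr_gt0; lra.
- move=> k; have t0 : 0 < cell u N k.+1.
    exact: le_lt_trans (cell_ge0 N u2 k) (cell_lt u2 Nu k).
  case: (cell_split N k) => [kN|[j kE]]; last first.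
    apply: le_trans (b'cov _ (spanY Y t0)) _.
    rewrite (covar_one covYE)//; apply: le_trans (covY_le_inv t0) _.
    rewrite kE -addnS cell_weight_large cell_large// [2 ^+ j.+1]exprS.
    rewrite le_eqVlt; apply/orP; left; apply/eqP; field.
    by rewrite !gt_eqF// exprn_gt0.
  have taup : tau p = u ^+ 2.
    by rewrite /tau uE; field; rewrite gt_eqF.
  have tS b : tau b.+1 = 2 * tau b by rewrite /tau [2 ^+ b.+1]exprS mulrCA.
  have tle : cell u N k.+1 <= tau p.
    rewrite taup -[u ^+ 2](_ : u ^- 4 * N%:R = _); last by rewrite Nu; field; rewrite gt_eqF.
    by rewrite cell_small// ler_pM2l ?invr_gt0// ler_nat.
  have tge : u ^- 4 <= cell u N k.+1 by rewrite cell_small// ler_peMr ?invr_ge0 ?(ltW (un0 _))// ler1n.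
  rewrite /cell_weight kN; move: (cell u N k.+1) t0 tle tge => t t0 tle tge.
  have [b [bp t1 t2]] : exists b, [/\ (b <= p)%N, tau b <= t & t <= 2 * tau b].
    (* [increasing_cover] is strict on the left, so the lower end of the first block is treated
       apart. *)
    have [tE|tn] := eqVneq t (tau 0%N).
      by exists 0%N; rewrite -tE; split => //; lra.
    have tlt : tau 0%N < t by rewrite lt_neqAle eq_sym tn /tau expr0 mulr1.
    have [b /andP[b1 b2]] := increasing_cover tlt (ex_intro _ p tle).
    exists b; rewrite -tS; split => //; last exact: ltW.
    rewrite leqNgt; apply/negP => pb; have := lt_le_trans b1 tle.
    by rewrite /tau ltr_pM2l ?invr_gt0// ltr_eXn2l ?ltr1n// ltnNge (ltnW pb).
  have kE : 2 ^- (14 * p) = u ^- 84 :> R by rewrite -uE /p mulnA.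
  apply: le_trans (anchor_bound (k := u ^- 84) covYE b'le a0 us
    (uniq_grid 1 p (tau0 b)) (gs b bp) (tau0 b) _ _ _ _) _.
  - move=> q qg; rewrite (grid_ge (tau0 b) qg)/=.
    have [b0 [j [+ jp ->]]] := gridP qg; rewrite ltnS leqn0 => /eqP ->.
    by have /andP[_ /ltW] := node_bounds 0 (tau0 b) jp; rewrite expr0 mulr1 mulrC.
  - by rewrite t1.
  - by rewrite invr_gt0 un0 invf_le1// exprn_ege1.
  - by move=> q qg; rewrite -kE; exact: grid_blaschke.
  rewrite size_grid mul1n.
  (* [9 ^- p <= 8 ^- p = u ^- 18], of which only [u ^- 12] is needed: [u ^- 4] compensates the
     smallest [t]. *)
  have h1 : 9 ^- p / (2 * t) <= u ^- 8 / 2.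
    rewrite invfM mulrCA (mulrC 2^-1) ler_pM2r// ler_pdivrMr//.
    apply: (@le_trans _ _ (u ^- 8 * u ^- 4)); last by rewrite ler_pM2l// invr_gt0.
    rewrite -invfM -exprD lef_pV2 ?posrE ?exprn_gt0//.
    apply: (@le_trans _ _ (8 ^+ p)); last by rewrite lerXn2r ?nnegrE//; lra.
    rewrite (_ : 8 = 2 ^+ 3 :> R); last by rewrite -natrX.
    by rewrite -exprM mulnA uE ler_weXn2l.
  have h2 : 8 * p%:R / u ^- 84 / a <= u ^- 8 / 2.
    rewrite /a -[100%N]/(84 + 16)%N exprD natrM.
    have -> : 8 * (6 * m%:R) / u ^- 84 / (u ^+ 84 * u ^+ 16) = 48 * m%:R / u ^+ 16.
      by move: (un0 84%N) => ?; field; rewrite !gt_eqF.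
    rewrite ler_pdivrMr// -[16%N]/(8 + 8)%N exprD.
    rewrite (_ : u ^- 8 / 2 * (u ^+ 8 * u ^+ 8) = u ^+ 8 / 2); last by field; rewrite gt_eqF.
    rewrite exprS; have h3 : 96 <= u ^+ 7.
      apply: (@le_trans _ _ (2 ^+ 7)); first by rewrite -natrX ler_nat.
      by rewrite lerXn2r ?nnegrE ?(ltW u0).
    have m1 : 0 <= m%:R :> R by [].
    by nra.
  by lra.
- move=> k t t' tk t'k.
  have t0 : 0 < t by have /andP[h _] := tk; exact: le_lt_trans (cell_ge0 N u2 k) h.
  have t'0 : 0 < t' by have /andP[h _] := t'k; exact: le_lt_trans (cell_ge0 N u2 k) h.
  apply: le_trans (b'cov _ _) _; first by apply: spanD; exact: spanY.
  by rewrite (covar_incr covYE)//; exact: cell_incr.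
- move=> w Yw; apply: AP => t t0; apply: le_trans (Yw t t0) _.
  by rewrite um; lra.
Qed.

End small_ball_lower.

(** * Radii near 1 *)

(** Half-angle formula, with [sin y <= y] in squared form from the mean value theorem. *)
Lemma cos_ge_half (R : realType) (x : R) : `|x| <= 1 -> 2^-1 <= cos x.
Proof.
wlog x0 : x / 0 <= x => [H|].
  have [/H//|/ltW xn] := leP 0 x.
  by rewrite -normrN -cosN => h; apply: H h; rewrite oppr_ge0.
rewrite ger0_norm// => x1; pose y := x / 2.
have y0 : 0 <= y by rewrite divr_ge0.
have y1 : y <= 2^-1 by rewrite ler_pdivrMr// mulVf.
have [c _] := @MVT_segment R sin cos 0 y y0 (fun u _ => is_derive_sin u)
  (continuous_subspaceT (@continuous_sin R)).
rewrite sin0 !subr0 => sy.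
have h : sin y ^+ 2 <= 4^-1.
  rewrite sy exprMn; have := sqr_ge0 (sin c); have := cos2Dsin2 c; have := sqr_ge0 (cos c).
  by have : y ^+ 2 <= 4^-1; nra.
have -> : cos x = 1 - 2 * sin y ^+ 2.
  rewrite (_ : x = y + y) ?cosD; last by rewrite /y; field.
  by have := cos2Dsin2 y; rewrite -!expr2; lra.
by lra.
Qed.

(** The mean of [cos (Y t)] has to fall below 2/3, which requires a variance near 1, hence a small
    [t]. At [t = 16^-1] two uses of [1 + x <= expR x] suffice. *)
Lemma covY_sixteenth (R : realType) : expR (- (covY 16^-1 16^-1) / 2) <= (289 / 355) ^+ 2 :> R.
Proof.
have h1 : expR (- 16^-1 - 16^-1) <= 256 / 289 :> R.
  rewrite (_ : - 16^-1 - 16^-1 = - (16^-1 + 16^-1)); last by lra.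
  rewrite expRN expRD -[leRHS]invrK invf_div lef_pV2 ?posrE ?mulr_gt0 ?expR_gt0 ?divr_gt0//.
  by have := expR_ge1Dx (16^-1 : R); nra.
have h2 : 264 / 289 <= covY 16^-1 16^-1 :> R.
  by rewrite /covY (_ : 16^-1 + 16^-1 = 8^-1) ?invrK; lra.
rewrite mulNr expRN (_ : (289 / 355) ^+ 2 = ((355 / 289) ^+ 2)^-1); last by rewrite -exprVn invf_div.
rewrite lef_pV2 ?posrE ?expR_gt0 ?exprn_gt0 ?divr_gt0//.
apply: (@le_trans _ _ (expR (66 / 289 + 66 / 289))); last by rewrite ler_expR; lra.
rewrite expRD; have := expR_ge1Dx (66 / 289 : R); nra.
Qed.

Section small_ball_lt1.
Context d (T : measurableType d) (R : realType) (P : probability T R).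
Variable Y : R -> {RV P >-> R}.
Hypothesis gY : gaussian_process `]0%R, +oo[ Y.
Hypothesis EY : forall t : R, 0 < t -> ('E_P[Y t] = 0)%E.
Hypothesis covYE : forall t s : R, 0 < t -> 0 < s ->
  ('E_P[fun w => (Y t w * Y s w)%R] = (covY t s)%:E)%E.

(* The trigonometric polynomial [1 + cos (2x) / 2 - 3/2 cos x = (cos x - 1) (cos x - 1/2)]
   is nonpositive on [-1, 1], but its mean under a Gaussian law of variance near 1 is positive. *)
Lemma small_ball_lt1 (A : set T) : measurable A ->
  (forall w, A w -> forall t : R, 0 < t -> `|Y t w| < 1) ->
  fine (P A) <= 599 / 600.
Proof.
move=> mA AY; pose t : R := 16^-1; have t0 : 0 < t by rewrite invr_gt0.
pose W : T -> R := Y t; pose W2 w := W w + 1 * W w.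
have sW : linspan Y W by exact: spanY.
have sW2 : linspan Y W2 by exact: spanD.
have Ecos V : linspan Y V -> (\int[P]_w (cos (V w))%:E = (expR (- covar P V V / 2))%:E)%E.
  move=> sV; rewrite -[X in _ = X%:E]mul1r -(tilted_cos (tilted_covar gY EY covYE) sV).
  by apply: eq_integral => w _; rewrite mulr1.
have icos V : linspan Y V -> P.-integrable setT (fun w => (cos (V w))%:E).
  move=> sV; apply: (@le_integrable _ T R P setT measurableT _ (fun=> 1%:E)).
  - apply/measurable_EFinP; apply: measurableT_comp; last exact: span_meas sV.
    by apply: continuous_measurable_fun; exact: continuous_cos.
  - by move=> w _; rewrite lee_fin normr1; exact: cos_max.
  - exact: finite_measure_integrable_cst.
have i1 : P.-integrable setT (fun w => (2^-1)%:E * (cos (W2 w))%:E)%E.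
  by apply: integrableZl => //; exact: icos.
have i2 : P.-integrable setT (fun w => (- (3 / 2))%:E * (cos (W w))%:E)%E.
  by apply: integrableZl => //; exact: icos.
have i3 : P.-integrable setT (fun w => 1%:E : \bar R) by exact: finite_measure_integrable_cst.
have mB : measurable (~` A) by exact: measurableC.
have i4 : P.-integrable setT (fun w => 3%:E * (\1_(~` A) w)%:E)%E.
  by apply: integrableZl => //; exact: integrable_indic.
(* 3 is the maximum of the polynomial, reached where the cosine is -1. *)
have H : (\int[P]_w ((2^-1)%:E * (cos (W2 w))%:E + ((- (3 / 2))%:E * (cos (W w))%:E + 1%:E))
    <= \int[P]_w (3%:E * (\1_(~` A) w)%:E))%E.
  apply: le_integral => // [|w _]; first by do 2?apply: integrableD.
  rewrite -!EFinM -!EFinD lee_fin /W2 mul1r cosD -!expr2.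
  have := cos2Dsin2 (W w); have := cos_le1 (W w); have := cos_geN1 (W w).
  have [Aw|nAw] := pselect (A w).
    have := cos_ge_half (ltW (AY w Aw t t0)).
    rewrite indicE memNset; last by apply.
    rewrite mulr0 -/(W w); move: (cos (W w)) (sin (W w)) => x y; nra.
  rewrite indicE mem_set// mulr1; move: (cos (W w)) (sin (W w)) => x y; nra.
move: H; rewrite integralD//; last exact: integrableD.
rewrite integralD// !integralZl//; [|exact: integrable_indic|exact: icos..].
rewrite !Ecos// integral_cst// [X in (_ + (_ + X))%E](_ : _ = 1%E); last first.
  by rewrite mul1e; exact: probability_setT.
rewrite integral_indic// setIT.
have PA : P A \is a fin_num by rewrite fin_num_measure.
rewrite [X in (3%:E * X)%E](_ : _ = (1 - fine (P A))%:E); last first.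
  by rewrite EFinB fineK//; exact: probability_setC.
rewrite -!EFinM -!EFinD lee_fin.
rewrite (covar_one covYE)//.
(* The mean of [cos (W2 w)] is positive, and [1 - 3 / 2 * (289 / 355) ^+ 2 >= 1 / 200]; dividing by
   3 gives 1/600. *)
have := expR_ge0 (- covar P W2 W2 / 2); have := covY_sixteenth R.
by rewrite -/t; move: (expR _) (expR _) => e e'; lra.
Qed.

End small_ball_lt1.

(** * From powers of 2 to logarithms *)

Lemma expR_nln2 (R : realType) (n : nat) : expR (- (n%:R * ln 2)) = 2 ^- n :> R.
Proof. by rewrite expRN mulrC expRM_natr lnK// posrE. Qed.

Lemma lne_le (R : realType) (p y : R) : p <= expR y -> (lne p%:E <= y%:E)%E.
Proof.
move=> py; have [p0|p0] := leP p 0; first by rewrite le0_lneNy ?lee_fin ?leNye.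
by rewrite lne_EFin// lee_fin -ler_expR lnK.
Qed.

Lemma lne_ge (R : realType) (p y : R) : expR y <= p -> (y%:E <= lne p%:E)%E.
Proof.
move=> yp; have p0 : 0 < p by apply: lt_le_trans yp; exact: expR_gt0.
by rewrite lne_EFin// lee_fin -ler_expR lnK.
Qed.

Lemma small_ball_eventP d (T : measurableType d) (R : realType) (P : probability T R)
    (Y : R -> {RV P >-> R}) (eps t : R) (w : T) :
  small_ball_event `]0%R, +oo[ Y eps w -> 0 < t -> `|Y t w| < eps.
Proof.
rewrite /small_ball_event /sup_abs/= => h t0; rewrite -lte_fin; apply: le_lt_trans h.
by apply: ereal_sup_ubound; exists t => //=; rewrite in_itv/= andbT.
Qed.

Lemma small_ball_event_le d (T : measurableType d) (R : realType) (P : probability T R)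
    (Y : R -> {RV P >-> R}) (eps c : R) (w : T) : c < eps ->
  (forall t : R, 0 < t -> `|Y t w| <= c) -> small_ball_event `]0%R, +oo[ Y eps w.
Proof.
move=> ce Yc; rewrite /small_ball_event /sup_abs/=.
apply: (@le_lt_trans _ _ c%:E); last by rewrite lte_fin.
apply: ge_ereal_sup => _ [t /= + <-]; rewrite in_itv/= andbT => t0.
by rewrite lee_fin; exact: Yc.
Qed.

(* The lower bound cannot hold with one constant C2 up to eps = 1: there the
   probability stays below 1 while |log eps| tends to 0.  Hence C2 may depend on
   an arbitrary cutoff eps0 < 1; C1 serves the whole range 0 < eps < 1. *)
Theorem theorem1p2 (R : realType) :
  exists C1 : R, 0 < C1 /\
  forall eps0 : R, 0 < eps0 < 1 ->
  exists C2 : R, 0 < C2 /\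
  forall (d : measure_display) (T : measurableType d) (P : probability T R)
    (Y : R -> {RV P >-> R}),
  gaussian_process `]0%R, +oo[ Y ->
  (forall t : R, 0 < t -> ('E_P[Y t] = 0)%E) ->
  (forall t s : R, 0 < t -> 0 < s ->
     ('E_P[fun w => (Y t w * Y s w)%R]
      = ((1 - expR (- t - s)) / (t + s))%:E)%E) ->
  {ae P, forall w, {within `]0, +oo[, continuous (fun t : R => Y t w)}} ->
  forall eps : R, 0 < eps < 1 ->
  measurable (small_ball_event `]0%R, +oo[ Y eps) ->
  (lne (P (small_ball_event `]0%R, +oo[ Y eps))
     <= (- C1 * `|ln eps| ^+ 3)%:E)%E /\
  (eps <= eps0 ->
   ((- C2 * `|ln eps| ^+ 3)%:E
     <= lne (P (small_ball_event `]0%R, +oo[ Y eps)))%E).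
Proof.
have l2 : 0 < ln 2 :> R by rewrite ln_gt0// ltr1n.
have [q [q0 q1 qE]] : exists q : R, [/\ 0 < q, q < 1 & forall x, x <= 599 / 600 -> x <= q].
  by exists (599 / 600); split; [lra|lra|move=> x].
pose de : R := - ln q.
have de0 : 0 < de by rewrite oppr_gt0 ln_lt0// q0.
(* Write [eps = 2 ^- (64 x)]. For [x >= 1] rounding [x] down to [r] costs at most a factor 8 in the
   cube; for [x < 1] the bound [q] suffices, since [x ^+ 3 <= 1]. *)
pose c := Num.min (50 * ln 2 / 8) de.
have c0 : 0 < c by rewrite lt_min de0 andbT divr_gt0// mulr_gt0.
have c1 : c <= 50 * ln 2 / 8 by rewrite ge_min lexx.
have c2 : c <= de by rewrite ge_min lexx orbT.
exists (c / (64 * ln 2) ^+ 3); split; first by rewrite divr_gt0// exprn_gt0// mulr_gt0.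
move=> eps0 /andP[eps00 eps01].
pose L0 := - ln eps0; have L00 : 0 < L0 by rewrite oppr_gt0 ln_lt0// eps00.
have l24 : 0 < ln 24 :> R by rewrite ln_gt0// ltr1n.
(* Chosen so that [m <= (L + ln 24 + ln 2) / ln 2 <= B * L] as soon as [L0 <= L]; this is how the
   cutoff enters the constant. *)
pose B := (1 + (ln 24 + ln 2) / L0) / ln 2.
have B0 : 0 < B by rewrite divr_gt0// addr_gt0// divr_gt0// addr_gt0.
have [k kE] : exists k, k = 2122%N by exists 2122%N.
pose K : R := k%:R * ln 2.
have K0 : 0 < K by rewrite mulr_gt0// ltr0n kE.
exists (K * B ^+ 3); split; first by rewrite mulr_gt0// exprn_gt0.
move=> d T P Y gY EY covYE cY eps /andP[e0 e1] mA.
set A := small_ball_event _ _ _ in mA *.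
have PA : P A = (fine (P A))%:E by rewrite fineK// fin_num_measure.
have Ale w t : A w -> 0 < t -> `|Y t w| < eps by exact: small_ball_eventP.
rewrite ltr0_norm; last by rewrite ln_lt0// e0.
set L := - ln eps; have L1 : 0 < L by rewrite oppr_gt0 ln_lt0// e0.
have epsE : eps = expR (- L) by rewrite opprK lnK.
split.
  rewrite PA; apply: lne_le.
  pose x := L / (64 * ln 2).
  have x0 : 0 < x by rewrite divr_gt0// mulr_gt0.
  have -> : - (c / (64 * ln 2) ^+ 3) * L ^+ 3 = - (c * x ^+ 3).
    by rewrite /x; field; rewrite gt_eqF.
  have [x1|x1] := leP 1 x; last first.
    apply: (@le_trans _ _ q).
      apply: qE; apply: (small_ball_lt1 gY EY covYE) => // w Aw t t0.
      exact: lt_trans (Ale w t Aw t0) e1.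
    rewrite -[leLHS]lnK ?posrE// -[X in expR X <= _]opprK -/de.
    rewrite ler_expR lerN2; apply: le_trans c2; apply: ler_piMr; first exact: ltW.
    by rewrite exprn_ile1// ltW.
  pose r := Num.truncn x.
  have /andP[rx xr] : r%:R <= x < r.+1%:R by apply: truncn_itv; exact: ltW.
  have r0 : (0 < r)%N by rewrite -ltnS -(ltr_nat R); exact: le_lt_trans x1 xr.
  apply: (@le_trans _ _ (2 ^- (50 * r ^ 3))).
    apply: (small_ball_upper gY EY covYE r0 e0) => // [|w Aw t t0]; last exact: Ale.
    rewrite -expR_nln2 epsE ler_expR lerN2 natrM.
    move: rx; rewrite /x ler_pdivlMr ?mulr_gt0//; lra.
  rewrite -expR_nln2 ler_expR lerN2 natrM natrX.
  have x2 : x <= 2 * r%:R.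
    by move: xr; rewrite -natr1; have : 1 <= r%:R :> R; [rewrite ler1n|lra].
  have x3 : x ^+ 3 <= 8 * r%:R ^+ 3.
    rewrite (_ : 8 * r%:R ^+ 3 = (2 * r%:R) ^+ 3); last by ring.
    by apply: lerXn2r => //; rewrite nnegrE; [exact: ltW|exact: mulr_ge0].
  have r3 : 0 <= r%:R ^+ 3 :> R by rewrite exprn_ge0.
  apply: le_trans (ler_wpM2l (ltW c0) x3) _.
  move: (r%:R ^+ 3) r3 => z z0.
  by have := ler_wpM2r z0 c1; lra.
move=> ee0; rewrite PA; apply: lne_ge.
have LL0 : L0 <= L by rewrite lerN2 ler_ln ?posrE.
pose y := (L + ln 24) / ln 2.
have y0 : 0 <= y by rewrite divr_ge0 ?(ltW l2)// addr_ge0// ltW.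
(* Strictly above [y], so that [24 * 2 ^- m < eps], as the strict inequality in the event
   demands. *)
pose m := (Num.truncn y).+1.
have /andP[m1 m2] : (Num.truncn y)%:R <= y < m%:R by exact: truncn_itv.
have mB : m%:R <= B * L.
  apply: (@le_trans _ _ (y + 1)); first by rewrite -natr1 lerD2r.
  have -> : B * L = (L + (ln 24 + ln 2) * (L / L0)) / ln 2.
    by rewrite /B; field; rewrite !gt_eqF.
  have -> : y + 1 = (L + (ln 24 + ln 2)) / ln 2 by rewrite /y; field; rewrite gt_eqF.
  rewrite ler_pM2r ?invr_gt0// lerD2l ler_peMr ?addr_ge0 ?(ltW l24) ?(ltW l2)//.
  by rewrite ler_pdivlMr// mul1r.
apply: (@le_trans _ _ (2 ^- (k * m ^ 3))); last first.
  rewrite kE; apply: (small_ball_lower gY EY covYE cY) => // w Yw.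
  apply: (small_ball_event_le _ Yw).
  rewrite -expR_nln2 epsE -[24]lnK ?posrE// -expRD ltr_expR.
  by move: m2; rewrite ltr_pdivrMr//; lra.
rewrite -expR_nln2 ler_expR mulNr lerN2 natrM natrX.
rewrite (_ : K * B ^+ 3 * L ^+ 3 = K * (B * L) ^+ 3); last by ring.
rewrite /K mulrAC ler_pM2l//.
by rewrite lerXn2r ?nnegrE// mulr_ge0// ltW.
Qed.
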